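(* A Riemannian twisted product $B\times_f F$ is pointwise Osserman if and only if it is a space of constant sectional curvature.
   Context: Given Riemannian manifolds $(B,g_B)$ and $(F,g_F)$ and a positive function $f:B\times F\to\mathbb{R}^+$ on $B\times F$, the Riemannian twisted product $B\times_f F$ is the product manifold $B\times F$ endowed with the Riemannian metric $g=g_B\oplus f^2 g_F$. Let $(M,g)$ be a Riemannian manifold with Levi-Civita connection $\nabla$ and curvature tensor $R(X,Y)=\nabla_{[X,Y]}-[\nabla_X,\nabla_Y]$. The Jacobi operator is $\mathcal{J}(X)Y=R(X,Y)X$. $(M,g)$ is pointwise Osserman if for every $p\in M$ the Jacobi operator has constant eigenvalues on the unit tangent sphere $S_p=\{x\in T_pM: g_p(x,x)=1\}$ (the eigenvalues may depend on $p$).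
   Formalization: B and F are assumed connected, each of dimension at least 1, with total dimension at least 3: otherwise the claim fails (surfaces are always pointwise Osserman; a point times CP^2; disconnected products with different constant curvatures on components). *)

(* Defs.v *)
From HB Require Import structures.
From mathcomp Require Import all_boot all_order all_algebra ring.
From mathcomp Require Import all_classical all_reals all_analysis.

Set Implicit Arguments.
Unset Strict Implicit.
Unset Printing Implicit Defensive.

Import Order.TTheory GRing.Theory Num.Theory.
Import numFieldNormedType.Exports.

Local Open Scope classical_set_scope.
Local Open Scope ring_scope.

Definition pderiv (R : realType) (n : nat) (V : normedModType R) (i : 'I_n)
    (f : 'rV[R]_n -> V) : 'rV[R]_n -> V :=
  'D_(delta_mx 0 i) f.

Fixpoint Ck_on (R : realType) (n k : nat) (U : set 'rV[R]_n)
    (f : 'rV[R]_n -> R) : Prop :=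
  (forall x, U x -> {for x, continuous f}) /\
  if k is k'.+1 then
    (forall x i, U x -> derivable f x (delta_mx 0 i)) /\
    (forall i, Ck_on k' U (pderiv i f))
  else True.

Definition smooth_on (R : realType) (n : nat) (U : set 'rV[R]_n)
    (f : 'rV[R]_n -> R) : Prop :=
  forall k, Ck_on k U f.

Section SmoothTheory.
Variable R : realType.

Lemma cvg_mx (T : Type) (F : set_system T) {FF : Filter F} (m n : nat)
    (M : T -> 'M[R]_(m, n)) (A : 'M[R]_(m, n)) :
  (forall i j, M x i j @[x --> F] --> A i j) -> M @ F --> A.
Proof.
move=> MA P [Q QA QP]; rewrite nbhs_filterE /=.
apply: (@filterS _ F FF [set x | forall i j, Q i j (M x i j)]).
  by move=> x; apply: QP.
apply: filter_forall => i; apply: filter_forall => j.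
exact: MA (QA i j).
Qed.

Lemma Ck_on_sub n k (U V : set 'rV[R]_n) f :
  V `<=` U -> Ck_on k U f -> Ck_on k V f.
Proof.
move=> VU; elim: k f => [|k IH] f /= [cf df]; split=> //.
- by move=> x /VU; exact: cf.
- by move=> x /VU; exact: cf.
- have [der Ckd] := df; split; first by move=> x i /VU; exact: der.
  by move=> i; exact: IH.
Qed.

Lemma smooth_on_sub n (U V : set 'rV[R]_n) f :
  V `<=` U -> smooth_on U f -> smooth_on V f.
Proof. by move=> VU sf k; exact: Ck_on_sub VU (sf k). Qed.

Lemma near_continuous (S T : topologicalType) (f g : S -> T) x :
  (\near x, f x = g x) -> {for x, continuous f} -> {for x, continuous g}.
Proof.
move=> fg cf; have fgx := nbhs_singleton fg.
rewrite /prop_for /continuous_at -fgx; apply: cvg_trans cf.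
exact: near_eq_cvg.
Qed.

Lemma Ck_on_eq n k (U : set 'rV[R]_n) f g :
  open U -> (forall x, U x -> f x = g x) -> Ck_on k U f -> Ck_on k U g.
Proof.
move=> oU; elim: k f g => [|k IH] f g fg /= [cf df];
  have fgn x : U x -> \near x, f x = g x by
    move=> Ux; apply: filterS (open_nbhs_nbhs (conj oU Ux)) => y; exact: fg.
  by split=> // x Ux; apply: near_continuous (fgn x Ux) (cf x Ux).
have [der Ckd] := df; split; [|split].
- by move=> x Ux; apply: near_continuous (fgn x Ux) (cf x Ux).
- by move=> x i Ux; apply: near_eq_derivable (der x i Ux); exact: fgn.
- move=> i; apply: IH (Ckd i) => x Ux; rewrite /pderiv.
  by apply: near_eq_derive; exact: fgn.
Qed.

Lemma smooth_on_eq n (U : set 'rV[R]_n) f g :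
  open U -> (forall x, U x -> f x = g x) -> smooth_on U f -> smooth_on U g.
Proof. by move=> oU fg sf k; exact: Ck_on_eq oU fg (sf k). Qed.

Lemma pderiv_cst n (V : normedModType R) (a : V) (i : 'I_n) :
  pderiv i (fun=> a) = (fun=> 0).
Proof. by apply/funext => x; rewrite /pderiv derive_cst. Qed.

Lemma smooth_on_cst n (U : set 'rV[R]_n) (a : R) : smooth_on U (fun=> a).
Proof.
move=> k; elim: k a => [|k IH] a; first by split=> // x _; exact: cst_continuous.
split; first by move=> x _; exact: cst_continuous.
split; first by move=> x i _; exact: derivable_cst.
by move=> i; rewrite pderiv_cst; exact: IH.
Qed.

Lemma Ck_on_pred n k (U : set 'rV[R]_n) f : Ck_on k.+1 U f -> Ck_on k U f.
Proof.
elim: k f => [|k IH] f; first by case.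
move=> [cf [der Ckd]]; split=> //; split=> // i; exact: IH.
Qed.

Lemma Ck_onD n k (U : set 'rV[R]_n) f g : open U ->
  Ck_on k U f -> Ck_on k U g -> Ck_on k U (fun x => f x + g x).
Proof.
move=> oU; elim: k f g => [|k IH] f g [cf df] [cg dg].
  by split=> // x Ux; apply: (@continuousD _ R^o); [exact: cf|exact: cg].
have [df1 df2] := df; have [dg1 dg2] := dg; split; [|split].
- by move=> x Ux; apply: (@continuousD _ R^o); [exact: cf|exact: cg].
- by move=> x i Ux; apply: (@derivableD _ _ R^o); [exact: df1|exact: dg1].
- move=> i; apply: (@Ck_on_eq _ _ _ (fun x => pderiv i f x + pderiv i g x)) => //.
    by move=> x Ux; rewrite /pderiv -(@deriveD _ _ R^o) //;
      [exact: df1|exact: dg1].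
  exact: IH (df2 i) (dg2 i).
Qed.

Lemma Ck_onM n k (U : set 'rV[R]_n) f g : open U ->
  Ck_on k U f -> Ck_on k U g -> Ck_on k U (fun x => f x * g x).
Proof.
move=> oU; elim: k f g => [|k IH] f g Ckf Ckg.
  have [cf _] := Ckf; have [cg _] := Ckg.
  by split=> // x Ux; apply: continuousM; [exact: cf|exact: cg].
have [cf [df1 df2]] := Ckf; have [cg [dg1 dg2]] := Ckg; split; [|split].
- by move=> x Ux; apply: continuousM; [exact: cf|exact: cg].
- by move=> x i Ux; apply: derivableM; [exact: df1|exact: dg1].
- move=> i; apply: (@Ck_on_eq _ _ _
    (fun x => f x * pderiv i g x + g x * pderiv i f x)) => //.
    by move=> x Ux; rewrite /pderiv deriveM //; [exact: df1|exact: dg1].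
  by apply: Ck_onD => //; apply: IH => //; try exact: Ck_on_pred; [exact: dg2|exact: df2].
Qed.

Lemma smooth_onD n (U : set 'rV[R]_n) f g : open U ->
  smooth_on U f -> smooth_on U g -> smooth_on U (fun x => f x + g x).
Proof. by move=> oU sf sg k; exact: Ck_onD. Qed.

Lemma smooth_onM n (U : set 'rV[R]_n) f g : open U ->
  smooth_on U f -> smooth_on U g -> smooth_on U (fun x => f x * g x).
Proof. by move=> oU sf sg k; exact: Ck_onM. Qed.

Lemma derive_comp_linear (V V' W : normedModType R) (L : {linear V -> V'})
    (f : V' -> W) x v :
  'D_v (f \o L) x = 'D_(L v) f (L x) /\
  (derivable (f \o L) x v <-> derivable f (L x) (L v)).
Proof.
have e : (fun h : R => h^-1 *: (((f \o L) \o shift x) (h *: v) - (f \o L) x)) =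
         (fun h : R => h^-1 *: ((f \o shift (L x)) (h *: L v) - f (L x))).
  by apply/funext => h /=; rewrite linearP.
by rewrite /derive /derivable e.
Qed.

Lemma continuous_linear_rV m n (L : {linear 'rV[R]_m -> 'rV[R]_n})
    (s : 'I_n -> 'I_m) : (forall x j, L x 0 j = x 0 (s j)) -> continuous L.
Proof.
move=> Ls x; apply: (@cvg_mx _ (nbhs x) (nbhs_filter x)) => i j; rewrite !ord1.
under [X in X @ _ --> _]eq_fun do rewrite Ls.
rewrite Ls; exact: coord_continuous.
Qed.

Lemma Ck_on_comp_linear m n k (L : {linear 'rV[R]_m -> 'rV[R]_n})
    (s : 'I_n -> 'I_m) (U : set 'rV[R]_n) f :
  injective s -> (forall x j, L x 0 j = x 0 (s j)) ->
  Ck_on k U f -> Ck_on k (L @^-1` U) (f \o L).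
Proof.
move=> sI Ls; have Lc := continuous_linear_rV Ls.
have Le i : (exists2 j, i = s j & L (delta_mx 0 i) = delta_mx 0 j) \/
            L (delta_mx 0 i) = 0.
  have [[j ->]|nij] := pselect (exists j, i = s j); [left|right].
    exists j => //; apply/rowP => j'; rewrite Ls !mxE !eqxx /=.
    by rewrite (inj_eq sI).
  apply/rowP => j; rewrite Ls !mxE eqxx /=; case: eqP => // e.
  by case: nij; exists j.
elim: k f => [|k IH] f [cf df].
  by split=> // x Ux; apply: continuous_comp; [exact: Lc|exact: cf].
have [der Ckd] := df; split; [|split].
- by move=> x Ux; apply: continuous_comp; [exact: Lc|exact: cf].
- move=> x i Ux; apply/(derive_comp_linear _ _ _ _).2.
  have [[j _ ->]|->] := Le i; first exact: der.
  exact: derivable0.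
- move=> i; have [[j _ e]|e] := Le i.
    have -> : pderiv i (f \o L) = pderiv j f \o L.
      by apply/funext => x; rewrite /pderiv (derive_comp_linear _ _ _ _).1 e.
    exact: IH (Ckd j).
  have -> : pderiv i (f \o L) = fun=> 0.
    by apply/funext => x; rewrite /pderiv (derive_comp_linear _ _ _ _).1 e derive0.
  exact: smooth_on_cst.
Qed.

Lemma lsubmxE' m n (x : 'rV[R]_(m + n)) j : lsubmx x 0 j = x 0 (lshift n j).
Proof. by rewrite mxE. Qed.

Lemma rsubmxE' m n (x : 'rV[R]_(m + n)) j : rsubmx x 0 j = x 0 (rshift m j).
Proof. by rewrite mxE. Qed.

Lemma lsubmx_continuous m n : continuous (@lsubmx R 1 m n).
Proof. exact: continuous_linear_rV (@lsubmxE' m n). Qed.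

Lemma rsubmx_continuous m n : continuous (@rsubmx R 1 m n).
Proof. exact: continuous_linear_rV (@rsubmxE' m n). Qed.

Lemma smooth_on_lsubmx m n (U : set 'rV[R]_m) f :
  smooth_on U f -> smooth_on (lsubmx @^-1` U) (fun x : 'rV_(m + n) => f (lsubmx x)).
Proof.
move=> sf k.
exact: (Ck_on_comp_linear (@lshift_inj m n) (@lsubmxE' m n) (sf k)).
Qed.

Lemma smooth_on_rsubmx m n (U : set 'rV[R]_n) f :
  smooth_on U f -> smooth_on (rsubmx @^-1` U) (fun x : 'rV_(m + n) => f (rsubmx x)).
Proof.
move=> sf k.
exact: (Ck_on_comp_linear (@rshift_inj m n) (@rsubmxE' m n) (sf k)).
Qed.

End SmoothTheory.

Record chart (R : realType) (n : nat) (T : topologicalType) := Chart {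
  source : set T;
  target : set 'rV[R]_n;
  to_coord : T -> 'rV[R]_n;
  of_coord : 'rV[R]_n -> T;
  source_open : open source;
  target_open : open target;
  to_coord_target : forall p, source p -> target (to_coord p);
  of_coord_source : forall x, target x -> source (of_coord x);
  to_coordK : forall p, source p -> of_coord (to_coord p) = p;
  of_coordK : forall x, target x -> to_coord (of_coord x) = x;
  to_coord_continuous : forall p, source p -> {for p, continuous to_coord};
  of_coord_continuous : forall x, target x -> {for x, continuous of_coord}
}.

Definition transition (R : realType) (n : nat) (T : topologicalType)
    (c d : chart R n T) : 'rV[R]_n -> 'rV[R]_n :=
  fun x => to_coord d (of_coord c x).

Definition transition_dom (R : realType) (n : nat) (T : topologicalType)
    (c d : chart R n T) : set 'rV[R]_n :=
  [set x | target c x /\ source d (of_coord c x)].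

(* The atlas need not be maximal; it is indexed so that data can be attached to
   each of its charts. *)
Record manifold (R : realType) (n : nat) := Manifold {
  point_of :> topologicalType;
  atlas : Type;
  chart_of : atlas -> chart R n point_of;
  chart_cover : forall p, exists c, source (chart_of c) p;
  chart_compat : forall c d j,
    smooth_on (transition_dom (chart_of c) (chart_of d))
              (fun x => transition (chart_of c) (chart_of d) x 0 j);
  manifold_hausdorff : hausdorff_space point_of;
  manifold_second_countable : @second_countable point_of
}.

Definition smooth_function (R : realType) (n : nat) (M : manifold R n)
    (f : M -> R) : Prop :=
  forall c : atlas M,
    smooth_on (target (chart_of c)) (fun x => f (of_coord (chart_of c) x)).

(* Tangent vectors are row vectors of coordinates, so the Jacobian matrix acts
   on the right: the differential of phi at x is v |-> v *m jac phi x. *)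
Definition jac (R : realType) (n : nat) (phi : 'rV[R]_n -> 'rV[R]_n)
    (x : 'rV[R]_n) : 'M[R]_n :=
  \matrix_(i, j) pderiv i (fun y => phi y 0 j) x.

Record riemannian_metric (R : realType) (n : nat) (M : manifold R n) :=
  RiemannianMetric {
  gram : atlas M -> 'rV[R]_n -> 'M[R]_n;
  gram_smooth : forall c i j,
    smooth_on (target (chart_of c)) (fun x => gram c x i j);
  gram_sym : forall c x, target (chart_of c) x -> (gram c x)^T = gram c x;
  gram_posdef : forall c x (v : 'rV[R]_n), target (chart_of c) x -> v != 0 ->
    0 < (v *m gram c x *m v^T) 0 0;
  gram_compat : forall c d x,
    transition_dom (chart_of c) (chart_of d) x ->
    let phi := transition (chart_of c) (chart_of d) in
    gram c x = jac phi x *m gram d (phi x) *m (jac phi x)^T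
}.

Section LocalGeometry.
Variables (R : realType) (n : nat).
Implicit Types (G : 'rV[R]_n -> 'M[R]_n) (X Y Z : 'rV[R]_n -> 'rV[R]_n).
Implicit Types (U : set 'rV[R]_n) (x u v w : 'rV[R]_n).

Definition inner (A : 'M[R]_n) v w : R := (v *m A *m w^T) 0 0.

Definition dirderiv (V : normedModType R) X (f : 'rV[R]_n -> V) :
    'rV[R]_n -> V :=
  fun x => \sum_i X x 0 i *: pderiv i f x.

Definition bracket X Y : 'rV[R]_n -> 'rV[R]_n :=
  fun x => dirderiv X Y x - dirderiv Y X x.

Definition connection (Gam : 'rV[R]_n -> 'I_n -> 'I_n -> 'I_n -> R) X Y :
    'rV[R]_n -> 'rV[R]_n :=
  fun x => dirderiv X Y x +
    \row_k \sum_i \sum_j X x 0 i * Y x 0 j * Gam x i j k.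

(* [christoffel G x i j k] is the symbol with lower indices i, j and upper
   index k; by [levi_civitaP] it yields the unique affine connection that is
   torsion free and compatible with G. *)
Definition christoffel G x (i j k : 'I_n) : R :=
  2^-1 * \sum_l invmx (G x) k l *
    (pderiv i (fun y => G y j l) x + pderiv j (fun y => G y i l) x
     - pderiv l (fun y => G y i j) x).

Definition nabla G := connection (christoffel G).

Definition smooth_field U X : Prop :=
  forall j, smooth_on U (fun x => X x 0 j).

Definition levi_civita U G
    (nab : ('rV[R]_n -> 'rV[R]_n) -> ('rV[R]_n -> 'rV[R]_n) ->
           'rV[R]_n -> 'rV[R]_n) : Prop :=
  (forall X Y x, smooth_field U X -> smooth_field U Y -> U x ->
     nab X Y x - nab Y X x = bracket X Y x) /\
  (forall X Y Z x, smooth_field U X -> smooth_field U Y -> smooth_field U Z ->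
     U x ->
     dirderiv X (fun y => inner (G y) (Y y) (Z y)) x =
     inner (G x) (nab X Y x) (Z x) + inner (G x) (Y x) (nab X Z x)).

End LocalGeometry.

Section LeviCivita.
Variables (R : realType) (n : nat).
Implicit Types (G : 'rV[R]_n -> 'M[R]_n) (X Y Z : 'rV[R]_n -> 'rV[R]_n).
Implicit Types (U : set 'rV[R]_n) (x : 'rV[R]_n).
Implicit Types Gam : 'rV[R]_n -> 'I_n -> 'I_n -> 'I_n -> R.

Lemma smooth_derivable U (f : 'rV[R]_n -> R) x i :
  smooth_on U f -> U x -> derivable f x (delta_mx 0 i).
Proof. by move=> sf Ux; have [_ [df _]] := sf 1%N; exact: df. Qed.

Lemma is_derive_mulmx (V : normedModType R) (m p q : nat)
    (A : V -> 'M[R]_(m, p)) (A' : V -> 'M[R]_(p, q)) (x v : V) :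
  derivable A x v -> derivable A' x v ->
  derivable (fun y => A y *m A' y) x v /\
  'D_v (fun y => A y *m A' y) x = 'D_v A x *m A' x + A x *m 'D_v A' x.
Proof.
move=> dA dA'; have dAe := (derivable_mxP _ _ _).1 dA.
have dAe' := (derivable_mxP _ _ _).1 dA'.
have E i j : (fun y => (A y *m A' y) i j) =
    \sum_k ((fun y => A y i k) * (fun y => A' y k j)).
  by apply/funext => y; rewrite mxE fct_sumE.
have d i j k : derivable ((fun y => A y i k) * (fun y => A' y k j)) x v.
  exact: derivableM.
have D : derivable (fun y => A y *m A' y) x v.
  by apply/derivable_mxP => i j; rewrite E; exact: derivable_sum.
split=> //; rewrite (derive_mx D) (derive_mx dA) (derive_mx dA').
apply/matrixP => i j; rewrite !mxE E derive_sum // -big_split /=.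
apply: eq_bigr => k _; rewrite deriveM // !mxE addrC.
by congr (_ + _); exact: mulrC.
Qed.

Lemma is_derive_trmx (V : normedModType R) (m p : nat)
    (A : V -> 'M[R]_(m, p)) (x v : V) :
  derivable A x v ->
  derivable (fun y => (A y)^T) x v /\
  'D_v (fun y => (A y)^T) x = ('D_v A x)^T.
Proof.
move=> dA; have dAe := (derivable_mxP _ _ _).1 dA.
have D : derivable (fun y => (A y)^T) x v.
  apply/derivable_mxP => i j; under eq_fun do rewrite mxE.
  exact: dAe.
split=> //; rewrite (derive_mx D) (derive_mx dA); apply/matrixP => i j.
by rewrite !mxE; under eq_fun do rewrite mxE.
Qed.

Lemma derive_inner G Y Z x v :
  derivable G x v -> derivable Y x v -> derivable Z x v ->
  'D_v (fun y => inner (G y) (Y y) (Z y)) x =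
  inner (G x) ('D_v Y x) (Z x) + inner ('D_v G x) (Y x) (Z x)
    + inner (G x) (Y x) ('D_v Z x).
Proof.
move=> dG dY dZ; have [dYG eYG] := is_derive_mulmx dY dG.
have [dZt eZt] := is_derive_trmx dZ.
have [dI eI] := is_derive_mulmx dYG dZt.
move: (congr1 (fun M : 'M[R]_1 => M 0 0) eI); rewrite (derive_mx dI) mxE /inner => ->.
by rewrite eYG eZt mulmxDl !mxE.
Qed.

Definition gam_mx Gam x (i : 'I_n) : 'M[R]_n := \matrix_(j, k) Gam x i j k.

Lemma connectionE Gam X Y x :
  connection Gam X Y x =
  \sum_i X x 0 i *: (pderiv i Y x + Y x *m gam_mx Gam x i).
Proof.
under eq_bigr do rewrite scalerDr; rewrite big_split; congr (_ + _).
apply/rowP => k; rewrite mxE summxE; apply: eq_bigr => i _.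
rewrite !mxE mulr_sumr; apply: eq_bigr => j _; by rewrite mxE mulrA.
Qed.

Lemma connection_delta Gam x i j :
  connection Gam (fun=> delta_mx 0 i) (fun=> delta_mx 0 j) x =
  \row_k Gam x i j k.
Proof.
rewrite connectionE (bigD1 i) //= big1 => [|i' ne]; last first.
  by rewrite !mxE (negbTE ne) andbF scale0r.
rewrite pderiv_cst mxE !eqxx scale1r add0r addr0 -rowE.
by apply/rowP => k; rewrite !mxE.
Qed.

Lemma bracket_cst (u v : 'rV[R]_n) x : bracket (fun=> u) (fun=> v) x = 0.
Proof.
by rewrite /bracket /dirderiv !big1 ?subrr // => i _;
  rewrite pderiv_cst scaler0.
Qed.

Lemma inner_delta (A : 'M[R]_n) i j :
  inner A (delta_mx 0 i) (delta_mx 0 j) = A i j.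
Proof. by rewrite /inner -rowE trmx_delta -colE !mxE. Qed.

Lemma innerDl (A : 'M[R]_n) u v w : inner A (u + v) w = inner A u w + inner A v w.
Proof. by rewrite /inner !mulmxDl mxE. Qed.

Lemma innerDr (A : 'M[R]_n) u v w : inner A u (v + w) = inner A u v + inner A u w.
Proof. by rewrite /inner linearD mulmxDr mxE. Qed.

Lemma innerZl (A : 'M[R]_n) a v w : inner A (a *: v) w = a * inner A v w.
Proof. by rewrite /inner -!scalemxAl mxE. Qed.

Lemma innerZr (A : 'M[R]_n) a v w : inner A v (a *: w) = a * inner A v w.
Proof. by rewrite /inner linearZ -scalemxAr mxE. Qed.

Lemma inner0l (A : 'M[R]_n) w : inner A 0 w = 0.
Proof. by rewrite /inner !mul0mx mxE. Qed.

Lemma inner0r (A : 'M[R]_n) v : inner A v 0 = 0.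
Proof. by rewrite /inner trmx0 mulmx0 mxE. Qed.

Lemma inner_suml (A : 'M[R]_n) (h : 'I_n -> 'rV[R]_n) w :
  inner A (\sum_i h i) w = \sum_i inner A (h i) w.
Proof. by rewrite /inner !mulmx_suml summxE. Qed.

Lemma inner_sumr (A : 'M[R]_n) v (h : 'I_n -> 'rV[R]_n) :
  inner A v (\sum_i h i) = \sum_i inner A v (h i).
Proof. by rewrite /inner linear_sum mulmx_sumr summxE. Qed.

Variables (U : set 'rV[R]_n) (G : 'rV[R]_n -> 'M[R]_n).
Hypothesis U_open : open U.
Hypothesis G_smooth : forall i j, smooth_on U (fun x => G x i j).
Hypothesis G_sym : forall x, U x -> (G x)^T = G x.
Hypothesis G_posdef :
  forall x (v : 'rV[R]_n), U x -> v != 0 -> 0 < (v *m G x *m v^T) 0 0.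

Let dG x i j k := pderiv i (fun y => G y j k) x.
Let C x i j l := 2^-1 * (dG x i j l + dG x j i l - dG x l i j).
Let L Gam x i j l := \sum_k Gam x i j k * G x k l.

Lemma G_unit x : U x -> G x \in unitmx.
Proof.
move=> Ux; rewrite unitmxE unitfE; apply/negP => /det0P [v v0 vG].
by have := G_posdef Ux v0; rewrite vG mul0mx mxE ltxx.
Qed.

Lemma dG_sym x i j k : U x -> dG x i j k = dG x i k j.
Proof.
move=> Ux; apply: near_eq_derive.
apply: filterS (open_nbhs_nbhs (conj U_open Ux)) => y Uy.
by rewrite -{1}(G_sym Uy) mxE.
Qed.

Lemma invG_sym x : U x -> (invmx (G x))^T = invmx (G x).
Proof. by move=> Ux; rewrite trmx_inv G_sym. Qed.

Lemma christoffel_lower x i j l : U x -> L (christoffel G) x i j l = C x i j l.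
Proof.
move=> Ux.
have e : \row_k christoffel G x i j k = (\row_l C x i j l) *m invmx (G x).
  apply/rowP => k; rewrite !mxE /christoffel mulr_sumr; apply: eq_bigr => a _.
  by rewrite mxE -[in RHS](invG_sym Ux) [in RHS]mxE /C /dG; ring.
have : \row_k christoffel G x i j k *m G x = \row_l C x i j l.
  by rewrite e mulmxKV // G_unit.
move/rowP/(_ l); rewrite !mxE => <-.
by apply: eq_bigr => k _; rewrite mxE.
Qed.

Lemma christoffel_unique Gam x : U x ->
  (forall i j l, L Gam x i j l = C x i j l) -> Gam x = christoffel G x.
Proof.
move=> Ux LC; apply/funext => i; apply/funext => j.
suff /rowP e : \row_k Gam x i j k = \row_k christoffel G x i j k.
  by apply/funext => k; have := e k; rewrite !mxE.
rewrite -[LHS](mulmxK (G_unit Ux)) -[RHS](mulmxK (G_unit Ux)); congr (_ *m _).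
apply/rowP => l; have := christoffel_lower i j l Ux; rewrite -LC /L => e.
by rewrite !mxE; under eq_bigr do rewrite mxE;
  under [RHS]eq_bigr do rewrite mxE.
Qed.

Lemma metric_condition Gam X Y Z x : smooth_field U X -> smooth_field U Y ->
    smooth_field U Z -> U x ->
    (forall k i j, dG x k i j = L Gam x k i j + L Gam x k j i) ->
  dirderiv X (fun y => inner (G y) (Y y) (Z y)) x =
  inner (G x) (connection Gam X Y x) (Z x) +
  inner (G x) (Y x) (connection Gam X Z x).
Proof.
move=> sX sY sZ Ux M.
have dfield W i : smooth_field U W -> derivable W x (delta_mx 0 i).
  by move=> sW; apply/derivable_mxP => a b; rewrite ord1;
    exact: smooth_derivable (sW b) Ux.
have dGx i : derivable G x (delta_mx 0 i).
  by apply/derivable_mxP => a b; exact: smooth_derivable Ux.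
rewrite !connectionE inner_suml inner_sumr -big_split /=; apply: eq_bigr => k _.
rewrite innerZl innerZr -mulrDr innerDl innerDr /pderiv derive_inner //;
  [|exact: dfield..].
have -> : 'D_(delta_mx 0 k) G x = gam_mx Gam x k *m G x + G x *m (gam_mx Gam x k)^T.
  rewrite (derive_mx (dGx k)); apply/matrixP => i j.
  rewrite [LHS]mxE [LHS]M !mxE; congr (_ + _).
    by apply: eq_bigr => l _; rewrite mxE.
  apply: eq_bigr => l _; rewrite !mxE mulrC; congr (_ * _).
  by rewrite -[in LHS](G_sym Ux) mxE.
set g := gam_mx _ _ _; set a := inner _ _ _; set b := inner _ _ ('D__ _ _).
have -> : inner (g *m G x + G x *m g^T) (Y x) (Z x) =
    inner (G x) (Y x *m g) (Z x) + inner (G x) (Y x) (Z x *m g).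
  by rewrite /inner mulmxDr mulmxDl mxE trmx_mul !mulmxA.
by rewrite /GRing.scale /=; ring.
Qed.

Lemma levi_civitaP Gam :
  levi_civita U G (connection Gam) <->
  (forall x, U x -> Gam x = christoffel G x).
Proof.
have sdelta i : smooth_field U (fun=> delta_mx 0 i : 'rV[R]_n).
  by move=> j; exact: smooth_on_cst.
split=> [[tor met] x Ux | GamE].
  have sym i j k : Gam x i j k = Gam x j i k.
    have := tor _ _ _ (sdelta i) (sdelta j) Ux.
    rewrite !connection_delta bracket_cst => /eqP; rewrite subr_eq0.
    by move=> /eqP/rowP/(_ k); rewrite !mxE.
  have M k i j : dG x k i j = L Gam x k i j + L Gam x k j i.
    have := met _ _ _ _ (sdelta k) (sdelta i) (sdelta j) Ux.
    rewrite !connection_delta /dirderiv (bigD1 k) //= big1 => [|k' ne]; last first.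
      by rewrite mxE (negbTE ne) andbF scale0r.
    rewrite mxE !eqxx scale1r addr0 => e.
    have -> : dG x k i j = pderiv k (fun y =>
        inner (G y) (delta_mx 0 i) (delta_mx 0 j)) x.
      by rewrite /dG; congr (pderiv _ _ _); apply/funext => y; rewrite inner_delta.
    rewrite e; congr (_ + _).
      by rewrite /inner trmx_delta -colE !mxE; apply: eq_bigr => l _; rewrite mxE.
    rewrite /inner -rowE mxE; apply: eq_bigr => l _; rewrite !mxE mulrC.
    by rewrite -[in LHS](G_sym Ux) mxE.
  apply: christoffel_unique => // i j l; rewrite /C !M.
  have Lsym a b c : L Gam x a b c = L Gam x b a c.
    by apply: eq_bigr => k _; rewrite sym.
  by rewrite (Lsym j i) (Lsym l i) (Lsym l j); field.
split=> [X Y x sX sY Ux|X Y Z x sX sY sZ Ux].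
  rewrite /connection GamE // /bracket.

  suff -> : \row_k (\sum_i \sum_j X x 0 i * Y x 0 j * christoffel G x i j k) =
            \row_k (\sum_i \sum_j Y x 0 i * X x 0 j * christoffel G x i j k).
    by rewrite opprD addrACA subrr addr0.
  apply/rowP => k; rewrite !mxE exchange_big; apply: eq_bigr => i _.
  apply: eq_bigr => j _; rewrite [X x 0 j * _]mulrC; congr (_ * _).
  rewrite /christoffel; congr (_ * _); apply: eq_bigr => l _.
  rewrite -!/(dG _ _ _ _) (dG_sym l i j Ux); congr (_ * (_ - _)).
  exact: addrC.
apply: metric_condition => // k i j.
by rewrite /L GamE // -!/(L _ _ _ _ _) !christoffel_lower // /C
  (dG_sym k j i Ux); field.
Qed.

End LeviCivita.

Lemma nabla_levi_civita (R : realType) (n : nat) (M : manifold R n)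
    (g : riemannian_metric M) (c : atlas M) :
  levi_civita (target (chart_of c)) (gram g c) (nabla (gram g c)).
Proof.
apply/levi_civitaP => //; first exact: target_open.
- exact: gram_smooth.
- by move=> x; exact: gram_sym.
- by move=> x v; exact: gram_posdef.
Qed.

Section Curvature.
Variables (R : realType) (n : nat).
Implicit Types (G : 'rV[R]_n -> 'M[R]_n) (X Y Z : 'rV[R]_n -> 'rV[R]_n).
Implicit Types (x u v w : 'rV[R]_n).

Definition curvature G X Y Z : 'rV[R]_n -> 'rV[R]_n :=
  fun x => nabla G (bracket X Y) Z x -
    (nabla G X (nabla G Y Z) x - nabla G Y (nabla G X Z) x).

(* Curvature is tensorial, so tangent vectors may be extended arbitrarily; we
   use the extension with constant coordinates. *)
Definition curvature_at G x u v w : 'rV[R]_n :=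
  curvature G (fun=> u) (fun=> v) (fun=> w) x.

Definition jacobi G x u : 'M[R]_n :=
  lin1_mx (fun v => curvature_at G x u v u).

(* With the sign convention of [curvature] for R, the sectional curvature is
   <R(u,v)u, v> / (|u|^2 |v|^2 - <u,v>^2), positive on round spheres. *)
Definition sectional G x u v : R :=
  inner (G x) (curvature_at G x u v u) v /
  (inner (G x) u u * inner (G x) v v - inner (G x) u v ^+ 2).

End Curvature.

(* Eigenvalues are counted with multiplicity: every real number has the same
   geometric multiplicity for the (self-adjoint) Jacobi operators of all unit
   vectors at p. *)
Definition pointwise_osserman (R : realType) (n : nat) (M : manifold R n)
    (g : riemannian_metric M) : Prop :=
  forall (p : M) (c : atlas M), source (chart_of c) p ->
    let G := gram g c in
    let x := to_coord (chart_of c) p in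
    forall u v : 'rV[R]_n, inner (G x) u u = 1 -> inner (G x) v v = 1 ->
    forall a : R,
      \rank (eigenspace (jacobi G x u) a) = \rank (eigenspace (jacobi G x v) a).

Definition constant_sectional_curvature (R : realType) (n : nat)
    (M : manifold R n) (g : riemannian_metric M) : Prop :=
  exists kappa : R, forall (p : M) (c : atlas M), source (chart_of c) p ->
    forall u v : 'rV[R]_n, row_free (col_mx u v) ->
      sectional (gram g c) (to_coord (chart_of c) p) u v = kappa.

Lemma open_setX (S T : topologicalType) (U : set S) (V : set T) :
  open U -> open V -> open (U `*` V).
Proof.
move=> oU oV; apply: openI; apply: open_comp => //.
- by move=> p _; exact: cvg_fst.
- by move=> p _; exact: cvg_snd.
Qed.

Section ProductManifold.
Variables (R : realType) (m n : nat).

Section ProductChart.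
Variables (S T : topologicalType) (c : chart R m S) (d : chart R n T).

Definition prod_source : set (S * T) := [set p | source c p.1 /\ source d p.2].

Definition prod_target : set 'rV[R]_(m + n) :=
  [set x | target c (lsubmx x) /\ target d (rsubmx x)].

Definition prod_to_coord (p : S * T) : 'rV[R]_(m + n) :=
  row_mx (to_coord c p.1) (to_coord d p.2).

Definition prod_of_coord (x : 'rV[R]_(m + n)) : S * T :=
  (of_coord c (lsubmx x), of_coord d (rsubmx x)).

Lemma prod_source_open : open prod_source.
Proof. exact: open_setX (source_open c) (source_open d). Qed.

Lemma prod_target_open : open prod_target.
Proof.
apply: openI; apply: open_comp.
- by move=> p _; exact: lsubmx_continuous.
- exact: target_open.
- by move=> p _; exact: rsubmx_continuous.
- exact: target_open.
Qed.

Lemma prod_to_coord_target p : prod_source p -> prod_target (prod_to_coord p).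
Proof.
by move=> [sp1 sp2]; split; rewrite ?row_mxKl ?row_mxKr;
  exact: to_coord_target.
Qed.

Lemma prod_of_coord_source x : prod_target x -> prod_source (prod_of_coord x).
Proof. by move=> [tx1 tx2]; split; exact: of_coord_source. Qed.

Lemma prod_to_coordK p : prod_source p -> prod_of_coord (prod_to_coord p) = p.
Proof.
case: p => p1 p2 [/= sp1 sp2].
by rewrite /prod_of_coord row_mxKl row_mxKr /= !to_coordK.
Qed.

Lemma prod_of_coordK x : prod_target x -> prod_to_coord (prod_of_coord x) = x.
Proof. by move=> [tx1 tx2]; rewrite /prod_to_coord !of_coordK // hsubmxK. Qed.

Lemma prod_to_coord_continuous p :
  prod_source p -> {for p, continuous prod_to_coord}.
Proof.
move=> [sp1 sp2]; rewrite /prop_for /continuous_at.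
apply: cvg_mx => i j; rewrite !ord1.
case: (split_ordP j) => k ->.
- under [X in X @ _ --> _]eq_fun do rewrite row_mxEl.
  rewrite row_mxEl.
  apply: (@continuous_comp _ _ _ (to_coord c \o fst) (fun v => v 0 k));
    last exact: coord_continuous.
  by apply: continuous_comp; [exact: cvg_fst|exact: to_coord_continuous].
- under [X in X @ _ --> _]eq_fun do rewrite row_mxEr.
  rewrite row_mxEr.
  apply: (@continuous_comp _ _ _ (to_coord d \o snd) (fun v => v 0 k));
    last exact: coord_continuous.
  by apply: continuous_comp; [exact: cvg_snd|exact: to_coord_continuous].
Qed.

Lemma prod_of_coord_continuous x :
  prod_target x -> {for x, continuous prod_of_coord}.
Proof.
move=> [tx1 tx2].
have cl : {for x, continuous (of_coord c \o lsubmx)}.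
  apply: continuous_comp; first exact: lsubmx_continuous.
  exact: of_coord_continuous.
have cr : {for x, continuous (of_coord d \o rsubmx)}.
  apply: continuous_comp; first exact: rsubmx_continuous.
  exact: of_coord_continuous.
exact: cvg_pair cl cr.
Qed.

Definition prod_chart : chart R (m + n) (S * T)%type :=
  Chart prod_source_open prod_target_open prod_to_coord_target
    prod_of_coord_source prod_to_coordK prod_of_coordK
    prod_to_coord_continuous prod_of_coord_continuous.

End ProductChart.

Variables (B : manifold R m) (F : manifold R n).

Definition prod_chart_of (cd : atlas B * atlas F) :
    chart R (m + n) (B * F)%type :=
  prod_chart (chart_of cd.1) (chart_of cd.2).

Lemma prod_chart_cover (p : B * F) : exists cd, source (prod_chart_of cd) p.
Proof.
have [c sc] := chart_cover p.1; have [d sd] := chart_cover p.2.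
by exists (c, d).
Qed.

Lemma prod_chart_compat (c d : atlas B * atlas F) j :
  smooth_on (transition_dom (prod_chart_of c) (prod_chart_of d))
    (fun x => transition (prod_chart_of c) (prod_chart_of d) x 0 j).
Proof.
rewrite /transition /= /prod_to_coord /=.
case: (split_ordP j) => k ->.
- under eq_fun do rewrite row_mxEl.
  have h := @smooth_on_lsubmx _ m n _ _ (chart_compat c.1 d.1 k).
  by apply: smooth_on_sub h => x [[tx _] [sx _]].
- under eq_fun do rewrite row_mxEr.
  have h := @smooth_on_rsubmx _ m n _ _ (chart_compat c.2 d.2 k).
  by apply: smooth_on_sub h => x [[_ tx] [_ sx]].
Qed.

Lemma prod_hausdorff : hausdorff_space (B * F)%type.
Proof.
move=> [p1 p2] [q1 q2] pq; congr pair.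
- apply: (@manifold_hausdorff _ _ B) => P Q pP qQ.
  have [[x y] [Px Qx]] := pq _ _ (cvg_fst pP) (cvg_fst qQ).
  by exists x.
- apply: (@manifold_hausdorff _ _ F) => P Q pP qQ.
  have [[x y] [Px Qx]] := pq _ _ (cvg_snd pP) (cvg_snd qQ).
  by exists y.
Qed.

Lemma prod_second_countable : @second_countable (B * F)%type.
Proof.
have [P cP [oP bP]] := @manifold_second_countable _ _ B.
have [Q cQ [oQ bQ]] := @manifold_second_countable _ _ F.
exists [set (U.1 `*` U.2) | U in P `*` Q].
  by apply: (card_le_trans (card_image_le _ _)); exact: countableX.
split.
  move=> _ [[U V] [/= PU QV] <-]; apply: open_setX; [exact: oP|exact: oQ].
move=> [x y] W [[W1 W2] /= [W1x W2y] W12].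
have [U [PU Ux] UW1] := bP x _ W1x; have [V [QV Vy] VW2] := bQ y _ W2y.
exists (U `*` V).
  by split; [exists (U, V)|split].
by move=> [u v] [/= /UW1 ? /VW2 ?]; exact: W12.
Qed.

Definition product_manifold : manifold R (m + n) :=
  Manifold prod_chart_cover prod_chart_compat prod_hausdorff
    prod_second_countable.

End ProductManifold.

Section TwistedProduct.
Variables (R : realType) (m n : nat) (B : manifold R m) (F : manifold R n).
Variables (gB : riemannian_metric B) (gF : riemannian_metric F).
Local Notation BF := (product_manifold B F).
Variable f : BF -> R.
Hypothesis f_gt0 : forall p, 0 < f p.
Hypothesis f_smooth : smooth_function f.

Definition twisted_gram (cd : atlas BF) (x : 'rV[R]_(m + n)) :
    'M[R]_(m + n) :=
  block_mx (gram gB cd.1 (lsubmx x)) 0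
           0 (f (of_coord (chart_of cd) x) ^+ 2 *: gram gF cd.2 (rsubmx x)).

Lemma twisted_gram_smooth c i j :
  smooth_on (target (chart_of c)) (fun x => twisted_gram c x i j).
Proof.
have oc := @target_open _ _ _ (chart_of c).
rewrite /twisted_gram; case: (split_ordP i) => i' ->; case: (split_ordP j) => j' ->.
- under eq_fun do rewrite block_mxEul.
  have h := @smooth_on_lsubmx _ m n _ _ (gram_smooth gB c.1 i' j').
  by apply: smooth_on_sub h => x [].
- under eq_fun do rewrite block_mxEur mxE; exact: smooth_on_cst.
- under eq_fun do rewrite block_mxEdl mxE; exact: smooth_on_cst.
- under eq_fun do rewrite block_mxEdr mxE expr2.
  apply: smooth_onM => //; first by apply: smooth_onM => //; exact: f_smooth.
  have h := @smooth_on_rsubmx _ m n _ _ (gram_smooth gF c.2 i' j').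
  by apply: smooth_on_sub h => x [].
Qed.

Lemma twisted_gram_sym c x :
  target (chart_of c) x -> (twisted_gram c x)^T = twisted_gram c x.
Proof.
move=> [tx1 tx2]; rewrite /twisted_gram tr_block_mx !trmx0 linearZ /=.
by rewrite !gram_sym.
Qed.

Lemma twisted_gram_posdef c x (v : 'rV[R]_(m + n)) :
  target (chart_of c) x -> v != 0 -> 0 < (v *m twisted_gram c x *m v^T) 0 0.
Proof.
move=> [tx1 tx2] v0; rewrite /twisted_gram -[v]hsubmxK mul_row_block tr_row_mx.
rewrite mul_row_col !mulmx0 addr0 add0r -scalemxAr -scalemxAl.
rewrite [X in _ < X]mxE [X in _ + X]mxE.
set f2 := _ ^+ 2; have f2_gt0 : 0 < f2 by rewrite exprn_gt0.
have ge0 k (M : manifold R k) (g : riemannian_metric M) a y (u : 'rV_k) :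
    target (chart_of a) y -> 0 <= (u *m gram g a y *m u^T) 0 0.
  move=> ty; have [->|u0] := eqVneq u 0; first by rewrite !mul0mx mxE.
  exact/ltW/gram_posdef.
have [l0|l0] := eqVneq (lsubmx v) 0.
  rewrite l0 !mul0mx [X in X + _]mxE add0r mulr_gt0 //; apply: gram_posdef => //.
  apply: contra_neq v0 => r0; rewrite -[v]hsubmxK l0 r0; exact: row_mx0.
rewrite ltr_pwDl //; first exact: gram_posdef.
by rewrite mulr_ge0 ?ge0 // ltW.
Qed.

Lemma jac_product c d x :
  jac (transition (@chart_of _ _ BF c) (chart_of d)) x =
  block_mx (jac (transition (chart_of c.1) (chart_of d.1)) (lsubmx x)) 0
           0 (jac (transition (chart_of c.2) (chart_of d.2)) (rsubmx x)).
Proof.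
apply/matrixP => i j; rewrite mxE /transition /= /prod_to_coord /=.
have dl i' : lsubmx (delta_mx 0 (lshift n i') : 'rV[R]_(m + n)) = delta_mx 0 i'.
  by apply/rowP => k; rewrite !mxE (inj_eq (@lshift_inj m n)).
have dr i' : rsubmx (delta_mx 0 (rshift m i') : 'rV[R]_(m + n)) = delta_mx 0 i'.
  by apply/rowP => k; rewrite !mxE (inj_eq (@rshift_inj m n)).
have dl0 i' : lsubmx (delta_mx 0 (rshift m i') : 'rV[R]_(m + n)) = 0.
  by apply/rowP => k; rewrite !mxE eq_lrshift andbF.
have dr0 i' : rsubmx (delta_mx 0 (lshift n i') : 'rV[R]_(m + n)) = 0.
  by apply/rowP => k; rewrite !mxE eq_rlshift andbF.
case: (split_ordP j) => j' ->; rewrite /pderiv.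
- under eq_fun do rewrite row_mxEl.
  rewrite (derive_comp_linear (@lsubmx R 1 m n)
    (fun y => transition (chart_of c.1) (chart_of d.1) y 0 j') _ _).1.
  case: (split_ordP i) => i' ->.
  + by rewrite /= dl block_mxEul mxE.
  + by rewrite /= dl0 derive0 block_mxEdl mxE.
- under eq_fun do rewrite row_mxEr.
  rewrite (derive_comp_linear (@rsubmx R 1 m n)
    (fun y => transition (chart_of c.2) (chart_of d.2) y 0 j') _ _).1.
  case: (split_ordP i) => i' ->.
  + by rewrite /= dr0 derive0 block_mxEur mxE.
  + by rewrite /= dr block_mxEdr mxE.
Qed.

Lemma twisted_gram_compat c d x :
  transition_dom (chart_of c) (chart_of d) x ->
  let phi := transition (chart_of c) (chart_of d) in
  twisted_gram c x = jac phi x *m twisted_gram d (phi x) *m (jac phi x)^T.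
Proof.
move=> cdx phi; have [[tx1 tx2] [sx1 sx2]] := cdx.
rewrite /phi jac_product /twisted_gram tr_block_mx !trmx0 !mulmx_block.
rewrite !(mulmx0, mul0mx, addr0, add0r) -scalemxAr -scalemxAl.
rewrite {1 2}/transition [of_coord (chart_of d) _]to_coordK; last by case: cdx.
rewrite (gram_compat gB (d := d.1)); last by split.
rewrite (gram_compat gF (d := d.2)); last by split.
by rewrite /= /prod_to_coord row_mxKl row_mxKr.
Qed.

Definition twisted_product : riemannian_metric BF :=
  RiemannianMetric twisted_gram_smooth twisted_gram_sym twisted_gram_posdef
    twisted_gram_compat.

End TwistedProduct.

(* Main.v *)
(* At a point of the twisted product write X, Y for horizontal and U, V, W for
   vertical vectors. Computing the rows of the Christoffel matrices indexed by
   horizontal vectors shows that R(X,Y,Z,U) = 0, R(U,V,X,Y) = 0, that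
   R(X,U,Y,V) = h(X,Y) <U,V> for a bilinear form h, and that R(U,V,X,W) is
   governed by the mixed derivative XV(log f). So U is an eigenvector of the
   Jacobi operator J(X) with eigenvalue h(X,X). On unit vectors the Jacobi operators
   have a fixed finite spectrum, so the quadratic form h takes finitely many
   values on unit vectors and h = mu <.,.>. Constancy of the trace of J kills
   the mixed term R(U,V,X,W). If now Y is an eigenvector of J(X), horizontal and
   orthogonal to X, with eigenvalue l |X|^2, then Y is also an eigenvector of
   J(X + tU), with eigenvalue l |X|^2 + t^2 mu |U|^2; since the quotient by
   |X|^2 + t^2 |U|^2 lies in a finite set for all t, l = mu. By symmetry the
   same holds for vertical vectors, and the curvature tensor at the point is mu
   times that of the unit sphere. Schur's lemma (the second Bianchi identity),
   the invariance of mu under changes of charts, and connectedness conclude. *)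

Require Import Defs.
From mathcomp Require Import all_boot all_order all_algebra ring lra.
From mathcomp Require Import all_classical all_reals all_analysis.
From mathcomp Require complex.

Set Implicit Arguments.
Unset Strict Implicit.
Unset Printing Implicit Defensive.

Import Order.TTheory GRing.Theory Num.Theory.
Import numFieldNormedType.Exports.

Local Open Scope classical_set_scope.
Local Open Scope ring_scope.

(** * Partial derivatives *)

(** All computations are done with matrices in one chart at a time. A vector is a row, so connection
    and curvature matrices act on the right, and the pointwise part of the argument becomes linear
    algebra over a positive definite matrix and a family of matrices with the symmetries of a
    curvature tensor. A finite spectrum is exploited through polynomials in [t]: if the quotient of
    two polynomials takes values in a finite set, a finite product of polynomials vanishes
    identically, hence so does one factor. Self-adjoint operators are diagonalised over the complex
    numbers, after a factorisation of the metric has turned them into hermitian matrices; ranks and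
    traces then descend to the reals. The dimension bound enters through Schur's lemma: on a surface
    the Jacobi operator of every unit vector has the eigenvalues 0 and the Gauss curvature, so there
    the Osserman condition says nothing. In the converse direction, constant curvature is invariant
    under the reflection that exchanges two unit vectors. *)

Section Calculus.
Variables (R : realType) (N : nat).
Implicit Types (h : 'rV[R]_N -> R) (x y : 'rV[R]_N) (i j : 'I_N) (t s r : R).

Local Notation e_ i := (delta_mx 0 i : 'rV[R]_N).

Definition box x r : set 'rV[R]_N := [set y : 'rV[R]_N | forall a, `|x 0 a - y 0 a| < r].

Lemma nbhs_box x (P : set 'rV[R]_N) :
  nbhs x P -> exists2 r, 0 < r & box x r `<=` P.
Proof.
move/nbhs_ballP => [r /= r0 rP]; exists r => // y xy.
by apply: rP; split=> // i a; rewrite !ord1; exact: xy.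
Qed.

Lemma box_nbhs x r : 0 < r -> nbhs x (box x r).
Proof.
move=> r0.
apply: (@filter_forall _ _ (fun a (y : 'rV[R]_N) => `|x 0 a - y 0 a| < r) (nbhs x)) => a.
by have := @coord_continuous R 1 N 0 a x; move/cvgrPdist_lt => /(_ r r0).
Qed.

Lemma box_le x r s : r <= s -> box x r `<=` box x s.
Proof. by move=> rs y xy a; exact: lt_le_trans (xy a) rs. Qed.

Lemma coord_line x i t a : (x + t *: e_ i) 0 a = x 0 a + t * (a == i)%:R.
Proof. by rewrite !mxE eqxx. Qed.

Lemma is_derive_line h x i t : derivable h (x + t *: e_ i) (e_ i) ->
  is_derive t 1 (fun s => h (x + s *: e_ i)) (pderiv i h (x + t *: e_ i)).
Proof.
have e : (fun k : R => k^-1 *: (((fun s => h (x + s *: e_ i)) \o shift t) (k *: 1)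
             - h (x + t *: e_ i))) =
         (fun k : R => k^-1 *: ((h \o shift (x + t *: e_ i)) (k *: e_ i)
             - h (x + t *: e_ i))).
  apply/funext => k /=; congr (_ *: (h _ - _)).
  by rewrite [k%:A]mulr1 scalerDl addrCA.
by move=> d; split; [rewrite /derivable e|rewrite /pderiv /derive e].
Qed.

(** Both signs of [t] are covered at once by controlling the intermediate point through its absolute
    value; this suits increments along a coordinate line. *)
Lemma mvt0 (g dg : R -> R) t : (forall s, `|s| <= `|t| -> is_derive s 1 g (dg s)) ->
  exists2 s, `|s| <= `|t| & g t - g 0 = t * dg s.
Proof.
move=> gP.
have cg a b : (forall s, a <= s <= b -> `|s| <= `|t|) ->
    {within `[a, b], continuous g}.
  move=> ab; apply: derivable_within_continuous => s.
  by rewrite in_itv /= => /ab /gP [].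
have [t0|/ltW t0] := leP 0 t.
- have bd s : 0 <= s <= t -> `|s| <= `|t|.
    by move=> /andP[s0 st]; rewrite !ger0_norm.
  have [|s sI ->] := @MVT_segment R g dg 0 t t0 _ (cg _ _ bd).
    by move=> s /[!in_itv] /andP[s0 st]; apply: gP; apply: bd; rewrite !ltW.
  exists s; first by apply: bd; rewrite in_itv in sI.
  by rewrite subr0 mulrC.
- have bd s : t <= s <= 0 -> `|s| <= `|t|.
    by move=> /andP[s0 st]; rewrite !ler0_norm ?lerN2.
  have [|s sI e] := @MVT_segment R g dg t 0 t0 _ (cg _ _ bd).
    by move=> s /[!in_itv] /andP[s0 st]; apply: gP; apply: bd; rewrite !ltW.
  exists s; first by apply: bd; rewrite in_itv in sI.
  by apply: oppr_inj; rewrite opprB e; ring.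
Qed.

Lemma line_mvt h x i t :
  (forall s, `|s| <= `|t| -> derivable h (x + s *: e_ i) (e_ i)) ->
  exists2 s, `|s| <= `|t| &
    h (x + t *: e_ i) - h x = t * pderiv i h (x + s *: e_ i).
Proof.
move=> dh; have [|s st e] := @mvt0 (fun s => h (x + s *: e_ i))
    (fun s => pderiv i h (x + s *: e_ i)) t.
  by move=> s /dh /is_derive_line.
by exists s => //; rewrite -e scale0r addr0.
Qed.

(** The mean value theorem, used in direction [k] and then in direction [l], writes a second
    difference as [t ^+ 2] times a mixed partial at a nearby point. The difference is symmetric in
    the two directions, and continuity of both mixed partials allows [t] to shrink. *)
Lemma pderiv_pderivC (U : set 'rV[R]_N) h x i j : open U -> smooth_on U h -> U x ->
  pderiv i (pderiv j h) x = pderiv j (pderiv i h) x.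
Proof.
move=> oU sh Ux.
have dh y k : U y -> derivable h y (e_ k).
  by have [_ [dh _]] := sh 1%N => Uy; exact: dh.
have dh2 y k l : U y -> derivable (pderiv k h) y (e_ l).
  by have [_ [_ dh2]] := sh 2%N => Uy; have [_ [d _]] := dh2 k; exact: d.
have ch2 k l : {for x, continuous (pderiv k (pderiv l h))}.
  have [_ [_ dh2']] := sh 2%N; have [_ [_ c]] := dh2' l.
  by have [c' _] := c k; exact: c'.
have [r r0 rU] := nbhs_box (open_nbhs_nbhs (conj oU Ux)).
have line2 k l s t : `|s| < r / 2 -> `|t| < r / 2 -> U (x + t *: e_ l + s *: e_ k).
  move=> sr tr; apply: rU => a; rewrite !coord_line -addrA opprD addNKr normrN.
  apply: le_lt_trans (ler_normD _ _) _; rewrite !normrM [r]splitr ltrD//.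
    by apply: le_lt_trans tr; case: eqP; rewrite ?normr0 ?normr1 ?mulr1 ?mulr0.
  by apply: le_lt_trans sr; case: eqP; rewrite ?normr0 ?normr1 ?mulr1 ?mulr0.
have r2 : 0 < r / 2 by rewrite divr_gt0.
(* Both mixed partials are limits of the same second difference quotient. *)
pose D k l t := h (x + t *: e_ l + t *: e_ k) - h (x + t *: e_ k) - (h (x + t *: e_ l) - h x).
have key k l t : 0 < t < r / 2 -> exists2 y, D k l t = t ^+ 2 * pderiv l (pderiv k h) y
    & forall a, `|x 0 a - y 0 a| <= 2 * t.
  move=> /andP[t0 tr].
  have small s : `|s| <= `|t| -> `|s| < r / 2.
    by move=> st; apply: le_lt_trans st _; rewrite gtr0_norm.
  pose g1 s := h (x + t *: e_ l + s *: e_ k); pose g2 s := h (x + s *: e_ k).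
  have dg s : `|s| <= `|t| -> is_derive s 1 (g1 - g2)
     (pderiv k h (x + t *: e_ l + s *: e_ k) - pderiv k h (x + s *: e_ k)).
    move=> st; apply: is_deriveB.
      by apply: is_derive_line; apply: dh; apply: line2; exact: small.
    apply: is_derive_line; apply: dh; rewrite -[_ + _]addr0 -(scale0r (e_ k)).
    by apply: line2; [rewrite normr0|exact: small].
  have [s st e] := @mvt0 _ _ t dg.
  have [s' st' e'] := @line_mvt (pderiv k h) (x + s *: e_ k) l t (fun s' st' =>
     dh2 _ k l (line2 _ _ _ _ (small _ st') (small _ st))).
  exists (x + s *: e_ k + s' *: e_ l).
    have -> : D k l t = (g1 - g2) t - (g1 - g2) 0.
      by rewrite !fctE /D /g1 /g2 !scale0r !addr0.
    by rewrite e addrAC e' mulrA expr2.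
  move=> a; rewrite !coord_line -addrA opprD addNKr normrN.
  apply: le_trans (ler_normD _ _) _; rewrite !normrM mulr2n mulrDl mul1r.
  rewrite (gtr0_norm t0) in st st'.
  apply: lerD.
    by apply: le_trans st; case: eqP; rewrite ?normr0 ?normr1 ?mulr1 ?mulr0.
  by apply: le_trans st'; case: eqP; rewrite ?normr0 ?normr1 ?mulr1 ?mulr0.
have DC t : D i j t = D j i t by rewrite /D [x + _ + _]addrAC !opprB; ring.
have near_val (q : 'rV[R]_N -> R) (e : R) : {for x, continuous q} -> 0 < e ->
    exists2 d, 0 < d & forall y, (forall a, `|x 0 a - y 0 a| < d) -> `|q x - q y| < e.
  move=> + e0; move/cvgrPdist_lt => /(_ e e0) /nbhs_box[d d0 dP].
  by exists d => // y /dP.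
move: (ch2 i j) (ch2 j i) (key i j) (key j i).
move: (pderiv i (pderiv j h)) (pderiv j (pderiv i h)) => p q cp cq keyq keyp.
apply/eqP; rewrite -subr_eq0 -normr_le0; apply/ler_addgt0Pl => e e0; rewrite addr0.
have e2 : 0 < e / 2 by rewrite divr_gt0.
have [d d0 dP] := near_val p _ cp e2; have [d' d'0 dP'] := near_val q _ cq e2.
(* The points supplied by [key] lie within [2 * t] of [x]; the divisor 4 puts this strictly below
   [d] and [d']. *)
pose t := Num.min (r / 2) (Num.min d d') / 4.
have m0 : 0 < Num.min (r / 2) (Num.min d d') by rewrite !lt_min r2 d0.
have t0 : 0 < t by rewrite divr_gt0.
have mr : Num.min (r / 2) (Num.min d d') <= r / 2 by rewrite ge_min lexx.
have md : Num.min (r / 2) (Num.min d d') <= d by rewrite !ge_min lexx orbT.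
have md' : Num.min (r / 2) (Num.min d d') <= d' by rewrite !ge_min lexx !orbT.
have tr : 0 < t < r / 2 by rewrite t0 /= /t; lra.
have [y ye yx] := keyq t tr; have [y' ye' yx'] := keyp t tr.
have tn : t ^+ 2 != 0 by rewrite expf_neq0 // gt_eqF.
have E : q y = p y' by apply: (mulfI tn); rewrite -ye -ye' DC.
have b1 : `|q x - q y| < e / 2.
  by apply: dP' => a; apply: le_lt_trans (yx a) _; rewrite /t; lra.
have b2 : `|p x - p y'| < e / 2.
  by apply: dP => a; apply: le_lt_trans (yx' a) _; rewrite /t; lra.
rewrite -E in b2; move: b1 b2; move: (q x) (p x) (q y) => u v w.
rewrite -(normrN (u - w)) opprB => b1 b2.
have -> : v - u = (v - w) + (w - u) by ring.
rewrite [e]splitr; apply: le_trans (ler_normD _ _) _.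
by apply: lerD; exact: ltW.
Qed.

(* Hadamard's lemma: [slope] turns an increment of [h] into a sum of coordinate
   increments with coefficients that are continuous at [x]. *)
Definition interp x y (k : nat) : 'rV[R]_N :=
  \row_a (if (a < k)%N then y 0 a else x 0 a).

Definition slope h x y i : R :=
  if y 0 i == x 0 i then pderiv i h x
  else (h (interp x y i.+1) - h (interp x y i)) / (y 0 i - x 0 i).

Lemma interpS x y i : interp x y i.+1 = interp x y i + (y 0 i - x 0 i) *: e_ i.
Proof.
apply/rowP => a; rewrite coord_line !mxE ltnS leq_eqVlt.
have [->|ne] := eqVneq a i; first by rewrite eqxx ltnn /= mulr1 addrC subrK.
have /negbTE -> : (a != i :> nat) by [].
by rewrite mulr0 addr0.
Qed.

Lemma interp0 x y : interp x y 0 = x.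
Proof. by apply/rowP => a; rewrite mxE. Qed.

Lemma interpN x y : interp x y N = y.
Proof. by apply/rowP => a; rewrite mxE ltn_ord. Qed.

Lemma increment h x y :
  h y - h x = \sum_(i < N) (h (interp x y i.+1) - h (interp x y i)).
Proof.
have := @telescope_sumr _ 0 N (fun k => h (interp x y k)) (leq0n N).
by rewrite interpN interp0 big_mkord.
Qed.

Lemma slopeE h x y : h y = h x + \sum_i (y 0 i - x 0 i) * slope h x y i.
Proof.
rewrite -[LHS](subrK (h x)) addrC increment; congr (_ + _).
apply: eq_bigr => i _; rewrite /slope interpS; case: eqP => [->|/eqP ne].
  by rewrite subrr scale0r addr0 subrr mul0r.
by rewrite mulrC divfK // subr_eq0.
Qed.

Lemma slope_center h x i : slope h x x i = pderiv i h x.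
Proof. by rewrite /slope eqxx. Qed.

Lemma interp_line x y i s a : `|s| <= `|y 0 i - x 0 i| ->
  `|x 0 a - (interp x y i + s *: e_ i) 0 a| <= `|x 0 a - y 0 a|.
Proof.
move=> sb; rewrite coord_line mxE; have [->|ne] := eqVneq a i.
  by rewrite ltnn mulr1 opprD addrA subrr sub0r normrN -(normrN (x 0 i - _)) opprB.
by rewrite mulr0 addr0; case: ifP; rewrite ?subrr ?normr0.
Qed.

(** By the mean value theorem every slope is a value of [pderiv i h] at a point that is no farther
    from [x], in any coordinate, than [y] is. Continuity of this partial derivative at [x] therefore
    passes to the slope. *)
Lemma slope_continuous (U : set 'rV[R]_N) h x i : open U -> U x ->
  (forall y, U y -> derivable h y (e_ i)) -> {for x, continuous (pderiv i h)} ->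
  {for x, continuous (slope h x ^~ i)}.
Proof.
move=> oU Ux dh ch; apply/(@cvgrPdist_lt R R^o _ (nbhs x) (nbhs_filter x)) => e e0.
rewrite /= slope_center.
have [r r0 rU] := nbhs_box (open_nbhs_nbhs (conj oU Ux)).
move: (ch) => /cvgrPdist_lt/(_ e e0)/nbhs_box[d d0 dP].
have m0 : 0 < Num.min r d by rewrite lt_min r0.
have := box_nbhs x m0; apply: (@filterS _ (nbhs x) (nbhs_filter x)) => y xy.
rewrite /slope.
case: eqP => [_|/eqP ne]; first by rewrite subrr normr0.
have bx s : `|s| <= `|y 0 i - x 0 i| -> box x (Num.min r d) (interp x y i + s *: e_ i).
  by move=> sb a; apply: le_lt_trans (xy a); exact: interp_line.
rewrite interpS; have [|s sb ->] := @line_mvt h (interp x y i) i (y 0 i - x 0 i).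
  by move=> s /bx sU; apply: dh; apply: rU; apply: box_le sU; rewrite ge_min lexx.
rewrite mulrC mulKf ?subr_eq0 //; apply: dP.
by apply: box_le (bx _ sb); rewrite ge_min lexx orbT.
Qed.

(** The axis-parallel path [interp] from [x] to [y] stays in the cube, and the mean value theorem
    kills the increment along each of its edges. *)
Lemma pderiv0_cst h x r :
  (forall y i, box x r y -> derivable h y (e_ i) /\ pderiv i h y = 0) ->
  forall y, box x r y -> h y = h x.
Proof.
move=> h0 y xy; apply/eqP; rewrite -subr_eq0 increment big1 // => i _.
have bx s : `|s| <= `|y 0 i - x 0 i| -> box x r (interp x y i + s *: e_ i).
  by move=> sb a; apply: le_lt_trans (xy a); exact: interp_line.
rewrite interpS; have [|s sb ->] := @line_mvt h (interp x y i) i (y 0 i - x 0 i).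
  by move=> s /bx sU; have [] := h0 _ i sU.
by have [_ ->] := h0 _ i (bx _ sb); rewrite mulr0.
Qed.

End Calculus.

(** Chain rule from Hadamard's lemma: the difference quotient of the composite is a sum of quotients
    of the coordinates of [phi] times slopes of [h], and the slopes converge by continuity. *)
Lemma pderiv_comp (R : realType) (M N : nat) (V : set 'rV[R]_N) (h : 'rV[R]_N -> R)
    (phi : 'rV[R]_M -> 'rV[R]_N) (x : 'rV[R]_M) (k : 'I_M) :
  open V -> V (phi x) -> smooth_on V h ->
  {for x, continuous phi} ->
  (forall a, derivable (fun y => phi y 0 a) x (delta_mx 0 k)) ->
  derivable (fun y => h (phi y)) x (delta_mx 0 k) /\
  pderiv k (fun y => h (phi y)) x =
    \sum_a pderiv k (fun y => phi y 0 a) x * pderiv a h (phi x).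
Proof.
move=> oV Vx sh cphi dphi; set v : 'rV[R]_M := delta_mx 0 k.
pose q t := \sum_a (t^-1 *: (phi (t *: v + x) 0 a - phi x 0 a)) *
                  slope h (phi x) (phi (t *: v + x)) a.
have qE : (fun t : R => t^-1 *: (((fun y => h (phi y)) \o shift x) (t *: v) - h (phi x))) = q.
  apply/funext => t /=; rewrite (slopeE h (phi x) (phi _)) addrC addKr scaler_sumr.
  by apply: eq_bigr => a _; rewrite scalerAl.
have cline : (fun t : R => phi (t *: v + x)) @ 0^' --> phi x.
  have c1 : (fun t : R => t *: v + x) @ 0^' --> x.
    apply: cvg_within_filter; rewrite -{2}[x]add0r -(scale0r v).
    by apply: cvgD; [apply: cvgZr_tmp; exact: cvg_id|exact: cvg_cst].
  exact: cvg_comp c1 cphi.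
have cq : q @ 0^' --> \sum_a pderiv k (fun y => phi y 0 a) x * pderiv a h (phi x).
  apply: cvg_big => [|a _]; first exact: add_continuous.
  apply: cvgM; first exact: dphi.
  rewrite -slope_center.
  apply: (@cvg_comp _ _ _ (fun t => phi (t *: v + x)) (slope h (phi x) ^~ a) _ _ _ cline).
  have [_ [dh ch]] := sh 1%N.
  apply: (slope_continuous oV Vx) => [y Vy|]; first exact: dh.
  by have [c _] := ch a; exact: c.
split; first by rewrite /derivable qE; apply: cvgP cq.
by rewrite /pderiv /derive qE; apply: cvg_lim cq.
Qed.

(** * Smooth functions and matrix-valued derivatives *)

Section SmoothAlgebra.
Variables (R : realType) (N : nat) (U : set 'rV[R]_N).
Hypothesis U_open : open U.
Implicit Types f g : 'rV[R]_N -> R.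

Lemma smooth_onZ (a : R) f : smooth_on U f -> smooth_on U (fun x => a * f x).
Proof. by move=> sf; apply: smooth_onM => //; exact: smooth_on_cst. Qed.

Lemma smooth_onN f : smooth_on U f -> smooth_on U (fun x => - f x).
Proof.
by move=> sf; under eq_fun do rewrite -mulN1r; exact: smooth_onZ.
Qed.

Lemma smooth_onB f g :
  smooth_on U f -> smooth_on U g -> smooth_on U (fun x => f x - g x).
Proof. by move=> sf sg; apply: smooth_onD => //; exact: smooth_onN. Qed.

Lemma smooth_on_sum (I : Type) (r : seq I) (P : pred I) (F : I -> 'rV[R]_N -> R) :
  (forall i, smooth_on U (F i)) -> smooth_on U (fun x => \sum_(i <- r | P i) F i x).
Proof.
move=> sF; elim: r => [|i r IH].
  by under eq_fun do rewrite big_nil; exact: smooth_on_cst.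
under eq_fun do rewrite big_cons; case: (P i) => //; exact: smooth_onD.
Qed.

Lemma smooth_on_prod (I : Type) (r : seq I) (P : pred I) (F : I -> 'rV[R]_N -> R) :
  (forall i, smooth_on U (F i)) -> smooth_on U (fun x => \prod_(i <- r | P i) F i x).
Proof.
move=> sF; elim: r => [|i r IH].
  by under eq_fun do rewrite big_nil; exact: smooth_on_cst.
under eq_fun do rewrite big_cons; case: (P i) => //; exact: smooth_onM.
Qed.

Lemma smooth_on_pderiv i f : smooth_on U f -> smooth_on U (pderiv i f).
Proof. by move=> sf k; have [_ [_ d]] := sf k.+1; exact: d. Qed.

Lemma smooth_onV f : (forall x, U x -> f x != 0) -> smooth_on U f ->
  smooth_on U (fun x => (f x)^-1).
Proof.
move=> f0 sf; elim=> [|k IH].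
  have [cf _] := sf 0%N; split=> // x Ux.
  by apply: continuousV; [exact: f0|exact: cf].
have [cf [df _]] := sf 1%N; split; [|split].
- by move=> x Ux; apply: continuousV; [exact: f0|exact: cf].
- by move=> x i Ux; apply: derivableV; [exact: f0|exact: df].
- move=> i; apply: (@Ck_on_eq _ _ _ _ (fun x => (-1) * ((f x)^-1 * (f x)^-1 * pderiv i f x))) => //.
    move=> x Ux; rewrite /pderiv deriveV ?f0 //; last exact: df.
    by rewrite -exprVn expr2 mulN1r; symmetry; exact: mulNr.
  apply: Ck_onM => //; first exact: smooth_on_cst.
  by apply: Ck_onM => //; [exact: Ck_onM|exact: smooth_on_pderiv].
Qed.

Definition mx_smooth (p q : nat) (A : 'rV[R]_N -> 'M[R]_(p, q)) :=
  forall a b, smooth_on U (fun x => A x a b).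

Lemma mx_smoothM p q r (A : 'rV[R]_N -> 'M[R]_(p, q)) (B : 'rV[R]_N -> 'M[R]_(q, r)) :
  mx_smooth A -> mx_smooth B -> mx_smooth (fun x => A x *m B x).
Proof.
move=> sA sB a b; under eq_fun do rewrite mxE.
by apply: smooth_on_sum => c; exact: smooth_onM.
Qed.

Lemma smooth_on_det p (A : 'rV[R]_N -> 'M[R]_p) :
  mx_smooth A -> smooth_on U (fun x => \det (A x)).
Proof.
move=> sA; apply: smooth_on_sum => s; apply: smooth_onZ.
exact: smooth_on_prod.
Qed.

(** Cramer's rule: the entries of the inverse are cofactors divided by the determinant, and both are
    polynomials in the entries of [A]. *)
Lemma smooth_on_invmx p (A : 'rV[R]_N -> 'M[R]_p) : mx_smooth A ->
  (forall x, U x -> A x \in unitmx) -> mx_smooth (fun x => invmx (A x)).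
Proof.
move=> sA uA a b.
apply: (@smooth_on_eq _ _ _ (fun x => (\det (A x))^-1 * cofactor (A x) b a)) => //.
  by move=> x Ux; rewrite /invmx uA // !mxE.
apply: smooth_onM => //.
  by apply: smooth_onV; [move=> x /uA; rewrite unitmxE unitfE|exact: smooth_on_det].
apply: smooth_onZ; apply: smooth_on_det => c d.
by under eq_fun do rewrite !mxE; exact: sA.
Qed.

Lemma christoffel_smooth (G : 'rV[R]_N -> 'M[R]_N) i j k : mx_smooth G ->
  (forall x, U x -> G x \in unitmx) -> smooth_on U (fun x => christoffel G x i j k).
Proof.
move=> sG uG; apply: smooth_onZ; apply: smooth_on_sum => l.
apply: smooth_onM => //; first exact: smooth_on_invmx.
by apply: smooth_onB; [apply: smooth_onD => //|]; exact: smooth_on_pderiv.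
Qed.

End SmoothAlgebra.

Section MatrixDerivative.
Variables (R : realType) (N : nat).
Implicit Types (x : 'rV[R]_N) (i j k : 'I_N).

(** Entrywise rather than as a derivative in the space of matrices, so that smoothness and the
    symmetry of second derivatives carry over from scalar functions; [mderivE] relates the two. *)
Definition mderiv p q i (A : 'rV[R]_N -> 'M[R]_(p, q)) x : 'M[R]_(p, q) :=
  \matrix_(a, b) pderiv i (fun y => A y a b) x.

Lemma mderiv_entry p q i (A : 'rV[R]_N -> 'M[R]_(p, q)) x a b :
  mderiv i A x a b = pderiv i (fun y => A y a b) x.
Proof. by rewrite mxE. Qed.

Lemma mderiv_entry_fun p q i (A : 'rV[R]_N -> 'M[R]_(p, q)) a b :
  (fun x => mderiv i A x a b) = pderiv i (fun y => A y a b).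
Proof. by apply/funext => x; rewrite mderiv_entry. Qed.

Definition mderivable p q i (A : 'rV[R]_N -> 'M[R]_(p, q)) x :=
  forall a b, derivable (fun y => A y a b) x (delta_mx 0 i).

Lemma mx_smooth_derivable p q (U : set 'rV[R]_N) (A : 'rV[R]_N -> 'M[R]_(p, q)) x i :
  mx_smooth U A -> U x -> mderivable i A x.
Proof. by move=> sA Ux a b; exact: smooth_derivable Ux. Qed.

Lemma mderivE p q i (A : 'rV[R]_N -> 'M[R]_(p, q)) x :
  mderivable i A x -> mderiv i A x = 'D_(delta_mx 0 i) A x.
Proof. by move=> dA; rewrite derive_mx //; exact/derivable_mxP. Qed.

Lemma mderivM p q r i (A : 'rV[R]_N -> 'M[R]_(p, q)) (B : 'rV[R]_N -> 'M[R]_(q, r)) x :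
  mderivable i A x -> mderivable i B x ->
  mderiv i (fun y => A y *m B y) x = mderiv i A x *m B x + A x *m mderiv i B x.
Proof.
move=> dA dB; rewrite (mderivE dA) (mderivE dB).
have [d <-] := is_derive_mulmx ((derivable_mxP _ _ _).2 dA) ((derivable_mxP _ _ _).2 dB).
by apply: mderivE; exact/derivable_mxP.
Qed.

Lemma mderivableM p q r i (A : 'rV[R]_N -> 'M[R]_(p, q)) (B : 'rV[R]_N -> 'M[R]_(q, r)) x :
  mderivable i A x -> mderivable i B x -> mderivable i (fun y => A y *m B y) x.
Proof.
move=> dA dB; apply/derivable_mxP.
by have [] := is_derive_mulmx ((derivable_mxP _ _ _).2 dA) ((derivable_mxP _ _ _).2 dB).
Qed.

Lemma mderivT p q i (A : 'rV[R]_N -> 'M[R]_(p, q)) x :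
  mderiv i (fun y => (A y)^T) x = (mderiv i A x)^T.
Proof.
apply/matrixP => a b; rewrite [RHS]mxE !mderiv_entry; congr (pderiv _ _ _).
by apply/funext => y; rewrite mxE.
Qed.

Lemma mderivableT p q i (A : 'rV[R]_N -> 'M[R]_(p, q)) x :
  mderivable i A x -> mderivable i (fun y => (A y)^T) x.
Proof. by move=> dA a b; under eq_fun do rewrite mxE; exact: dA. Qed.

Lemma mderivD p q i (A B : 'rV[R]_N -> 'M[R]_(p, q)) x :
  mderivable i A x -> mderivable i B x ->
  mderiv i (fun y => A y + B y) x = mderiv i A x + mderiv i B x.
Proof.
move=> dA dB; apply/matrixP => a b; rewrite !mxE; under eq_fun do rewrite mxE.
exact: (@deriveD _ _ R^o _ _ _ _ (dA a b) (dB a b)).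
Qed.

Lemma mderivableD p q i (A B : 'rV[R]_N -> 'M[R]_(p, q)) x :
  mderivable i A x -> mderivable i B x -> mderivable i (fun y => A y + B y) x.
Proof.
move=> dA dB a b; under eq_fun do rewrite mxE.
exact: (@derivableD _ _ R^o _ _ _ _ (dA a b) (dB a b)).
Qed.

Lemma mderivB p q i (A B : 'rV[R]_N -> 'M[R]_(p, q)) x :
  mderivable i A x -> mderivable i B x ->
  mderiv i (fun y => A y - B y) x = mderiv i A x - mderiv i B x.
Proof.
move=> dA dB; apply/matrixP => a b; rewrite !mxE; under eq_fun do rewrite !mxE.
exact: (@deriveB _ _ R^o _ _ _ _ (dA a b) (dB a b)).
Qed.

Lemma mderivableB p q i (A B : 'rV[R]_N -> 'M[R]_(p, q)) x :
  mderivable i A x -> mderivable i B x -> mderivable i (fun y => A y - B y) x.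
Proof.
move=> dA dB a b; under eq_fun do rewrite !mxE.
exact: (@derivableB _ _ R^o _ _ _ _ (dA a b) (dB a b)).
Qed.

Lemma mderivZ p q i (f : 'rV[R]_N -> R) (A : 'rV[R]_N -> 'M[R]_(p, q)) x :
  derivable f x (delta_mx 0 i) -> mderivable i A x ->
  mderiv i (fun y => f y *: A y) x = pderiv i f x *: A x + f x *: mderiv i A x.
Proof.
move=> df dA; apply/matrixP => a b; rewrite !mxE; under eq_fun do rewrite !mxE.
have e := deriveM df (dA a b).
rewrite [LHS]e addrC; congr (_ + _); exact: mulrC.
Qed.

Lemma mderivableZ p q i (f : 'rV[R]_N -> R) (B : 'rV[R]_N -> 'M[R]_(p, q)) x :
  derivable f x (delta_mx 0 i) -> mderivable i B x -> mderivable i (fun y => f y *: B y) x.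
Proof.
move=> df dB c d; have -> : (fun y => (f y *: B y) c d) = (fun y => f y * B y c d).
  by apply/funext => y; rewrite mxE.
exact: derivableM df (dB c d).
Qed.

Lemma mderiv_sum p q (I : Type) (r : seq I) i (A : I -> 'rV[R]_N -> 'M[R]_(p, q)) x :
  (forall a, mderivable i (A a) x) ->
  mderivable i (fun y => \sum_(a <- r) A a y) x /\
  mderiv i (fun y => \sum_(a <- r) A a y) x = \sum_(a <- r) mderiv i (A a) x.
Proof.
move=> dA; elim: r => [|a r [dr er]].
  split=> [a b|].
    by under eq_fun do rewrite big_nil mxE; exact: derivable_cst.
  by rewrite big_nil; apply/matrixP => a b; rewrite !mxE;
    under eq_fun do rewrite big_nil mxE; rewrite pderiv_cst.
have -> : (fun y => \sum_(b <- a :: r) A b y) =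
    (fun y => A a y + \sum_(b <- r) A b y).
  by apply/funext => y; rewrite big_cons.
split; first exact: mderivableD (dA a) dr.
by rewrite big_cons -er; exact: mderivD (dA a) dr.
Qed.

Lemma mderiv_cst p q i (A : 'M[R]_(p, q)) x :
  mderivable i (fun=> A) x /\ mderiv i (fun=> A) x = 0.
Proof.
split; first by move=> a b; exact: derivable_cst.
by apply/matrixP => a b; rewrite !mxE pderiv_cst.
Qed.

Lemma mderiv_near p q i (U : set 'rV[R]_N) (A B : 'rV[R]_N -> 'M[R]_(p, q)) x :
  open U -> U x -> (forall y, U y -> A y = B y) -> mderiv i A x = mderiv i B x.
Proof.
move=> oU Ux AB; apply/matrixP => a b; rewrite !mxE; apply: near_eq_derive.
by apply: filterS (open_nbhs_nbhs (conj oU Ux)) => y /AB ->.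
Qed.

Lemma mderivC p q i j (U : set 'rV[R]_N) (A : 'rV[R]_N -> 'M[R]_(p, q)) x :
  open U -> U x -> mx_smooth U A ->
  mderiv i (mderiv j A) x = mderiv j (mderiv i A) x.
Proof.
move=> oU Ux sA; apply/matrixP => a b; rewrite [LHS]mderiv_entry [RHS]mderiv_entry.
by rewrite !mderiv_entry_fun; exact: (pderiv_pderivC i j oU (sA a b) Ux).
Qed.

Lemma mx_smooth_mderiv p q (U : set 'rV[R]_N) i (A : 'rV[R]_N -> 'M[R]_(p, q)) :
  mx_smooth U A -> mx_smooth U (mderiv i A).
Proof.
by move=> sA a b; rewrite mderiv_entry_fun; exact: smooth_on_pderiv.
Qed.

(** Unlike [mxE], these rules open only the linear operations and keep matrix products folded, so
    that entries of products remain atoms for [ring]. *)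
Lemma addmxE p q (A B : 'M[R]_(p, q)) a b : (A + B) a b = A a b + B a b.
Proof. by rewrite mxE. Qed.

Lemma oppmxE p q (A : 'M[R]_(p, q)) a b : (- A) a b = - A a b.
Proof. by rewrite mxE. Qed.

Lemma zeromxE p q a b : (0 : 'M[R]_(p, q)) a b = 0.
Proof. by rewrite mxE. Qed.

Lemma row_addmx p q (A B : 'M[R]_(p, q)) a : row a (A + B) = row a A + row a B.
Proof. by apply/rowP => b; rewrite !mxE. Qed.

Lemma row_oppmx p q (A : 'M[R]_(p, q)) a : row a (- A) = - row a A.
Proof. by apply/rowP => b; rewrite !mxE. Qed.

Lemma tr_addmx p q (A B : 'M[R]_(p, q)) : (A + B)^T = A^T + B^T.
Proof. by apply/matrixP => a b; rewrite !mxE. Qed.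

Lemma tr_oppmx p q (A : 'M[R]_(p, q)) : (- A)^T = - A^T.
Proof. by apply/matrixP => a b; rewrite !mxE. Qed.

Lemma scalemxE p q (c : R) (A : 'M[R]_(p, q)) a b : (c *: A) a b = c * A a b.
Proof. by rewrite mxE. Qed.

End MatrixDerivative.

(** * Connection matrices, Bianchi identities, Schur's lemma *)

Section ConnectionMatrices.
Variables (R : realType) (N : nat) (U : set 'rV[R]_N).
Variable Gm : 'I_N -> 'rV[R]_N -> 'M[R]_N.
Hypothesis U_open : open U.
Hypothesis Gm_smooth : forall i, mx_smooth U (Gm i).
Implicit Types (x : 'rV[R]_N) (i j k : 'I_N) (G : 'rV[R]_N -> 'M[R]_N).

(* Rows act on the right, [nabla_i Y = d_i Y + Y Gm_i], whence the order of the
   factors in the curvature matrix. *)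
Definition curvmx i j x : 'M[R]_N :=
  mderiv i (Gm j) x - mderiv j (Gm i) x + Gm j x *m Gm i x - Gm i x *m Gm j x.

(** Row [j] of [Gm i] is the covariant derivative of the coordinate field [j] in direction [i].
    Coordinate fields commute, so vanishing torsion is this symmetry. *)
Definition torsion_free := forall x i j, U x -> row j (Gm i x) = row i (Gm j x).

Definition metric_compat G :=
  forall x i, U x -> mderiv i G x = Gm i x *m G x + G x *m (Gm i x)^T.

Let dGm i j x : U x -> mderivable i (Gm j) x.
Proof. exact: mx_smooth_derivable. Qed.

Let ddGm i j k x : U x -> mderivable i (mderiv j (Gm k)) x.
Proof. by apply: mx_smooth_derivable; exact: mx_smooth_mderiv. Qed.

Lemma curvmxC i j x : curvmx j i x = - curvmx i j x.
Proof. by apply/matrixP => a b; rewrite /curvmx !(addmxE, oppmxE); ring. Qed.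

Lemma row_mderiv p q i (k : 'I_p) (A : 'rV[R]_N -> 'M[R]_(p, q)) x :
  row k (mderiv i A x) = mderiv i (fun y => row k (A y)) x.
Proof.
apply/matrixP => a b; rewrite [LHS]mxE !mderiv_entry; congr (pderiv _ _ _).
by apply/funext => y; rewrite mxE.
Qed.

(** Torsion freeness holds on an open set and may be differentiated. It exchanges the row index with
    the index of a connection matrix, after which the terms of the cyclic sum cancel in pairs. *)
Lemma bianchi1 x i j k : torsion_free -> U x ->
  row k (curvmx i j x) + row i (curvmx j k x) + row j (curvmx k i x) = 0.
Proof.
move=> tf Ux; rewrite /curvmx !(row_addmx, row_oppmx, row_mul).
have d a b c : row c (mderiv a (Gm b) x) = row b (mderiv a (Gm c) x).
  by rewrite !row_mderiv; apply: (mderiv_near a U_open Ux) => y Uy; exact: tf.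
rewrite (d i k j) (d j i k) (d k j i) (tf x k j Ux) (tf x i k Ux) (tf x j i Ux).
move: (row _ (mderiv i _ x)) (row _ (mderiv j _ x)) (row _ (mderiv k _ x)) => A B C.
move: (_ *m Gm i x) (_ *m Gm j x) (_ *m Gm k x) => A' B' C'.
by apply/rowP => a; rewrite [RHS]zeromxE !(addmxE, oppmxE); ring.
Qed.

(** The second derivatives of [G] commute; expanding both orders by means of the metric condition
    leaves exactly this identity. *)
Lemma curvmx_skew G x i j : mx_smooth U G -> metric_compat G -> U x ->
  curvmx i j x *m G x + G x *m (curvmx i j x)^T = 0.
Proof.
move=> sG mc Ux.
have dG a : mderivable a G x by exact: mx_smooth_derivable Ux.
have E a b : mderiv a (mderiv b G) x =
    mderiv a (Gm b) x *m G x + Gm b x *m mderiv a G x +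
    (mderiv a G x *m (Gm b x)^T + G x *m (mderiv a (Gm b) x)^T).
  rewrite (mderiv_near a U_open Ux (fun y Uy => mc y b Uy)).
  have dT := mderivableT (@dGm a b x Ux).
  rewrite (mderivD (mderivableM (@dGm a b x Ux) (dG a)) (mderivableM (dG a) dT)).
  by rewrite (mderivM (@dGm a b x Ux) (dG a)) (mderivM (dG a) dT) mderivT.
have := mderivC i j U_open Ux sG.
rewrite !E (mc _ i Ux) (mc _ j Ux) /curvmx !(tr_addmx, tr_oppmx, trmx_mul).
rewrite !(mulmxDl, mulmxDr, mulNmx, mulmxN, mulmxA).
(* Once all products are multiplied out, the product is generalised to an arbitrary function, and a
   linear identity between its values remains. The same device recurs below. *)
move: (@mulmx R N N N) => mm /matrixP e.
apply/matrixP => a b; rewrite [RHS]zeromxE; have := e a b.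
rewrite !(addmxE, oppmxE) => /eqP.
rewrite -subr_eq0 => /eqP <-; ring.
Qed.

Lemma mderiv_curvmx x i j k : U x -> mderiv k (curvmx i j) x =
  mderiv k (mderiv i (Gm j)) x - mderiv k (mderiv j (Gm i)) x +
  (mderiv k (Gm j) x *m Gm i x + Gm j x *m mderiv k (Gm i) x) -
  (mderiv k (Gm i) x *m Gm j x + Gm i x *m mderiv k (Gm j) x).
Proof.
move=> Ux; have d a := @dGm k a x Ux; have dd a b := @ddGm k a b x Ux.
rewrite (mderivB (mderivableD (mderivableB (dd i j) (dd j i)) (mderivableM (d j) (d i)))
  (mderivableM (d i) (d j))).
rewrite (mderivD (mderivableB (dd i j) (dd j i)) (mderivableM (d j) (d i))).
by rewrite (mderivB (dd i j) (dd j i)) (mderivM (d i) (d j)) (mderivM (d j) (d i)).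
Qed.

(** The covariant derivative of the curvature as an endomorphism, with [i] and [j] treated as mere
    labels. Its cyclic sum is the exterior covariant derivative of the curvature form. *)
Definition cov_curvmx k i j x :=
  mderiv k (curvmx i j) x + curvmx i j x *m Gm k x - Gm k x *m curvmx i j x.

Lemma bianchi2 x i j k : U x ->
  cov_curvmx k i j x + cov_curvmx i j k x + cov_curvmx j k i x = 0.
Proof.
move=> Ux; rewrite /cov_curvmx !mderiv_curvmx // /curvmx.
rewrite (mderivC k i U_open Ux (Gm_smooth j)) (mderivC j k U_open Ux (Gm_smooth i)).
rewrite (mderivC i j U_open Ux (Gm_smooth k)).
rewrite !(mulmxDl, mulmxDr, mulNmx, mulmxN, mulmxA).
move: (mderiv _ (mderiv _ _) x) (mderiv _ (mderiv _ _) x) (mderiv _ (mderiv _ _) x).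
move: (mderiv i _ x) (mderiv i _ x) (mderiv j _ x) (mderiv j _ x) (mderiv k _ x) (mderiv k _ x).
move: (Gm i x) (Gm j x) (Gm k x) (@mulmx R N N N) => C1 C2 C3 mm A1 A2 A3 A4 A5 A6 B1 B2 B3.
apply/matrixP => a b; rewrite [RHS]zeromxE !(addmxE, oppmxE); ring.
Qed.

(** A row [w] times [G *m wedgemx i j] is [<w, e_j> e_i - <w, e_i> e_j]: this product is the
    curvature matrix of constant curvature 1. *)
Definition wedgemx i j : 'M[R]_N := delta_mx j i - delta_mx i j.

(** By metric compatibility the covariant derivative of [G *m wedgemx i j] consists of connection
    terms only, and these vanish in the cyclic sum by torsion freeness. The second Bianchi identity
    therefore says that the cyclic sum of [pderiv a kap x *: wedgemx i j] is zero, and three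
    distinct indices isolate one derivative. *)
Lemma schur_local G (kap : 'rV[R]_N -> R) x k : (2 < N)%N ->
  torsion_free -> metric_compat G -> mx_smooth U G ->
  (forall y, U y -> G y \in unitmx) ->
  (forall y i j, U y -> curvmx i j y = kap y *: (G y *m wedgemx i j)) ->
  (forall i, derivable kap x (delta_mx 0 i)) -> U x ->
  pderiv k kap x = 0.
Proof.
move=> N2 tf mc sG uG curvE dk Ux.
have dGS a i j : mderivable a (fun y => G y *m wedgemx i j) x /\
    mderiv a (fun y => G y *m wedgemx i j) x = mderiv a G x *m wedgemx i j.
  have dG : mderivable a G x by exact: mx_smooth_derivable Ux.
  have [dS eS] := mderiv_cst a (wedgemx i j) x.
  by split; [exact: mderivableM|rewrite mderivM // eS mulmx0 addr0].
have covE a i j : cov_curvmx a i j x = pderiv a kap x *: (G x *m wedgemx i j) +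
    kap x *: (G x *m ((Gm a x)^T *m wedgemx i j + wedgemx i j *m Gm a x)).
  rewrite /cov_curvmx (mderiv_near a U_open Ux (fun y Uy => curvE y i j Uy)).
  have [d e] := dGS a i j; rewrite mderivZ // e mc // curvE //.
  rewrite -addrA -addrA; congr (_ + _).
  rewrite -scalemxAl -scalemxAr -scalerBr -scalerDr; congr (_ *: _).
  rewrite mulmxDl mulmxDr !mulmxA.
  by apply/matrixP => b c; rewrite !(addmxE, oppmxE); ring.
have cyc0 a i j : wedgemx i j *m Gm a x + wedgemx j a *m Gm i x +
    wedgemx a i *m Gm j x = 0.
  rewrite /wedgemx !mulmxBl.
  have dm u v w : delta_mx u v *m Gm w x = (delta_mx 0 u : 'rV[R]_N)^T *m row v (Gm w x).
    by rewrite rowE mulmxA trmx_delta mul_delta_mx.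
  rewrite !dm (tf x a i Ux) (tf x a j Ux) (tf x i j Ux).
  by apply/matrixP => b c; rewrite [RHS]zeromxE !(addmxE, oppmxE); ring.
have skT i j : (wedgemx i j)^T = - wedgemx i j.
  by rewrite /wedgemx tr_addmx tr_oppmx !trmx_delta opprB.
have cyc0T a i j : (Gm a x)^T *m wedgemx i j + (Gm i x)^T *m wedgemx j a +
    (Gm j x)^T *m wedgemx a i = 0.
  have := congr1 trmx (cyc0 a i j); rewrite tr_addmx [X in X + _]tr_addmx.
  rewrite !trmx_mul !skT !mulmxN trmx0.
  by rewrite -!opprD => /eqP; rewrite oppr_eq0 => /eqP.
have key a i j : pderiv a kap x *: wedgemx i j + pderiv i kap x *: wedgemx j a +
    pderiv j kap x *: wedgemx a i = 0.
  apply: (can_inj (mulKmx (uG _ Ux))); rewrite mulmx0 -(bianchi2 i j a Ux) !covE.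
  have := cyc0 a i j; have := cyc0T a i j.
  move=> e1 e2; have {e1 e2} : kap x *: (G x *m (((Gm a x)^T *m wedgemx i j + (Gm i x)^T *m wedgemx j a +
    (Gm j x)^T *m wedgemx a i) + (wedgemx i j *m Gm a x + wedgemx j a *m Gm i x +
    wedgemx a i *m Gm j x))) = 0 by rewrite e1 e2 addr0 mulmx0 scaler0.
  move: (wedgemx i j) (wedgemx j a) (wedgemx a i) (Gm a x) (Gm i x) (Gm j x) => S1 S2 S3 C1 C2 C3.
  move: (pderiv a kap x) (pderiv i kap x) (pderiv j kap x) (kap x) => p1 p2 p3 p.
  rewrite !mulmxDr -!scalemxAr; move: (@mulmx R N N N) => mm e; apply/matrixP => b c.
  move/matrixP/(_ b c) : e; rewrite !(addmxE, scalemxE, oppmxE) zeromxE.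
  by move=> e; rewrite -[LHS]addr0 -e; ring.
(* Dimension at least three supplies [i] and [j] such that the entry at row [i] and column [j] of
   the cyclic sum sees only the derivative in direction [k]. *)
have [i [j [ik [jk ij]]]] : exists i j : 'I_N, i != k /\ j != k /\ i != j.
  have : (1 < #|predC1 k|)%N by rewrite cardC1 card_ord -ltnS prednK // (ltn_trans _ N2).
  by move=> /card_gt1P[i [j [ik jk ij]]]; exists i, j.
have /matrixP/(_ i j) := key k i j.
rewrite !mxE !eqxx (negbTE ij) (negbTE ik) (negbTE jk) /=.
rewrite !(andbF, andFb, subrr, mulr0, addr0, sub0r, subr0) mulrN1 => /eqP.
by rewrite oppr_eq0 => /eqP.
Qed.

End ConnectionMatrices.

(** * Spectrum of a self-adjoint operator *)

Lemma rank_diag_mx (F : fieldType) n (d : 'rV[F]_n) :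
  \rank (diag_mx d) = (\sum_i (d 0%R i != 0%R))%N.
Proof.
elim: n d => [|n IH] d; first by rewrite big_ord0 thinmx0 mxrank0.
suff: forall d : 'rV[F]_(1 + n), \rank (diag_mx d) = (\sum_(i < 1 + n) (d 0%R i != 0%R))%N.
  exact.
move=> {}d; rewrite -[in LHS](hsubmxK d) diag_mx_row rank_diag_block_mx IH big_split_ord big_ord1.
congr (_ + _)%N.
  have -> : diag_mx (lsubmx d) = (d 0 (lshift n 0))%:M.
    by apply/matrixP => i j; rewrite !ord1 !mxE eqxx.
  by rewrite rank_rV -scalemx1 scaler_eq0 oner_eq0 orbF.
by apply: eq_bigr => i _; rewrite mxE.
Qed.

Section SelfAdjointSpectrum.
Import complex.
Variables (R : rcfType) (n : nat).
Local Notation C := (complex.complex R).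
Local Notation toC := (map_mx (complex.real_complex R)).
Local Open Scope sesquilinear_scope.
Implicit Types (G J : 'M[R]_n).

Lemma toC_conj m p (A : 'M[R]_(m, p)) : (toC A) ^t* = toC A^T.
Proof.
by apply/matrixP => i j; rewrite !mxE; exact: complex.conjc_real.
Qed.

(** With [w = a + i b], symmetry of [G] cancels the imaginary cross terms, and the value at [w] is
    the sum of the values at [a] and at [b]. *)
Lemma posdef_toC G (w : 'rV[C]_n) : G^T = G ->
  (forall v : 'rV[R]_n, v != 0 -> 0 < (v *m G *m v^T) 0 0) -> w != 0 ->
  0 < (w *m toC G *m w ^t*) 0 0.
Proof.
move=> Gsym Gpos w0; pose a := map_mx (@complex.Re R) w; pose b := map_mx (@complex.Im R) w.
pose ii : C := complex.Complex 0 1.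
have ii2 : ii * ii = -1 by have := complex.sqr_i R; rewrite expr2.
have wE : w = toC a + ii *: toC b.
  by apply/rowP => i; rewrite !mxE -complex.complexE.
have wtE : w ^t* = toC a^T - ii *: toC b^T.
  apply/colP => i; rewrite !mxE; case: (w 0 i) => x y.
  by apply/eqP; rewrite eq_complex /=; apply/andP; split; apply/eqP; ring.
have cross : b *m G *m a^T = a *m G *m b^T.
  have -> : a *m G *m b^T = (b *m G *m a^T)^T by rewrite !trmx_mul trmxK Gsym mulmxA.
  by apply/matrixP => i j; rewrite !ord1 [RHS]mxE.
have -> : w *m toC G *m w ^t* = toC (a *m G *m a^T + b *m G *m b^T).
  rewrite wtE [in LHS]wE !(mulmxDl, mulmxBr) -!scalemxAl -!scalemxAr -!map_mxM /= cross.
  by rewrite scalerA ii2 scaleN1r opprB map_mxD /= addrACA subrr addr0.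
have ge0 (v : 'rV[R]_n) : 0 <= (v *m G *m v^T) 0 0.
  by have [->|/Gpos/ltW//] := eqVneq v 0; rewrite !mul0mx mxE.
rewrite mxE complex.ltcR mxE.
have [a0|a0] := eqVneq a 0; last by rewrite ltr_pwDl ?Gpos.
have [b0|b0] := eqVneq b 0; last by rewrite ltr_wpDl ?Gpos.
by move: w0; rewrite wE a0 b0 !map_mx0 scaler0 addr0 eqxx.
Qed.

(** The spectral theorem is applied twice. A decomposition of [G] yields [L] with [L *m L ^t*] equal
    to [G]; conjugation by [L] turns the self-adjoint [J] into a hermitian matrix [H], whose
    decomposition has real eigenvalues. *)
Lemma selfadjoint_diag G J : G^T = G ->
  (forall v : 'rV[R]_n, v != 0 -> 0 < (v *m G *m v^T) 0 0) ->
  J *m G = G *m J^T ->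
  exists (r : 'rV[R]_n) (M : 'M[C]_n),
    M \in unitmx /\ toC J *m M = M *m diag_mx (toC r).
Proof.
move=> Gsym Gpos JG; set Gc := toC G; set Jc := toC J.
have starM (A B : 'M[C]_n) : (A *m B) ^t* = B ^t* *m A ^t*.
  by rewrite trmx_mul map_mxM.
have herm (A : 'M[C]_n) : A ^t* = A -> A \is hermsymmx.
  by move=> e; apply/is_hermitianmxP; rewrite expr0 scale1r e.
have Gherm : Gc ^t* = Gc by rewrite toC_conj Gsym.
have /hermitian_normalmx/orthomx_spectralP := herm _ Gherm.
set P := spectralmx _; set d := spectral_diag _ => GE.
have Pu : P \is unitarymx by exact: spectral_unitarymx.
have PU : P \in unitmx by exact: spectral_unit.
have Pinv : invmx P = P ^t* by exact: invmx_unitary.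
have d0 i : 0 < d 0 i.
  have -> : d 0 i = (row i P *m Gc *m (row i P) ^t*) 0 0.
    transitivity ((P *m Gc *m P ^t*) i i).
      by rewrite GE -Pinv mulmxA mulmxK // mulmxA mulmxV // mul1mx mxE eqxx.
    by rewrite -row_mul [LHS]mxE [RHS]mxE; apply: eq_bigr => k _; rewrite !mxE.
  apply: posdef_toC => //; apply: contraTneq isT => e.
  move/unitarymxP: (Pu) => /matrixP/(_ i i).
  rewrite !mxE eqxx big1 => [/eqP|k _]; first by rewrite eq_sym oner_eq0.
  by have /rowP/(_ k) := e; rewrite !mxE => ->; rewrite mul0r.
pose D := diag_mx (map_mx sqrtC d); pose L := P ^t* *m D.
have Dstar : D ^t* = D.
  rewrite /D tr_diag_mx map_diag_mx; congr diag_mx; apply/rowP => i.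
  by rewrite !mxE; apply: geC0_conj; rewrite sqrtC_ge0 ltW.
have Lstar : L ^t* = D *m P by rewrite starM Dstar trmxCK.
have LL : L *m L ^t* = Gc.
  rewrite Lstar /L mulmxA -(mulmxA _ D D) GE Pinv; congr (_ *m _ *m _).
  rewrite /D mulmx_diag; congr diag_mx; apply/rowP => i.
  by rewrite !mxE -expr2 sqrtCK.
have GcU : Gc \in unitmx.
  rewrite GE !unitmx_mul unitmx_inv PU andbT /= unitmxE det_diag unitfE.
  by apply/prodf_neq0 => i _; rewrite gt_eqF.
have [LU LsU] : L \in unitmx /\ L ^t* \in unitmx.
  by move: GcU; rewrite -LL unitmx_mul => /andP.
clear Lstar; clearbody L.
pose H := invmx L *m Jc *m L.
have Jstar : Jc *m Gc = Gc *m Jc ^t* by rewrite toC_conj -!map_mxM JG.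
have Hherm : H ^t* = H.
  apply: (can_inj (mulmxK LsU)).
  have -> : H *m L ^t* = L ^t* *m Jc ^t*.
    by rewrite /H -!mulmxA LL Jstar -LL -!mulmxA mulKmx.
  rewrite /H !starM -!mulmxA -starM mulmxV //.
  by rewrite trmx1 map_mx1 mulmx1.
have LH : L *m H = Jc *m L by rewrite /H -mulmxA mulKVmx.
clearbody H; have Hh := herm _ Hherm.
have /hermitian_normalmx/orthomx_spectralP := Hh.
have := hermitian_spectral_diag_real Hh.
set Q := spectralmx H; set e := spectral_diag H => ereal HE.
have QU : Q \in unitmx by exact: spectral_unit.
exists (map_mx (@complex.Re R) e), (L *m invmx Q); split.
  by rewrite unitmx_mul LU unitmx_inv.
have -> : toC (map_mx (@complex.Re R) e) = e.
  by apply/rowP => i; rewrite !mxE; apply: complex.RRe_real; move/mxOverP: ereal; apply.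
by rewrite mulmxA -LH HE !mulmxA mulmxK.
Qed.

(** The rank of a matrix does not change under field extension, so real multiplicities can be read
    off the complex diagonal form. The last item serves to prove an operator zero by excluding
    nonzero eigenvalues. *)
Lemma selfadjoint_spectrum G J : G^T = G ->
  (forall v : 'rV[R]_n, v != 0 -> 0 < (v *m G *m v^T) 0 0) ->
  J *m G = G *m J^T ->
  exists rs : seq R,
    [/\ forall a, \rank (eigenspace J a) = count_mem a rs,
        \tr J = \sum_(r <- rs) r &
        (forall r, r \in rs -> r = 0) -> J = 0].
Proof.
move=> Gsym Gpos JG; have [r [M [MU JM]]] := selfadjoint_diag Gsym Gpos JG.
have JE : toC J = M *m diag_mx (toC r) *m invmx M by rewrite -JM mulmxK.
exists [seq r 0 i | i <- enum 'I_n]; split.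
- move=> a; rewrite mxrank_ker -(mxrank_map (complex.real_complex R)).
  have -> : toC (J - a%:M) = M *m diag_mx (toC (r - const_mx a)) *m invmx M.
    rewrite map_mxB map_scalar_mx JE map_mxB linearB /= mulmxBr mulmxBl; congr (_ - _).
    by rewrite map_const_mx diag_const_mx mul_mx_scalar -scalemxAl mulmxV // scalemx1.
  rewrite mxrankMfree ?row_free_unit ?unitmx_inv // -mxrank_tr trmx_mul.
  rewrite mxrankMfree ?row_free_unit ?unitmx_tr // mxrank_tr rank_diag_mx.
  rewrite count_map -sum1_count [RHS]big_enum_cond [RHS]big_mkcond /=.
  have sumn : (\sum_(i < n) 1 = n)%N by rewrite sum1_card card_ord.
  apply/eqP; rewrite -(eqn_add2r (\sum_(i < n) (toC (r - const_mx a) 0%R i != 0%R))) subnK.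
    rewrite -big_split /= -[X in X == _]sumn; apply/eqP/eq_bigr => i _.
    by rewrite mxE fmorph_eq0 !mxE subr_eq0; case: eqP.
  by rewrite -[X in (_ <= X)%N]sumn leq_sum // => i _; case: (_ != _).
- apply: (@complex.complexI R); rewrite -trace_map_mx JE mxtrace_mulC mulKmx //.
  rewrite mxtrace_diag rmorph_sum /= big_map big_enum /=.
  by apply: eq_bigr => i _; rewrite mxE.
- move=> r0; apply/eqP; rewrite -(map_mx_eq0 (complex.real_complex R)) JE.
  have -> : r = 0.
    by apply/rowP => i; rewrite mxE; apply: r0; apply: map_f; rewrite mem_enum.
  by rewrite map_mx0 linear0 mulmx0 mul0mx.
Qed.

End SelfAdjointSpectrum.

(** * Algebraic curvature tensors *)

Section PolynomialRatio.
Variable R : realType.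

Lemma poly0_of_horner0 (p : {poly R}) : (forall t, p.[t] = 0) -> p = 0.
Proof.
move=> p0; apply/eqP; apply: contraT => pn0.
have rp : all (root p) [seq i%:R | i <- iota 0 (size p)].
  by apply/allP => t _; apply/rootP.
have up : uniq [seq i%:R : R | i <- iota 0 (size p)].
  by rewrite map_inj_uniq ?iota_uniq // => i j /eqP; rewrite eqr_nat => /eqP.
by have := max_poly_roots pn0 rp up; rewrite size_map size_iota ltnn.
Qed.

(** The product of all [p - s *: q] vanishes at every point, hence is the zero polynomial, and
    polynomials form an integral domain. *)
Lemma poly_ratio_cst (S : seq R) (p q : {poly R}) :
  (forall t, exists2 s, s \in S & p.[t] = s * q.[t]) ->
  exists2 s, s \in S & p = s *: q.
Proof.
move=> pq; have /eqP : \prod_(s <- S) (p - s *: q) = 0.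
  apply: poly0_of_horner0 => t; have [s sS e] := pq t.
  apply/eqP; rewrite horner_prod prodf_seq_eq0; apply/hasP; exists s => //=.
  by rewrite !hornerE e subrr.
rewrite prodf_seq_eq0 => /hasP[s sS /=]; rewrite subr_eq0 => /eqP e.
by exists s.
Qed.

End PolynomialRatio.

Section AlgebraicCurvature.
Variables (R : realType) (N : nat) (G : 'M[R]_N) (Om : 'I_N -> 'I_N -> 'M[R]_N).
Hypothesis G_sym : G^T = G.
Hypothesis G_posdef : forall v : 'rV[R]_N, v != 0 -> 0 < (v *m G *m v^T) 0 0.
Hypothesis Om_anti : forall i j, Om j i = - Om i j.
Hypothesis Om_skew : forall i j, Om i j *m G + G *m (Om i j)^T = 0.
Hypothesis Om_bianchi : forall i j k,
  row k (Om i j) + row i (Om j k) + row j (Om k i) = 0.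
Implicit Types u v w z : 'rV[R]_N.

Local Notation ip := (inner G).

Lemma innerC u v : ip u v = ip v u.
Proof.
rewrite /inner; have -> : v *m G *m u^T = (u *m G *m v^T)^T.
  by rewrite !trmx_mul trmxK G_sym mulmxA.
by rewrite [RHS]mxE.
Qed.

Lemma inner_gt0 v : v != 0 -> 0 < ip v v. Proof. exact: G_posdef. Qed.

Lemma inner_eq0 v : (ip v v == 0) = (v == 0).
Proof.
by apply/idP/eqP => [|->]; [apply: contraTeq => /inner_gt0/gt_eqF->|rewrite inner0l].
Qed.

Lemma inner_ext v w : (forall z, ip v z = ip w z) -> v = w.
Proof.
move=> e; apply/eqP; rewrite -subr_eq0 -inner_eq0 -scaleN1r innerDl innerZl e.
by rewrite mulN1r subrr.
Qed.

(** [Om i j] plays the role of the commutator of the covariant derivatives in directions [i] and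
    [j]; the minus sign is that of the curvature convention in force. *)
Definition Rc u v w : 'rV[R]_N :=
  - \sum_i \sum_j (u 0 i * v 0 j) *: (w *m Om i j).

Lemma RcDl u u' v w : Rc (u + u') v w = Rc u v w + Rc u' v w.
Proof.
rewrite /Rc -opprD -big_split; congr (- _); apply: eq_bigr => i _ /=.
by rewrite -big_split; apply: eq_bigr => j _; rewrite mxE mulrDl scalerDl.
Qed.

Lemma RcZl c u v w : Rc (c *: u) v w = c *: Rc u v w.
Proof.
rewrite /Rc scalerN scaler_sumr; congr (- _); apply: eq_bigr => i _ /=.
by rewrite scaler_sumr; apply: eq_bigr => j _; rewrite mxE scalerA mulrA.
Qed.

Lemma RcC u v w : Rc v u w = - Rc u v w.
Proof.
rewrite /Rc exchange_big -!sumrN; apply: eq_bigr => i _ /=.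
rewrite -!sumrN; apply: eq_bigr => j _.
by rewrite Om_anti mulmxN scalerN mulrC.
Qed.

Lemma RcDm u v v' w : Rc u (v + v') w = Rc u v w + Rc u v' w.
Proof. by rewrite RcC RcDl opprD -!RcC. Qed.

Lemma RcZm c u v w : Rc u (c *: v) w = c *: Rc u v w.
Proof. by rewrite RcC RcZl -scalerN -RcC. Qed.

Lemma RcDr u v w w' : Rc u v (w + w') = Rc u v w + Rc u v w'.
Proof.
rewrite /Rc -opprD -big_split; congr (- _); apply: eq_bigr => i _ /=.
by rewrite -big_split; apply: eq_bigr => j _; rewrite mulmxDl scalerDr.
Qed.

Lemma RcZr c u v w : Rc u v (c *: w) = c *: Rc u v w.
Proof.
rewrite /Rc scalerN scaler_sumr; congr (- _); apply: eq_bigr => i _ /=.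
rewrite scaler_sumr; apply: eq_bigr => j _.
by rewrite -scalemxAl !scalerA mulrC.
Qed.

Definition r4 u v w z := ip (Rc u v w) z.

Lemma r4D1 u u' v w z : r4 (u + u') v w z = r4 u v w z + r4 u' v w z.
Proof. by rewrite /r4 RcDl innerDl. Qed.
Lemma r4D2 u v v' w z : r4 u (v + v') w z = r4 u v w z + r4 u v' w z.
Proof. by rewrite /r4 RcDm innerDl. Qed.
Lemma r4D3 u v w w' z : r4 u v (w + w') z = r4 u v w z + r4 u v w' z.
Proof. by rewrite /r4 RcDr innerDl. Qed.
Lemma r4D4 u v w z z' : r4 u v w (z + z') = r4 u v w z + r4 u v w z'.
Proof. by rewrite /r4 innerDr. Qed.
Lemma r4Z1 c u v w z : r4 (c *: u) v w z = c * r4 u v w z.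
Proof. by rewrite /r4 RcZl innerZl. Qed.
Lemma r4Z2 c u v w z : r4 u (c *: v) w z = c * r4 u v w z.
Proof. by rewrite /r4 RcZm innerZl. Qed.
Lemma r4Z4 c u v w z : r4 u v w (c *: z) = c * r4 u v w z.
Proof. by rewrite /r4 innerZr. Qed.

Lemma r4C12 u v w z : r4 v u w z = - r4 u v w z.
Proof. by rewrite /r4 RcC -scaleN1r innerZl mulN1r. Qed.

Lemma inner_oppl v w : ip (- v) w = - ip v w.
Proof. by rewrite -scaleN1r innerZl mulN1r. Qed.

Lemma inner_oppr v w : ip v (- w) = - ip v w.
Proof. by rewrite -scaleN1r innerZr mulN1r. Qed.

Lemma r4C34 u v w z : r4 u v z w = - r4 u v w z.
Proof.
apply/eqP; rewrite -addr_eq0 /r4 /Rc !inner_oppl -opprD oppr_eq0.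
rewrite !inner_suml -big_split big1 //= => i _.
rewrite !inner_suml -big_split big1 //= => j _.
rewrite !innerZl -mulrDr (innerC _ z) /inner trmx_mul.
have /(congr1 (fun M => (z *m M *m w^T) 0 0)) := Om_skew i j.
by rewrite mulmxDr mulmxDl !mulmxA mulmx0 mul0mx mxE [RHS]mxE => ->; rewrite mulr0.
Qed.

Lemma Rc_bianchi u v w : Rc u v w + Rc v w u + Rc w u v = 0.
Proof.
have E a b c : Rc a b c =
    - \sum_i \sum_j \sum_k (a 0 i * b 0 j * c 0 k) *: row k (Om i j).
  rewrite /Rc; congr (- _); apply: eq_bigr => i _; apply: eq_bigr => j _.
  by rewrite mulmx_sum_row scaler_sumr; apply: eq_bigr => k _; rewrite scalerA.
rewrite !E -!opprD; apply/eqP; rewrite oppr_eq0; apply/eqP.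
have -> : \sum_i \sum_j \sum_k (v 0 i * w 0 j * u 0 k) *: row k (Om i j) =
    \sum_i \sum_j \sum_k (u 0 i * v 0 j * w 0 k) *: row i (Om j k).
  rewrite [RHS]exchange_big; apply: eq_bigr => i _ /=; rewrite [RHS]exchange_big.
  apply: eq_bigr => j _; apply: eq_bigr => k _.
  by rewrite mulrC mulrA.
have -> : \sum_i \sum_j \sum_k (w 0 i * u 0 j * v 0 k) *: row k (Om i j) =
    \sum_i \sum_j \sum_k (u 0 i * v 0 j * w 0 k) *: row j (Om k i).
  rewrite exchange_big; apply: eq_bigr => i _ /=; rewrite exchange_big.
  apply: eq_bigr => j _; apply: eq_bigr => k _.
  by rewrite -mulrA mulrC.
rewrite -!big_split big1 //= => i _; rewrite -!big_split big1 //= => j _.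
rewrite -!big_split big1 //= => k _.
by rewrite -!scalerDr Om_bianchi scaler0.
Qed.

Lemma r4_bianchi u v w z : r4 u v w z + r4 v w u z + r4 w u v z = 0.
Proof. by rewrite /r4 -!innerDl Rc_bianchi inner0l. Qed.

(** The classical octahedron argument: four Bianchi identities are combined by means of the two skew
    symmetries, and linear arithmetic finds the combination. *)
Lemma r4_pair u v w z : r4 u v w z = r4 w z u v.
Proof.
have := r4_bianchi u v w z; have := r4_bianchi v w z u.
have := r4_bianchi w z u v; have := r4_bianchi z u v w.
have := r4C34 u v w z; have := r4C34 v w u z; have := r4C34 w u v z.
have := r4C34 w z v u; have := r4C34 v z u w; have := r4C34 z u v w.
have := r4C12 u v w z; have := r4C12 v w u z; have := r4C12 w u v z.
have := r4C12 z v w u; have := r4C12 u w z v; have := r4C12 z u w v.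
have := r4C34 z v w u; have := r4C34 v z w u; have := r4C34 u w z v.
have := r4C34 w z u v; have := r4C12 v z u w; have := r4C12 v z w u.
have := r4C34 w u z v.
lra.
Qed.

Definition Jac u : 'M[R]_N := lin1_mx (fun v => Rc u v u).

Lemma mul_lin1_mx (f : 'rV[R]_N -> 'rV[R]_N) v :
  (forall a b, f (a + b) = f a + f b) -> (forall c a, f (c *: a) = c *: f a) ->
  v *m lin1_mx f = f v.
Proof.
move=> fD fZ; have f0 : f 0 = 0 by have := fZ 0 0; rewrite !scale0r.
rewrite mulmx_sum_row {2}(row_sum_delta v) (big_morph f fD f0).
apply: eq_bigr => i _; rewrite fZ; congr (_ *: _).
by apply/rowP => j; rewrite !mxE.
Qed.

Lemma mul_Jac u v : v *m Jac u = Rc u v u.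
Proof. by apply: mul_lin1_mx => *; [exact: RcDm|exact: RcZm]. Qed.

Lemma selfadjointP (J : 'M[R]_N) :
  (forall v w, ip (v *m J) w = ip v (w *m J)) -> J *m G = G *m J^T.
Proof.
move=> sJ; apply/matrixP => i j; rewrite -!inner_delta.
have := sJ (delta_mx 0 i) (delta_mx 0 j).
by rewrite /inner trmx_mul !mulmxA.
Qed.

Lemma Jac_selfadjoint u : Jac u *m G = G *m (Jac u)^T.
Proof.
apply: selfadjointP => v w; rewrite !mul_Jac -/(r4 _ _ _ _) innerC.
by rewrite -/(r4 _ _ _ _) r4_pair.
Qed.

(** [<u, u>] times the orthogonal projection onto the complement of [u]. The factor avoids a
    division and makes constant curvature [mu] read [Jac u = mu *: proj_mx u]. *)
Definition proj_mx u : 'M[R]_N := (ip u u)%:M - G *m u^T *m u.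

Lemma mul_proj_mx u v : v *m proj_mx u = ip u u *: v - ip v u *: u.
Proof.
rewrite mulmxBr mul_mx_scalar !mulmxA; congr (_ - _).
by rewrite [v *m G *m u^T]mx11_scalar mul_scalar_mx.
Qed.

Lemma proj_selfadjoint u v w : ip (v *m proj_mx u) w = ip v (w *m proj_mx u).
Proof.
rewrite !mul_proj_mx -!scaleNr innerDl innerDr !innerZl !innerZr.
rewrite (innerC u w); ring.
Qed.

(** Polarising the hypothesis in [u] determines [Rc u v w + Rc w v u]. Its three cyclic instances
    and the first Bianchi identity are linear equations that determine [Rc u v w]. *)
Lemma Rc_cst (mu : R) :
  (forall u v, Rc u v u = mu *: (ip u u *: v - ip u v *: u)) ->
  forall u v w, Rc u v w = mu *: (ip u w *: v - ip v w *: u).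
Proof.
move=> H.
have pol u v w : Rc u v w + Rc w v u =
    mu *: ((ip u w + ip w u) *: v - ip u v *: w - ip w v *: u).
  have := H (u + w) v; rewrite !(RcDl, RcDr) !H !(innerDl, innerDr).
  move=> e; apply/rowP => a; move/rowP/(_ a): e.
  by rewrite !mxE => e; lra.
move=> u v w; have e1 := pol u v w; have e2 := pol v w u; have e3 := pol w u v.
have b := Rc_bianchi u v w.
rewrite (RcC v w u) (RcC w u v) (RcC u v w) in e1 e2 e3.
apply/rowP => a; move/rowP/(_ a): e1; move/rowP/(_ a): e2; move/rowP/(_ a): e3.
move/rowP/(_ a): b.
rewrite (innerC w u) (innerC v u) (innerC w v) !mxE => b e1 e2 e3.
lra.
Qed.

Lemma Om_cst (mu : R) i j :
  (forall u v w, Rc u v w = mu *: (ip u w *: v - ip v w *: u)) ->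
  Om i j = mu *: (G *m (delta_mx j i - delta_mx i j)).
Proof.
move=> H; have RcE w : Rc (delta_mx 0 i) (delta_mx 0 j) w = - (w *m Om i j).
  rewrite /Rc (bigD1 i) //= [X in _ + X]big1 ?addr0 => [|a /negbTE ne]; last first.
    by rewrite big1 // => b _; rewrite !mxE ne andbF mul0r scale0r.
  rewrite (bigD1 j) //= big1 ?addr0 => [|a /negbTE ne]; last first.
    by rewrite !mxE ne andbF mulr0 scale0r.
  by rewrite !mxE !eqxx mulr1 scale1r.
have row_delta (x : 'rV[R]_N) a b : x *m delta_mx a b = x 0 a *: delta_mx 0 b.
  apply/rowP => c; rewrite !mxE (bigD1 a) //= big1 ?addr0 ?mxE ?eqxx //.
  by move=> d /negbTE ne; rewrite mxE ne mulr0.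
apply/row_matrixP => k; rewrite !rowE; apply: oppr_inj; rewrite -RcE H.
rewrite -scalemxAr mulmxA mulmxBr !row_delta -[RHS]scalerN opprB.
by rewrite !(innerC _ (delta_mx 0 k)) !inner_delta -rowE !mxE.
Qed.

Definition osserman_at := forall u v, ip u u = 1 -> ip v v = 1 ->
  forall a, \rank (eigenspace (Jac u) a) = \rank (eigenspace (Jac v) a).

Lemma JacZ c u : Jac (c *: u) = c ^+ 2 *: Jac u.
Proof.
apply/row_matrixP => i; rewrite !rowE mul_Jac -scalemxAr mul_Jac.
by rewrite RcZl RcZr scalerA expr2.
Qed.

Lemma unit_vector u : u != 0 ->
  exists c e, [/\ u = c *: e, ip e e = 1, c != 0 & ip u u = c ^+ 2].
Proof.
move=> u0; have u_gt0 := inner_gt0 u0.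
have c0 : Num.sqrt (ip u u) != 0 by rewrite gt_eqF // sqrtr_gt0.
exists (Num.sqrt (ip u u)), ((Num.sqrt (ip u u))^-1 *: u); split => //.
- by rewrite scalerA mulfV // scale1r.
- rewrite innerZl innerZr mulrA -invfM -expr2 sqr_sqrtr ?ltW //.
  by rewrite mulVf // gt_eqF.
- by rewrite sqr_sqrtr // ltW.
Qed.

(** [Jac] is homogeneous of degree two, which reduces everything to unit vectors, and these share
    the eigenvalues and the trace of the single unit vector [e0]. *)
Lemma osserman_spectrum u0 : u0 != 0 -> osserman_at ->
  exists (S : seq R) (rho : R),
    (forall u v l, u != 0 -> v != 0 -> Rc u v u = l *: v ->
       exists2 s, s \in S & l = s * ip u u) /\
    (forall u, \tr (Jac u) = rho * ip u u).
Proof.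
move=> u0n oss; have [c0 [e0 [_ e01 _ _]]] := unit_vector u0n.
have [S [rankS trS _]] := selfadjoint_spectrum G_sym G_posdef (Jac_selfadjoint e0).
exists S, (\tr (Jac e0)); split.
  move=> u v l un vn uv; have [c [e [uE e1 cn cE]]] := unit_vector un.
  have c2 : c ^+ 2 != 0 by rewrite expf_neq0.
  exists (l / c ^+ 2); last by rewrite cE divfK.
  have ev : v *m Jac e = (l / c ^+ 2) *: v.
    rewrite mul_Jac; apply: (scalerI c2).
    by rewrite scalerA mulrC divfK // -uv uE RcZl RcZr scalerA expr2.
  have : (0 < \rank (eigenspace (Jac e) (l / c ^+ 2)))%N.
    by rewrite lt0n mxrank_eq0; apply/eigenvalueP; exists v.
  by rewrite (oss _ _ e1 e01) rankS -has_count has_pred1.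
move=> u; have [->|un] := eqVneq u 0.
  by rewrite -(scale0r (0 : 'rV_N)) JacZ innerZl mul0r mulr0 expr0n scale0r linear0.
have [c [e [uE e1 cn cE]]] := unit_vector un.
rewrite cE uE JacZ linearZ /= mulrC; congr (_ * _).
have [S' [rankS' trS' _]] := selfadjoint_spectrum G_sym G_posdef (Jac_selfadjoint e).
rewrite trS trS'; apply: perm_big; apply/allP => a _ /=.
by rewrite -rankS -rankS' (oss _ _ e1 e01).
Qed.

(* [P] and [Q] stand for the horizontal and the vertical vectors, in either
   order. *)
Record split_curv (P Q : 'rV[R]_N -> Prop) (mu : R) : Prop := SplitCurv {
  split_sum : forall v, exists x y, [/\ P x, Q y & v = x + y];
  split_orth : forall x u, P x -> Q u -> ip x u = 0;
  split_PPPQ : forall x y z u, P x -> P y -> P z -> Q u -> r4 x y z u = 0;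
  split_QQQP : forall x y z u, Q x -> Q y -> Q z -> P u -> r4 x y z u = 0;
  split_PQPQ : forall x u y v, P x -> Q u -> P y -> Q v ->
    r4 x u y v = mu * (ip x y * ip u v);
  split_QQPP : forall u v x y, Q u -> Q v -> P x -> P y -> r4 u v x y = 0 }.

Lemma split_swap P Q mu : split_curv P Q mu -> split_curv Q P mu.
Proof.
case=> ds orth pppq qqqp pqpq qqpp; split => //.
- by move=> v; have [x [y [Px Qy ->]]] := ds v; exists y, x; rewrite addrC.
- by move=> x u Qx Pu; rewrite innerC orth.
- move=> x u y v Qx Pu Qy Pv; rewrite r4C12 r4C34 opprK pqpq //.
  by congr (_ * _); rewrite mulrC.
- by move=> u v x y Pu Pv Qx Qy; rewrite r4_pair qqpp.
Qed.

(** The defect [K] of [Jac x] from [mu *: proj_mx x] is self-adjoint and kills [x] and every vector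
    of [Q]. An eigenvector [v] of [K] for a nonzero eigenvalue [r] is orthogonal to all of these,
    hence lies in [P], and the line [x + t *: u0] leads to a contradiction. *)
Lemma split_sectional P Q mu (S : seq R) u0 : split_curv P Q mu ->
  (forall u v l, u != 0 -> v != 0 -> Rc u v u = l *: v ->
       exists2 s, s \in S & l = s * ip u u) ->
  Q u0 -> u0 != 0 ->
  forall x y z, P x -> r4 x y x z = mu * ip y (z *m proj_mx x).
Proof.
move=> [ds orth pppq qqqp pqpq qqpp] spec Qu0 u0n x y z Px.
have orth' u x' : Q u -> P x' -> ip u x' = 0 by move=> Qu Px'; rewrite innerC orth.
have splitext v w : (forall a, P a -> ip v a = ip w a) ->
    (forall a, Q a -> ip v a = ip w a) -> v = w.
  move=> eP eQ; apply: inner_ext => a; have [b [c [Pb Qc ->]]] := ds a.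
  by rewrite !innerDr eP // eQ.
have [->|xn] := eqVneq x 0.
  have := r4Z1 0 0 y 0 z; rewrite scale0r mul0r => ->.
  by rewrite mul_proj_mx inner0l scale0r scaler0 subrr inner0r mulr0.
pose K := Jac x - mu *: proj_mx x.
have mulK v : v *m K = Rc x v x - mu *: (v *m proj_mx x).
  by rewrite mulmxBr mul_Jac -scalemxAr.
have Ksa v w : ip (v *m K) w = ip v (w *m K).
  rewrite !mulK -!scaleNr !(innerDl, innerDr) !innerZl innerZr proj_selfadjoint.
  by congr (_ + _); rewrite -/(r4 _ _ _ _) r4_pair [RHS]innerC.
have KQ u : Q u -> u *m K = 0.
  move=> Qu; apply: splitext => a Ha; rewrite inner0l mulK -scaleNr innerDl innerZl;
    rewrite mul_proj_mx -scaleNr innerDl !innerZl -/(r4 _ _ _ _).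
    by rewrite (orth' u a) // (orth' u x) // r4_pair pppq //; ring.
  by rewrite pqpq // (orth' u x) //; ring.
have Rxx : Rc x x x = 0.
  have := RcC x x x; move/eqP; rewrite -addr_eq0 -mulr2n -scaler_nat scaler_eq0.
  by rewrite pnatr_eq0 /= => /eqP.
have Kx : x *m K = 0.
  by rewrite mulK mul_proj_mx subrr scaler0 subr0.
have [rs [rankrs _ rs0]] := selfadjoint_spectrum G_sym G_posdef (selfadjointP Ksa).
have K0 : K = 0.
  apply: rs0 => r rrs; apply: contraTeq isT => rn.
  have : (0 < \rank (eigenspace K r))%N by rewrite rankrs -has_count has_pred1.
  rewrite lt0n mxrank_eq0 => /eigenvalueP[v vK vn].
  have vker w : w *m K = 0 -> ip v w = 0.
    move=> wK; apply: (mulfI rn).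
    by rewrite -innerZl -vK Ksa wK inner0r mulr0.
  have [v1 [v2 [Pv1 Qv2 vE]]] := ds v.
  have v20 : v2 = 0.
    apply/eqP; rewrite -inner_eq0; have := vker _ (KQ _ Qv2).
    by rewrite vE innerDl (orth v1 v2) // add0r => ->.
  have Pv : P v by rewrite vE v20 addr0.
  have vx : ip v x = 0 by exact: vker.
  have xv : ip x v = 0 by rewrite innerC.
  have Rv : Rc x v x = (r + mu * ip x x) *: v.
    move: vK; rewrite mulK mul_proj_mx vx scale0r subr0 => /eqP.
    by rewrite subr_eq => /eqP ->; rewrite scalerDl scalerA.
  (* This is the coefficient of [t] in the Jacobi operator of [x + t *: u0] at [v]. Without it [v]
     would not be an eigenvector along the whole line. *)
  have cross1 : Rc x v u0 + Rc u0 v x = 0.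
    apply: splitext => a Ha; rewrite innerDl inner0l -!/(r4 _ _ _ _).
      rewrite r4C34 pppq // (r4_pair u0 v) r4C34 pppq //; ring.
    rewrite r4_pair qqpp // r4C12 pqpq // vx; ring.
  have cross2 : Rc u0 v u0 = (mu * ip u0 u0) *: v.
    apply: splitext => a Ha; rewrite innerZl -/(r4 _ _ _ _).
      rewrite r4C12 r4C34 opprK pqpq //; ring.
    rewrite r4_pair qqqp // (orth v a) //; ring.
  have line t : Rc (x + t *: u0) v (x + t *: u0) =
      (r + mu * ip x x + t ^+ 2 * (mu * ip u0 u0)) *: v.
    rewrite RcDl !RcDr !RcZl !RcZr Rv cross2.
    rewrite -[LHS]/(_ + _ + (_ + _)) -addrA [X in _ + X]addrA -scalerDr cross1.
    by rewrite scaler0 add0r !scalerA expr2 -scalerDl mulrA.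
  have ipl t : ip (x + t *: u0) (x + t *: u0) = ip x x + t ^+ 2 * ip u0 u0.
    rewrite !(innerDl, innerDr, innerZl, innerZr) (orth x u0) // (orth' u0 x) //; ring.
  have linen t : x + t *: u0 != 0.
    rewrite -inner_eq0 ipl gt_eqF // ltr_pwDl ?inner_gt0 // mulr_ge0 ?sqr_ge0 //.
    exact/ltW/inner_gt0.
  have [|s sS] := @poly_ratio_cst _ S ((r + mu * ip x x)%:P + (mu * ip u0 u0) *: 'X^2)
      ((ip x x)%:P + (ip u0 u0) *: 'X^2).
    move=> t; have [s sS e] := spec _ _ _ (linen t) vn (line t).
    exists s => //; rewrite ipl in e; rewrite !(hornerD, hornerC, hornerZ, hornerXn).
    transitivity (r + mu * ip x x + t ^+ 2 * (mu * ip u0 u0)); first by ring.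
    by rewrite e; ring.
  have u0p : ip u0 u0 != 0 by rewrite inner_eq0.
  (* The coefficients of [t ^+ 2] give [s = mu]; the constant coefficients then give [r = 0],
     against [rn]. *)
  move=> /polyP e; have := e 2%N; rewrite !coefE /= !add0r !mulr1 => /(mulIf u0p) smu.
  have := e 0%N; rewrite !coefE /= !mulr0 !addr0 -smu => /eqP.
  by rewrite -subr_eq0 addrK (negbTE rn).
have := mulK y; rewrite K0 mulmx0 => /eqP; rewrite eq_sym subr_eq0 => /eqP e.
by rewrite /r4 e innerZl proj_selfadjoint.
Qed.

(** Splitting [u], [v] and the test vector gives sixteen terms. The two pure ones come from
    [split_sectional] and its mirror image, those with three vectors of one kind vanish, and among
    those with two of each kind only the ones that pair [P] with [Q] in each half survive. *)
Lemma split_Rc P Q mu (S : seq R) x0 u0 : split_curv P Q mu ->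
  (forall u v l, u != 0 -> v != 0 -> Rc u v u = l *: v ->
       exists2 s, s \in S & l = s * ip u u) ->
  P x0 -> x0 != 0 -> Q u0 -> u0 != 0 ->
  forall u v, Rc u v u = mu *: (ip u u *: v - ip u v *: u).
Proof.
move=> sPQ spec Px0 x0n Qu0 u0n u v.
have secP := split_sectional sPQ spec Qu0 u0n.
have secQ := split_sectional (split_swap sPQ) spec Px0 x0n.
have [ds orth pppq qqqp pqpq qqpp] := sPQ.
have orth' w x' : Q w -> P x' -> ip w x' = 0 by move=> Qw Px'; rewrite innerC orth.
apply: inner_ext => w.
have [x [a [Px Qa ->]]] := ds u; have [y [b [Py Qb ->]]] := ds v.
have [z [c [Pz Qc ->]]] := ds w.
rewrite -/(r4 _ _ _ _) !(r4D1, r4D2, r4D3, r4D4).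
rewrite (secP x y z) // (secQ a b c) // !mul_proj_mx.
have pppq' p q r s : P p -> P q -> Q r -> P s -> r4 p q r s = 0.
  by move=> *; rewrite r4C34 pppq // oppr0.
have qqqp' p q r s : Q p -> Q q -> P r -> Q s -> r4 p q r s = 0.
  by move=> *; rewrite r4C34 qqqp // oppr0.
rewrite (pppq x y x c) // (pppq' x y a z) // (r4_pair x y a c) (qqpp a c x y) //.
rewrite (r4_pair x b x z) (pppq x z x b) // (pqpq x b x c) //.
rewrite (r4C34 x b z a) (pqpq x b z a) // (r4_pair x b a c) (qqqp' a c x b) //.
rewrite (r4_pair a y x z) (pppq' x z a y) // (r4C12 y a x c) (pqpq y a x c) //.
rewrite (r4C12 y a a z) (r4C34 y a z a) (pqpq y a z a) // (r4_pair a y a c) (qqqp a c a y) //.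
rewrite (qqpp a b x z) // (qqqp' a b x c) // (qqqp a b a z) //.
rewrite !(innerDl, innerDr, innerZl, innerZr, inner_oppl, inner_oppr).
rewrite ?(orth x a, orth x b, orth x c, orth y a, orth y c) //.
rewrite ?(orth' a x, orth' a y, orth' a z, orth' b x, orth' b z, orth' c x) //.
rewrite (innerC y x) (innerC b a) (innerC z x) (innerC c a); ring.
Qed.

End AlgebraicCurvature.

(** * Constant sectional curvature and its Jacobi operators *)

Section ConstantCurvature.
Variables (R : realType) (N : nat) (G : 'M[R]_N) (Om : 'I_N -> 'I_N -> 'M[R]_N).
Hypothesis G_sym : G^T = G.
Hypothesis G_posdef : forall v : 'rV[R]_N, v != 0 -> 0 < (v *m G *m v^T) 0 0.
Hypothesis Om_anti : forall i j, Om j i = - Om i j.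
Hypothesis Om_skew : forall i j, Om i j *m G + G *m (Om i j)^T = 0.
Hypothesis Om_bianchi : forall i j k,
  row k (Om i j) + row i (Om j k) + row j (Om k i) = 0.
Implicit Types u v w : 'rV[R]_N.
Local Notation ip := (inner G).

(** Polarisation in the second vector: pair symmetry makes [r4 u v u w] symmetric in [v] and [w], so
    its diagonal determines it. *)
Lemma sectional_Rc (mu : R) :
  (forall u v, r4 G Om u v u v = mu * (ip u u * ip v v - ip u v ^+ 2)) ->
  forall u v, Rc Om u v u = mu *: (ip u u *: v - ip u v *: u).
Proof.
move=> H u v; apply: (inner_ext G_posdef) => w.
have := H u (v + w); rewrite (r4D2 G Om_anti) !r4D4 !H.
rewrite (r4_pair G_sym Om_anti Om_skew Om_bianchi u w u v) -/(r4 _ _ _ _ _ _).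
rewrite !(innerDl, innerDr, innerZl, inner_oppl) (innerC G_sym w v) -/(r4 G Om u v u w).
move: (r4 _ _ _ _ _ _) => x e.
lra.
Qed.

Lemma cst_osserman (mu : R) :
  (forall u v, Rc Om u v u = mu *: (ip u u *: v - ip u v *: u)) ->
  osserman_at G Om.
Proof.
move=> H u v u1 v1 a; have [->//|uv] := eqVneq u v.
have JE x y : ip x x = 1 -> y *m Jac Om x = mu *: (y - ip y x *: x).
  by move=> x1; rewrite (mul_Jac Om_anti) H x1 scale1r (innerC G_sym).
(* The reflection exchanging u and v conjugates the two Jacobi operators. *)
have [w wuv] : exists w, w = u - v by exists (u - v).
have w0 : w != 0 by rewrite wuv subr_eq0.
have ww : ip w w != 0 by rewrite (inner_eq0 G_posdef).
pose T : 'M[R]_N := 1%:M - (2 / ip w w) *: (G *m w^T *m w).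
have TE x : x *m T = x - (2 * ip x w / ip w w) *: w.
  rewrite mulmxBr mulmx1 -scalemxAr !mulmxA [x *m G *m w^T]mx11_scalar.
  by rewrite mul_scalar_mx scalerA mulrAC.
have wE : ip w w = 2 - 2 * ip u v.
  rewrite wuv !(innerDl, innerDr, inner_oppl, inner_oppr) u1 v1 (innerC G_sym v u); ring.
have uT : u *m T = v.
  rewrite TE; have -> : 2 * ip u w = ip w w.
    by rewrite wE wuv innerDr inner_oppr u1; ring.
  by rewrite divff // scale1r wuv opprB addrC subrK.
have Tsa x y : ip (x *m T) y = ip x (y *m T).
  rewrite !TE !(innerDl, innerDr, inner_oppl, inner_oppr, innerZl, innerZr).
  by rewrite (innerC G_sym w y); ring.
have wT : w *m T = - w.
  by rewrite TE mulfK // scaler_nat mulr2n opprD addrA subrr sub0r.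
have TT : T *m T = 1%:M.
  apply/row_matrixP => i; rewrite row_mul row1 rowE (TE (delta_mx 0 i)) mulmxBl -scalemxAl wT.
  by rewrite TE scalerN opprK subrK.
have vT : v *m T = u by rewrite -uT -mulmxA TT mulmx1.
have TU : T \in unitmx by have [] := mulmx1_unit TT.
clearbody T.
have JT : T *m Jac Om v = Jac Om u *m T.
  apply/row_matrixP => i; rewrite !rowE !mulmxA !JE // -scalemxAl mulmxBl -scalemxAl.
  by rewrite uT Tsa vT.
have conj : T *m (Jac Om v - a%:M) = (Jac Om u - a%:M) *m T.
  by rewrite mulmxBr mulmxBl JT mul_scalar_mx mul_mx_scalar.
rewrite !mxrank_ker; congr (_ - _)%N.
rewrite -(eqmxMfull (Jac Om v - a%:M) (_ : row_full T)) ?row_full_unit // conj.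
by rewrite mxrankMfree ?row_free_unit.
Qed.

End ConstantCurvature.

(** * Algebra of curvature tensors of twisted products *)

Section TwistedAlgebra.
Variables (R : realType) (m n : nat).
Variables (A : 'M[R]_m) (C : 'M[R]_n) (Om : 'I_(m + n) -> 'I_(m + n) -> 'M[R]_(m + n)).
Local Notation G := (block_mx A 0 0 C).
Local Notation ip := (inner G).
Local Notation r4 := (r4 G Om).
Local Notation hor X := (row_mx X (0 : 'rV[R]_n)).
Local Notation ver V := (row_mx (0 : 'rV[R]_m) V).
Hypothesis G_sym : G^T = G.
Hypothesis G_posdef : forall v : 'rV[R]_(m + n), v != 0 -> 0 < (v *m G *m v^T) 0 0.
Hypothesis Om_anti : forall i j, Om j i = - Om i j.
Hypothesis Om_skew : forall i j, Om i j *m G + G *m (Om i j)^T = 0.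
Hypothesis Om_bianchi : forall i j k,
  row k (Om i j) + row i (Om j k) + row j (Om k i) = 0.
Variables (h : 'M[R]_m) (a : 'M[R]_(m, n)).
Hypothesis r4_hhhv : forall X Y Z V, r4 (hor X) (hor Y) (hor Z) (ver V) = 0.
Hypothesis r4_hvhv : forall X V Y W,
  r4 (hor X) (ver V) (hor Y) (ver W) = inner h X Y * inner C V W.
Hypothesis r4_vvhh : forall V W X Y, r4 (ver V) (ver W) (hor X) (hor Y) = 0.
Hypothesis r4_vvhv : forall U V X W, r4 (ver U) (ver V) (hor X) (ver W) =
  (X *m a *m U^T) 0 0 * inner C V W - (X *m a *m V^T) 0 0 * inner C U W.
Hypotheses (m_gt0 : (0 < m)%N) (n_gt0 : (0 < n)%N).
Implicit Types (X Y Z : 'rV[R]_m) (U V W T : 'rV[R]_n).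

Let pair := r4_pair G_sym Om_anti Om_skew Om_bianchi.
Let C34 := r4C34 G_sym Om_skew.

Lemma ip_row_mx X V Y W : ip (row_mx X V) (row_mx Y W) = inner A X Y + inner C V W.
Proof.
rewrite /inner mul_row_block tr_row_mx mul_row_col !mulmx0 addr0 add0r.
by rewrite mxE.
Qed.

Lemma ip_hor X Y : ip (hor X) (hor Y) = inner A X Y.
Proof. by rewrite ip_row_mx inner0l addr0. Qed.

Lemma ip_ver V W : ip (ver V) (ver W) = inner C V W.
Proof. by rewrite ip_row_mx inner0l add0r. Qed.

Lemma ip_hv X V : ip (hor X) (ver V) = 0.
Proof. by rewrite ip_row_mx inner0l inner0r addr0. Qed.

Lemma hor_neq0 X : X != 0 -> hor X != 0.
Proof. by apply: contra_neq => /eqP; rewrite -row_mx0 => /eqP/eq_row_mx []. Qed.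

Lemma ver_neq0 V : V != 0 -> ver V != 0.
Proof. by apply: contra_neq => /eqP; rewrite -row_mx0 => /eqP/eq_row_mx []. Qed.

Lemma A_posdef X : X != 0 -> 0 < inner A X X.
Proof. by move=> /hor_neq0/(inner_gt0 G_posdef); rewrite ip_hor. Qed.

Lemma C_posdef V : V != 0 -> 0 < inner C V V.
Proof. by move=> /ver_neq0/(inner_gt0 G_posdef); rewrite ip_ver. Qed.

Lemma posdef_unit k (B : 'M[R]_k) : (forall v, v != 0 -> 0 < inner B v v) -> B \in unitmx.
Proof.
move=> pB; rewrite unitmxE unitfE; apply/negP => /det0P[v v0 vB].
by have := pB v v0; rewrite /inner vB mul0mx mxE ltxx.
Qed.

Lemma row1_neq0 k : (0 < k)%N -> exists v : 'rV[R]_k, v != 0.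
Proof.
move=> k0; exists (const_mx 1); apply/negP => /eqP/rowP/(_ (Ordinal k0)).
by rewrite !mxE => /eqP; rewrite oner_eq0.
Qed.

(** The quotient of the two quadratic forms takes values in the finite list [S]. On each line
    [X0 + t *: Y] it is a quotient of quadratic polynomials, hence constant; every such line passes
    through [X0], so the constant is always [mu]. Polarisation does the rest. *)
Lemma hessian_scalar (S : seq R) :
  (forall u v l, u != 0 -> v != 0 -> Rc Om u v u = l *: v ->
       exists2 s, s \in S & l = s * ip u u) ->
  exists mu, forall X Y, inner h X Y = mu * inner A X Y.
Proof.
move=> spec; have [V V0] := row1_neq0 n_gt0; have [X0 X0n] := row1_neq0 m_gt0.
have CV0 : inner C V V != 0 by rewrite gt_eqF // C_posdef.
have hsym X Y : inner h X Y = inner h Y X.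
  by apply: (mulIf CV0); rewrite -!r4_hvhv pair.
have ASym X Y : inner A X Y = inner A Y X by rewrite -!ip_hor (innerC G_sym).
have hspec X : X != 0 -> exists2 s, s \in S & inner h X X = s * inner A X X.
  move=> Xn; rewrite -ip_hor; apply: (spec _ (ver V)); [exact: hor_neq0|exact: ver_neq0|].
  apply: (inner_ext G_posdef) => w; rewrite -[w]hsubmxK.
  have -> : row_mx (lsubmx w) (rsubmx w) = hor (lsubmx w) + ver (rsubmx w).
    by rewrite add_row_mx addr0 add0r.
  rewrite innerDr -!/(r4 _ _ _ _) pair r4_hhhv r4_hvhv add0r innerZl innerDr.
  by rewrite (innerC G_sym (ver V)) ip_hv add0r ip_ver.
pose mu := inner h X0 X0 / inner A X0 X0.
have AX0 : inner A X0 X0 != 0 by rewrite gt_eqF // A_posdef.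
have diag Y : inner h Y Y = mu * inner A Y Y.
  have [|s sS e] := @poly_ratio_cst _ S
    ((inner h X0 X0)%:P + (2 * inner h X0 Y) *: 'X + (inner h Y Y) *: 'X^2)
    ((inner A X0 X0)%:P + (2 * inner A X0 Y) *: 'X + (inner A Y Y) *: 'X^2).
    move=> t; rewrite !(hornerD, hornerC, hornerZ, hornerXn, hornerX).
    have E (B : 'M[R]_m) : inner B X0 Y = inner B Y X0 ->
      inner B X0 X0 + 2 * inner B X0 Y * t + inner B Y Y * t ^+ 2 =
      inner B (X0 + t *: Y) (X0 + t *: Y).
      by move=> e; rewrite !(innerDl, innerDr, innerZl, innerZr) -e; ring.
    (* Where the line meets 0 both forms vanish and any element of [S] serves; the one belonging to
       [X0] is taken. *)
    rewrite !E //; have [->|n0] := eqVneq (X0 + t *: Y) 0; last exact: hspec.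
    by have [s sS _] := hspec _ X0n; exists s => //; rewrite !inner0l mulr0.
  have e0 : inner h X0 X0 = s * inner A X0 X0.
    by move/polyP/(_ 0%N): e; rewrite !coefE /= !mulr0 !addr0.
  have e2 : inner h Y Y = s * inner A Y Y.
    by move/polyP/(_ 2%N): e; rewrite !coefE /= !mulr0 !add0r !mulr1.
  by rewrite /mu e0 mulfK.
exists mu => X Y; have := diag (X + Y).
by rewrite !(innerDl, innerDr) !diag (hsym Y X) (ASym Y X) => e; lra.
Qed.

(** Let [K] be the part of [Jac] at [hor Y + ver T] that is bilinear in [Y] and [T]. It has trace
    zero, because the trace of [Jac] is a multiple of the squared norm and the two vectors are
    orthogonal. Its horizontal block vanishes and its vertical block has trace [2 * (n - 1) * al],
    where [al] is the value of [a] at [Y] and [T]. *)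
Lemma mixed_eq0 (rho : R) : (forall u, \tr (Jac Om u) = rho * ip u u) ->
  forall U V X W, r4 (ver U) (ver V) (hor X) (ver W) = 0.
Proof.
move=> tr_J U V X W.
(* For [n = 1] the factor [n - 1] gives no information, but the term is alternating in [U] and [V],
   which are then proportional. *)
have [n1|n1] := eqVneq n 1%N.
  move: (C) (a) U V W (r4_vvhv U V X W) => C' a' U' V' W' ->.
  move: C' a' U' V' W'; rewrite n1 => C' a' U' V' W'.
  have E (Z : 'rV[R]_1) : Z = Z 0 0 *: const_mx 1.
    by apply/rowP => j; rewrite !mxE !ord1 mulr1.
  have aE c (Z : 'rV[R]_1) : (X *m a' *m (c *: Z)^T) 0 0 = c * (X *m a' *m Z^T) 0 0.
    by rewrite linearZ /= -scalemxAr mxE.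
  rewrite (E U') (E V') !innerZl !aE.
  move: (U' 0 0) (V' 0 0) (inner _ _ _) (fun_of_matrix _ _ _) => p q r s; ring.
have a0 Y T : (Y *m a *m T^T) 0 0 = 0.
  pose K := Jac Om (hor Y + ver T) - Jac Om (hor Y) - Jac Om (ver T).
  have KE v w : ip (v *m K) w = r4 (hor Y) v (ver T) w + r4 (ver T) v (hor Y) w.
    have -> : v *m K = Rc Om (hor Y) v (ver T) + Rc Om (ver T) v (hor Y).
      rewrite /K !mulmxBr !(mul_Jac Om_anti) RcDl !RcDr.
      move: (Rc _ _ _ _) (Rc _ _ _ _) (Rc _ _ _ _) (Rc _ _ _ _) => p q r s.
      by apply/rowP => j; rewrite !mxE; ring.
    by rewrite innerDl.
  have AU : A \in unitmx by apply: posdef_unit; exact: A_posdef.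
  have CU : C \in unitmx by apply: posdef_unit; exact: C_posdef.
  have CT : C^T = C.
    by move: G_sym; rewrite tr_block_mx => /eq_block_mx [].
  pose al : R := (Y *m a *m T^T) 0 0.
  have KG : K *m G = block_mx (ulsubmx K *m A) (ursubmx K *m C)
                              (dlsubmx K *m A) (drsubmx K *m C).
    by rewrite -{1}[K]submxK mulmx_block !mulmx0 !addr0 !add0r.
  have dl (i : 'I_m) : delta_mx 0 (lshift n i) = hor (delta_mx 0 i).
    apply/rowP => j; case: (split_ordP j) => k ->; rewrite ?row_mxEl ?row_mxEr !mxE.
      by rewrite (inj_eq (@lshift_inj m n)).
    by rewrite eq_rlshift andbF.
  have dr (i : 'I_n) : delta_mx 0 (rshift m i) = ver (delta_mx 0 i).
    apply/rowP => j; case: (split_ordP j) => k ->; rewrite ?row_mxEl ?row_mxEr !mxE.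
      by rewrite eq_lrshift andbF.
    by rewrite (inj_eq (@rshift_inj m n)).
  have Kul : ulsubmx K = 0.
    apply: (can_inj (mulmxK AU)); rewrite mul0mx; apply/matrixP => i j.
    transitivity ((K *m G) (lshift n i) (lshift n j)); first by rewrite KG block_mxEul.
    rewrite -inner_delta /inner mulmxA -/(inner G _ _) KE !dl.
    by rewrite C34 r4_hhhv (pair (ver T)) C34 r4_hhhv mxE !oppr0 addr0.
  have Kdr : drsubmx K = ((2 * al) *: C - (T *m C)^T *m (Y *m a)
      - (Y *m a)^T *m (T *m C)) *m invmx C.
    apply: (can_inj (mulmxK CU)); rewrite mulmxKV //; apply/matrixP => i j.
    transitivity ((K *m G) (rshift m i) (rshift m j)); first by rewrite KG block_mxEdr.
    rewrite -inner_delta /inner mulmxA -/(inner G _ _) KE !dr.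
    rewrite (pair (hor Y)) !r4_vvhv -/al !inner_delta.
    have rowcol (x : 'rV[R]_n) (k : 'I_n) : (x *m (delta_mx 0 k : 'rV[R]_n)^T) 0 0 = x 0 k.
      by rewrite trmx_delta -colE mxE.
    have outer (x y : 'rV[R]_n) : (x^T *m y) i j = x 0 i * y 0 j.
      by rewrite mxE big_ord1 mxE.
    have Cji : C j i = C i j by rewrite -[in LHS]CT mxE.
    rewrite /inner !rowcol Cji; move: (T *m C) (Y *m a) => c d.
    have sub3 (p q r : 'M[R]_n) : (p - q - r) i j = p i j - q i j - r i j.
      by rewrite !mxE.
    rewrite sub3 !outer [X in _ = X - _ - _]mxE; ring.
  have trK : \tr K = 0.
    rewrite /K !linearB /= !tr_J innerDl !innerDr (innerC G_sym (ver T) (hor Y)) ip_hv.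
    ring.
  have tr1 (x y : 'rV[R]_n) : \tr (x^T *m y) = (y *m x^T) 0 0.
    by rewrite mxtrace_mulC /mxtrace big_ord1.
  have alT : (T *m (Y *m a)^T) 0 0 = al.
    have -> : T *m (Y *m a)^T = (Y *m a *m T^T)^T by rewrite [RHS]trmx_mul trmxK.
    by rewrite mxE.
  move: trK; rewrite -[K]submxK mxtrace_block Kul mxtrace0 add0r Kdr.
  rewrite !mulmxBl -scalemxAl mulmxV // -!mulmxA mulmxV // mulmx1 !linearB /=.
  rewrite mxtraceZ mxtrace1 !tr1 alT trmx_mul CT -!mulmxA mulKmx // mulmxA -/al => e.
  have : al * (n%:R - 1) = 0 by apply: (@mulfI _ 2) => //; rewrite mulr0 -e; ring.
  move/eqP; rewrite mulf_eq0 subr_eq0 => /orP[/eqP //|].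
  by rewrite -[X in _ == X]/(1%:R) eqr_nat (negbTE n1).
by rewrite r4_vvhv !a0 !mul0r subrr.
Qed.

Lemma osserman_cst : osserman_at G Om ->
  exists mu, forall u v, Rc Om u v u = mu *: (ip u u *: v - ip u v *: u).
Proof.
move=> oss; have [V V0] := row1_neq0 n_gt0; have [X X0] := row1_neq0 m_gt0.
have [S [rho [spec tr_J]]] := osserman_spectrum G_sym G_posdef Om_anti Om_skew
  Om_bianchi (hor_neq0 X0) oss.
have [mu hmu] := hessian_scalar spec; have mixed := mixed_eq0 tr_J.
exists mu; apply: (@split_Rc _ _ _ _ G_sym G_posdef Om_anti Om_skew Om_bianchi
  (fun v => exists X, v = hor X) (fun v => exists V, v = ver V) mu S (hor X) (ver V)) => //.
- split.
  + move=> v; exists (hor (lsubmx v)), (ver (rsubmx v)); split; [by eexists|by eexists|].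
    by rewrite add_row_mx addr0 add0r hsubmxK.
  + by move=> _ _ [Y ->] [W ->]; exact: ip_hv.
  + by move=> _ _ _ _ [Y ->] [Z ->] [T ->] [W ->]; exact: r4_hhhv.
  + move=> _ _ _ _ [Y ->] [Z ->] [T ->] [W ->].
    by rewrite C34 mixed oppr0.
  + by move=> _ _ _ _ [Y ->] [Z ->] [T ->] [W ->]; rewrite r4_hvhv hmu ip_hor ip_ver mulrA.
  + by move=> _ _ _ _ [Y ->] [Z ->] [T ->] [W ->]; exact: r4_vvhh.
- by exists X.
- exact: hor_neq0.
- by exists V.
- exact: ver_neq0.
Qed.

End TwistedAlgebra.

(** * The Levi-Civita connection *)

Section LeviCivitaMatrices.
Variables (R : realType) (N : nat) (U : set 'rV[R]_N) (G : 'rV[R]_N -> 'M[R]_N).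
Hypothesis U_open : open U.
Hypothesis G_smooth : forall i j, smooth_on U (fun x => G x i j).
Hypothesis G_sym : forall x, U x -> (G x)^T = G x.
Hypothesis G_posdef :
  forall x (v : 'rV[R]_N), U x -> v != 0 -> 0 < (v *m G x *m v^T) 0 0.
Implicit Types (x u v w : 'rV[R]_N) (i j k : 'I_N).

Definition lcmx i x : 'M[R]_N := gam_mx (christoffel G) x i.

Local Notation Om := (fun x i j => curvmx lcmx i j x).

Lemma gram_unit x : U x -> G x \in unitmx.
Proof. by move=> Ux; apply: G_unit Ux. Qed.

Lemma lcmx_smooth i : mx_smooth U (lcmx i).
Proof.
move=> a b; have -> : (fun x => lcmx i x a b) = (fun x => christoffel G x i a b).
  by apply/funext => x; rewrite mxE.
by apply: christoffel_smooth => //; exact: gram_unit.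
Qed.

Lemma pderiv_gramC x k i j : U x ->
  pderiv k (fun y => G y i j) x = pderiv k (fun y => G y j i) x.
Proof.
move=> Ux; apply: near_eq_derive.
apply: filterS (open_nbhs_nbhs (conj U_open Ux)) => y Uy.
by rewrite -{1}(G_sym Uy) mxE.
Qed.

Lemma lcmx_torsion_free : torsion_free U lcmx.
Proof.
move=> x i j Ux; apply/rowP => k; rewrite !mxE /christoffel; congr (_ * _).
apply: eq_bigr => l _; rewrite (pderiv_gramC l i j Ux); congr (_ * (_ - _)).
exact: addrC.
Qed.

Lemma lcmxG x i j l : U x -> (lcmx i x *m G x) j l =
  2^-1 * (pderiv i (fun y => G y j l) x + pderiv j (fun y => G y i l) x
          - pderiv l (fun y => G y i j) x).
Proof.
move=> Ux; have := christoffel_lower G_sym G_posdef i j l Ux.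
by move=> /= <-; rewrite mxE; apply: eq_bigr => k _; rewrite mxE.
Qed.

Lemma lcmx_metric : metric_compat U lcmx G.
Proof.
move=> x k Ux; apply/matrixP => i j.
have -> : G x *m (lcmx k x)^T = (lcmx k x *m G x)^T by rewrite trmx_mul G_sym.
rewrite mderiv_entry addmxE [_^T i j]mxE !lcmxG //.
rewrite (pderiv_gramC k j i Ux); move: (pderiv _ _ _) (pderiv _ _ _) (pderiv _ _ _) => p q r.
by field.
Qed.

Lemma nabla_cst (v w : 'rV[R]_N) : nabla G (fun=> v) (fun=> w) =
  (fun y => \sum_j v 0 j *: (w *m lcmx j y)).
Proof.
apply/funext => y; rewrite /nabla connectionE; apply: eq_bigr => j _.
by rewrite pderiv_cst add0r.
Qed.

(** Constant fields have zero bracket, and differentiating [w *m lcmx j] produces [w *m (mderiv i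
    (lcmx j) x + lcmx j x *m lcmx i x)]; antisymmetrising in [i] and [j] yields the curvature
    matrices. *)
Lemma curvature_atE x u v w : U x -> curvature_at G x u v w = Rc (Om x) u v w.
Proof.
move=> Ux; rewrite /curvature_at /curvature.
have -> : nabla G (bracket (fun=> u) (fun=> v)) (fun=> w) x = 0.
  rewrite /nabla connectionE big1 // => i _.
  by rewrite bracket_cst mxE scale0r.
have E (a b : 'rV[R]_N) : nabla G (fun=> a) (nabla G (fun=> b) (fun=> w)) x =
    \sum_i \sum_j (a 0 i * b 0 j) *: (w *m (mderiv i (lcmx j) x + lcmx j x *m lcmx i x)).
  rewrite nabla_cst /nabla connectionE; apply: eq_bigr => i _.
  have dl j : mderivable i (lcmx j) x by exact: mx_smooth_derivable (lcmx_smooth j) Ux.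
  have [dw ew] := mderiv_cst i w x.
  have dwl j : mderivable i (fun y => b 0 j *: (w *m lcmx j y)) x.
    move=> p q; have -> : (fun y => (b 0 j *: (w *m lcmx j y)) p q) =
        (fun y => b 0 j * (w *m lcmx j y) p q).
      by apply/funext => y; rewrite mxE.
    by apply: derivableM; [exact: derivable_cst|exact: mderivableM].
  have [ds es] := @mderiv_sum R N 1 N 'I_N (index_enum 'I_N) i _ x dwl.
  rewrite /pderiv -(mderivE ds) es mulmx_suml -big_split scaler_sumr.
  apply: eq_bigr => j _ /=.
  have -> : mderiv i (fun y => b 0 j *: (w *m lcmx j y)) x =
      b 0 j *: (w *m mderiv i (lcmx j) x).
    rewrite (@mderivZ R N 1 N i (fun=> b 0 j) (fun y => w *m lcmx j y) x).
    - by rewrite pderiv_cst scale0r add0r mderivM // ew mul0mx add0r.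
    - exact: derivable_cst.
    - exact: mderivableM.
  by rewrite -scalemxAl -scalerDr scalerA mulmxDr mulmxA.
rewrite sub0r /Rc; congr (- _).
rewrite !E [X in _ - X]exchange_big -sumrB; apply: eq_bigr => i _ /=.
rewrite -sumrB; apply: eq_bigr => j _.
rewrite [v 0 j * _]mulrC -scalerBr -mulmxBr; congr (_ *: (_ *m _)).
rewrite /curvmx; move: (mderiv _ _ _) (mderiv _ _ _) (_ *m _) (_ *m _) => p q r s.
by apply/matrixP => c d; rewrite !mxE; ring.
Qed.

Lemma jacobiE x u : U x -> jacobi G x u = Jac (Om x) u.
Proof.
move=> Ux; rewrite /jacobi /Jac; congr lin1_mx.
by apply/funext => v; rewrite curvature_atE.
Qed.

Lemma Om_skew_at x : U x ->
  forall i j, Om x i j *m G x + G x *m (Om x i j)^T = 0.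
Proof.
move=> Ux i j; apply: (curvmx_skew U_open lcmx_smooth i j _ lcmx_metric Ux).
exact: G_smooth.
Qed.

Lemma Om_bianchi_at x : U x -> forall i j k,
  row k (Om x i j) + row i (Om x j k) + row j (Om x k i) = 0.
Proof.
move=> Ux i j k.
exact: (bianchi1 U_open i j k lcmx_torsion_free Ux).
Qed.

Lemma Om_anti_at x i j : Om x j i = - Om x i j.
Proof. exact: curvmxC. Qed.

(** The Koszul computation with three permuted metric identities. It will identify a connection
    carried over from another chart. *)
Lemma lcmx_unique (Gm : 'I_N -> 'rV[R]_N -> 'M[R]_N) : torsion_free U Gm ->
  metric_compat U Gm G -> forall x i, U x -> Gm i x = lcmx i x.
Proof.
move=> tf mc x i Ux; pose Gam y (i j k : 'I_N) := Gm i y j k.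
have symG a b c : Gm a x b c = Gm b x a c.
  by have /rowP/(_ c) := tf x a b Ux; rewrite !mxE.
have met a b c : pderiv a (fun y => G y b c) x = (Gm a x *m G x) b c + (Gm a x *m G x) c b.
  have /matrixP/(_ b c) := mc x a Ux; rewrite mderiv_entry addmxE => ->.
  have -> : G x *m (Gm a x)^T = (Gm a x *m G x)^T by rewrite trmx_mul G_sym.
  by rewrite [_^T b c]mxE.
have symL a b c : (Gm a x *m G x) b c = (Gm b x *m G x) a c.
  by rewrite !mxE; apply: eq_bigr => k _; rewrite symG.
have e : Gam x = christoffel G x.
  apply: (christoffel_unique G_sym G_posdef Ux) => a b c /=.
  transitivity ((Gm a x *m G x) b c); first by rewrite mxE.
  by rewrite !met (symL b a) (symL c a) (symL c b); field.
apply/matrixP => j k; rewrite /lcmx mxE -e //.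
Qed.

End LeviCivitaMatrices.

(** * Curvature of a twisted product *)

Section TwistedLocal.
Variables (R : realType) (m n : nat).
Variables (V1 : set 'rV[R]_m) (V2 : set 'rV[R]_n).
Variables (A : 'rV[R]_m -> 'M[R]_m) (C : 'rV[R]_n -> 'M[R]_n).
Variable phi : 'rV[R]_(m + n) -> R.
Local Notation U := [set x : 'rV[R]_(m + n) | V1 (lsubmx x) /\ V2 (rsubmx x)].
Local Notation G := (fun x : 'rV[R]_(m + n) =>
  block_mx (A (lsubmx x)) 0 0 (phi x ^+ 2 *: C (rsubmx x))).
Hypothesis U_open : open U.
Hypothesis phi_neq0 : forall x, phi x != 0.
Hypothesis phi_smooth : smooth_on U phi.
Hypothesis G_smooth : forall i j, smooth_on U (fun x => G x i j).
Hypothesis G_sym : forall x, U x -> (G x)^T = G x.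
Hypothesis G_posdef :
  forall x (v : 'rV[R]_(m + n)), U x -> v != 0 -> 0 < (v *m G x *m v^T) 0 0.

Implicit Types (x y : 'rV[R]_(m + n)) (i j k : 'I_m) (al be : 'I_n).
Local Notation hi i := (lshift n i).
Local Notation vi al := (rshift m al).
Local Notation Gam := (lcmx G).

Definition dlog j x := pderiv (hi j) phi x / phi x.

Lemma rsubmx_delta_l i : rsubmx (delta_mx 0 (hi i) : 'rV[R]_(m + n)) = 0.
Proof. by apply/rowP => k; rewrite !mxE eq_rlshift andbF. Qed.

Lemma lsubmx_delta_r al : lsubmx (delta_mx 0 (vi al) : 'rV[R]_(m + n)) = 0.
Proof. by apply/rowP => k; rewrite !mxE eq_lrshift andbF. Qed.

Lemma pderiv_zero (g : 'rV[R]_(m + n) -> R) (k : 'I_(m + n)) x :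
  U x -> (forall y, U y -> g y = 0) -> pderiv k g x = 0.
Proof.
move=> Ux g0; rewrite -[RHS](@derive_cst R _ R^o 0 x (delta_mx 0 k)).
apply: near_eq_derive; apply: filterS (open_nbhs_nbhs (conj U_open Ux)) => y Uy.
by rewrite g0.
Qed.

Lemma dG_offdiag (k : 'I_(m + n)) i al x :
  pderiv k (fun y => G y (hi i) (vi al)) x = 0 /\
  pderiv k (fun y => G y (vi al) (hi i)) x = 0.
Proof.
have -> : (fun y => G y (hi i) (vi al)) = fun=> 0.
  by apply/funext => y; rewrite block_mxEur mxE.
have -> : (fun y => G y (vi al) (hi i)) = fun=> 0.
  by apply/funext => y; rewrite block_mxEdl mxE.
by rewrite pderiv_cst.
Qed.

Lemma dG_hor al i j x : pderiv (vi al) (fun y => G y (hi i) (hi j)) x = 0.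
Proof.
have -> : (fun y => G y (hi i) (hi j)) = (fun z => A z i j) \o (@lsubmx R 1 m n).
  by apply/funext => y; rewrite block_mxEul.
by rewrite /pderiv (derive_comp_linear _ _ _ _).1 /= lsubmx_delta_r derive0.
Qed.

Lemma dG_ver j al be x : U x ->
  pderiv (hi j) (fun y => G y (vi al) (vi be)) x =
  2 * dlog j x * G x (vi al) (vi be).
Proof.
move=> Ux; pose c := (fun z => C z al be) \o (@rsubmx R 1 m n).
have -> : (fun y => G y (vi al) (vi be)) = (fun y => phi y * phi y * c y).
  by apply/funext => y; rewrite block_mxEdr mxE expr2.
have [dc0 dc] : pderiv (hi j) c x = 0 /\ derivable c x (delta_mx 0 (hi j)).
  have [e d] := derive_comp_linear (@rsubmx R 1 m n) (fun z => C z al be) x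
    (delta_mx 0 (hi j)).
  split; first by rewrite /pderiv e /= rsubmx_delta_l derive0.
  by apply/d; rewrite /= rsubmx_delta_l; exact: derivable0.
have dp : derivable phi x (delta_mx 0 (hi j)) by exact: smooth_derivable Ux.
have dpp : derivable (fun y => phi y * phi y) x (delta_mx 0 (hi j)) by exact: derivableM.
rewrite block_mxEdr mxE -/(c x).
have e1 := deriveM dpp dc; have e2 := deriveM dp dp.
rewrite /pderiv in dc0 *; rewrite [LHS]e1 dc0 scaler0 add0r [X in _ *: X]e2.
rewrite /dlog /pderiv; have := phi_neq0 x; rewrite -/(c x) /c /=.
move: ('D_(delta_mx 0 (hi j)) phi x) (phi x) (C _ _ _) => d p q p0.
rewrite /GRing.scale /=; field.
exact: p0.
Qed.

(** After lowering an index with [G], the only surviving derivative is the horizontal one of the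
    vertical block, where [phi ^+ 2] contributes [2 * dlog j x] and the Christoffel symbol halves
    it. *)
Lemma Gam_hv j al (c : 'I_(m + n)) x : U x ->
  Gam (vi al) x (hi j) c = dlog j x * (c == vi al)%:R.
Proof.
move=> Ux; have GU := gram_unit G_posdef Ux.
have : row (hi j) (Gam (vi al) x) = dlog j x *: delta_mx 0 (vi al).
  apply: (can_inj (mulmxK GU)); rewrite -row_mul -scalemxAl -rowE.
  apply/rowP => d; rewrite [LHS]mxE (lcmxG G_sym G_posdef _ _ _ Ux) [RHS]mxE [X in _ = _ * X]mxE.
  case: (split_ordP d) => k ->.
    rewrite dG_hor (dG_offdiag _ _ _ _).2 (dG_offdiag _ _ _ _).2.
    by rewrite block_mxEdl mxE; ring.
  rewrite (dG_offdiag _ _ _ _).1 (dG_offdiag _ _ _ _).2 dG_ver //.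
  by move: (block_mx _ _ _ _ _ _) => g; field.
by move/rowP/(_ c); rewrite !mxE eqxx.
Qed.

(** The horizontal leaves are totally geodesic: the row [w] is orthogonal to all vertical vectors,
    and the vertical block of [G] is positive definite. *)
Lemma Gam_hh i j al x : U x -> Gam (hi i) x (hi j) (vi al) = 0.
Proof.
move=> Ux; pose w := row (hi j) (Gam (hi i) x).
suff : rsubmx w = 0 by move/rowP/(_ al); rewrite !mxE.
have wG : rsubmx (w *m G x) = 0.
  apply/rowP => be; rewrite /w -row_mul mxE [LHS]mxE (lcmxG G_sym G_posdef _ _ _ Ux) [RHS]mxE.
  rewrite !(dG_offdiag _ _ _ _).1 dG_hor; ring.
apply/eqP; apply: contraT => r0.
have vn : row_mx (0 : 'rV[R]_m) (rsubmx w) != 0.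
  by apply: contra_neq r0 => /eqP; rewrite -row_mx0 => /eqP/eq_row_mx [].
have := G_posdef Ux vn; move: wG; rewrite -[w]hsubmxK.
rewrite !mul_row_block !tr_row_mx !mul_row_col !mulmx0 !mul0mx !add0r row_mxKr.
by rewrite row_mxKr => ->; rewrite !mul0mx addr0 mxE ltxx.
Qed.

Local Notation Om x := (fun p q => curvmx Gam p q x).

Lemma Om_entry (k l c d : 'I_(m + n)) x : curvmx Gam k l x c d =
  pderiv k (fun y => Gam l y c d) x - pderiv l (fun y => Gam k y c d) x +
  (\sum_a Gam l x c a * Gam k x a d - \sum_a Gam k x c a * Gam l x a d).
Proof.
have E (p q r s : 'M[R]_(m + n)) :
    (p - q + r - s) c d = p c d - q c d + (r c d - s c d).
  by rewrite !mxE; ring.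
have mE (p q : 'M[R]_(m + n)) : (p *m q) c d = \sum_a p c a * q a d by rewrite mxE.
rewrite /curvmx; have := mderiv_entry k (Gam l) x c d; have := mderiv_entry l (Gam k) x c d.
move: (mderiv k _ x) (mderiv l _ x) (pderiv k _ x) (pderiv l _ x) (Gam k x) (Gam l x).
by move=> M1 M2 p1 p2 Q1 Q2 e2 e1; rewrite E !mE e1 e2.
Qed.

Lemma sum_Gam_hv j al (F : 'I_(m + n) -> R) x : U x ->
  \sum_a Gam (vi al) x (hi j) a * F a = dlog j x * F (vi al).
Proof.
move=> Ux; rewrite (bigD1 (vi al)) //= big1 => [|a /negbTE ne].
  by rewrite Gam_hv // eqxx mulr1 addr0.
by rewrite Gam_hv // ne mulr0 mul0r.
Qed.

Lemma Gam_sym (a b c : 'I_(m + n)) x : U x -> Gam a x b c = Gam b x a c.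
Proof.
move=> Ux; have /rowP/(_ c) := lcmx_torsion_free U_open G_sym a b Ux.
by rewrite !mxE.
Qed.

Lemma Om_hhhv i k j be x : U x -> curvmx Gam (hi i) (hi k) x (hi j) (vi be) = 0.
Proof.
move=> Ux; rewrite Om_entry !(pderiv_zero _ Ux) => [|y Uy|y Uy]; try exact: Gam_hh.
have s0 a b : \sum_c Gam (hi a) x (hi j) c * Gam (hi b) x c (vi be) = 0.
  rewrite big1 // => c _; case: (split_ordP c) => d ->.
    by rewrite (Gam_hh b d be Ux) mulr0.
  by rewrite (Gam_hh a j d Ux) mul0r.
by rewrite !s0 !subrr addr0.
Qed.

(** The quotient rule turns this into the Hessian of [phi] along the horizontal leaf, divided by
    [phi]. *)
Definition hess x : 'M[R]_m := \matrix_(i, j)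
  (pderiv (hi i) (dlog j) x + dlog j x * dlog i x
   - \sum_k Gam (hi i) x (hi j) (hi k) * dlog k x).

Lemma pderiv_delta (k : 'I_(m + n)) (g f : 'rV[R]_(m + n) -> R) (b : bool) x : U x ->
  (forall y, U y -> g y = f y * b%:R) -> pderiv k g x = pderiv k f x * b%:R.
Proof.
move=> Ux gf; case: b gf => gf; last first.
  by rewrite mulr0; apply: pderiv_zero => // y Uy; rewrite gf // mulr0.
rewrite mulr1; apply: near_eq_derive.
by apply: filterS (open_nbhs_nbhs (conj U_open Ux)) => y Uy; rewrite gf // mulr1.
Qed.

Lemma Om_hvhv i al j be x : U x ->
  curvmx Gam (hi i) (vi al) x (hi j) (vi be) = hess x i j * (be == al)%:R.
Proof.
move=> Ux; rewrite Om_entry.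
rewrite (@pderiv_delta _ _ (dlog j) (be == al) x Ux) => [|y Uy]; last first.
  by rewrite Gam_hv // (inj_eq (@rshift_inj m n)).
rewrite (@pderiv_zero (fun y => Gam (hi i) y (hi j) (vi be)) (vi al) x Ux) => [|y Uy];
  last exact: Gam_hh.
rewrite sum_Gam_hv // (Gam_sym (hi i) (vi al)) // Gam_hv // (inj_eq (@rshift_inj m n)).
have -> : \sum_c Gam (hi i) x (hi j) c * Gam (vi al) x c (vi be) =
    \sum_k Gam (hi i) x (hi j) (hi k) * Gam (vi al) x (hi k) (vi be).
  rewrite big_split_ord /= [X in _ + X]big1 ?addr0 // => c _.
  by rewrite (Gam_hh i j c Ux) mul0r.
have -> : \sum_k Gam (hi i) x (hi j) (hi k) * Gam (vi al) x (hi k) (vi be) =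
    (\sum_k Gam (hi i) x (hi j) (hi k) * dlog k x) * (be == al)%:R.
  rewrite mulr_suml; apply: eq_bigr => k _.
  by rewrite Gam_hv // (inj_eq (@rshift_inj m n)) mulrA.
by rewrite mxE; ring.
Qed.

(** The mixed second derivatives of [log phi]; they vanish when [phi] is a function on one factor
    times a function on the other. *)
Definition mixed x : 'M[R]_(m, n) := \matrix_(j, al) pderiv (vi al) (dlog j) x.

(** The two quadratic terms are both [dlog j x] times a Christoffel symbol with lower indices [al]
    and [be], and cancel by torsion freeness. Only derivatives of [dlog] remain. *)
Lemma Om_vvh al be j (c : 'I_(m + n)) x : U x ->
  curvmx Gam (vi al) (vi be) x (hi j) c =
  mixed x j al * (c == vi be)%:R - mixed x j be * (c == vi al)%:R.
Proof.
move=> Ux; rewrite Om_entry !sum_Gam_hv // (Gam_sym (vi al) (vi be) c Ux).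
rewrite [X in _ + X]subrr addr0.
rewrite (@pderiv_delta (vi al) (fun y => Gam (vi be) y (hi j) c)
  (dlog j) (c == vi be) x Ux) => [|y Uy];
  last by rewrite Gam_hv.
rewrite (@pderiv_delta (vi be) (fun y => Gam (vi al) y (hi j) c)
  (dlog j) (c == vi al) x Ux) => [|y Uy];
  last by rewrite Gam_hv.
by rewrite !mxE.
Qed.

Local Notation hor X := (row_mx X (0 : 'rV[R]_n)).
Local Notation ver V := (row_mx (0 : 'rV[R]_m) V).

Lemma sum_hor (X : 'rV[R]_m) (F : 'I_(m + n) -> R) :
  \sum_p hor X 0 p * F p = \sum_(i < m) X 0 i * F (hi i).
Proof.
rewrite big_split_ord /= [X in _ + X]big1 ?addr0 => [|i _].
  by apply: eq_bigr => i _; rewrite row_mxEl.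
by rewrite row_mxEr mxE mul0r.
Qed.

Lemma sum_ver (V : 'rV[R]_n) (F : 'I_(m + n) -> R) :
  \sum_p ver V 0 p * F p = \sum_(i < n) V 0 i * F (vi i).
Proof.
rewrite big_split_ord /= big1 ?add0r => [|i _].
  by apply: eq_bigr => i _; rewrite row_mxEr.
by rewrite row_mxEl mxE mul0r.
Qed.

Lemma Rc_entry N (W : 'I_N -> 'I_N -> 'M[R]_N) (u v w : 'rV[R]_N) d :
  Rc W u v w 0 d = - \sum_p u 0 p * \sum_q v 0 q * \sum_c w 0 c * W p q c d.
Proof.
rewrite /Rc mxE; congr (- _); rewrite summxE; apply: eq_bigr => i _.
rewrite summxE mulr_sumr; apply: eq_bigr => j _.
by rewrite !mxE mulrA.
Qed.

Lemma sum_delta (F : 'I_n -> R) be : \sum_al F al * (be == al)%:R = F be.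
Proof.
rewrite (bigD1 be) //= eqxx mulr1 big1 ?addr0 // => al.
by rewrite eq_sym => /negbTE ->; rewrite mulr0.
Qed.

Lemma inner_ver_r (A' : 'M[R]_m) (C' : 'M[R]_n)
    (y : 'rV[R]_(m + n)) (V : 'rV[R]_n) :
  inner (block_mx A' 0 0 C') y (ver V) = inner C' (rsubmx y) V.
Proof.
by rewrite -{1}[y]hsubmxK ip_row_mx inner0r add0r.
Qed.

Lemma inner_hor_r (A' : 'M[R]_m) (C' : 'M[R]_n)
    (y : 'rV[R]_(m + n)) (X : 'rV[R]_m) :
  inner (block_mx A' 0 0 C') y (hor X) = inner A' (lsubmx y) X.
Proof.
by rewrite -{1}[y]hsubmxK ip_row_mx inner0r addr0.
Qed.

Lemma twisted_osserman_cst x : (0 < m)%N -> (0 < n)%N -> U x ->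
  osserman_at (G x) (Om x) ->
  exists mu, forall u v, Rc (Om x) u v u =
    mu *: (inner (G x) u u *: v - inner (G x) u v *: u).
Proof.
(* Both signs are due to [Rc], which carries the opposite sign of [curvmx]. *)
move=> m0 n0 Ux; apply: (@osserman_cst R m n _ _ (Om x) _ _ _ _ _ (- hess x) (- mixed x)) => //.
- exact: G_sym.
- by move=> v; exact: G_posdef.
- by move=> i j; exact: Om_anti_at.
- exact: (Om_skew_at U_open G_smooth G_sym G_posdef Ux).
- exact: (Om_bianchi_at U_open G_sym Ux).
- move=> X Y Z V; rewrite /r4 inner_ver_r.
  suff -> : rsubmx (Rc (Om x) (hor X) (hor Y) (hor Z)) = 0 by rewrite inner0l.
  apply/rowP => b; rewrite mxE Rc_entry sum_hor big1 ?oppr0 ?mxE // => i _.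
  rewrite sum_hor big1 ?mulr0 // => j _; rewrite sum_hor big1 ?mulr0 // => k _.
  by rewrite Om_hhhv // mulr0.
- move=> X V Y W; rewrite /r4 inner_ver_r.
  have -> : rsubmx (Rc (Om x) (hor X) (ver V) (hor Y)) = inner (- hess x) X Y *: V.
    apply/rowP => b; rewrite mxE Rc_entry sum_hor mxE.
    have -> : inner (- hess x) X Y = - \sum_i X 0 i * \sum_j Y 0 j * hess x i j.
      rewrite /inner mulmxN mulNmx -mulmxA [LHS]mxE mxE; congr (- _).
      apply: eq_bigr => i _; congr (_ * _); rewrite mxE; apply: eq_bigr => j _.
      by rewrite [Y^T _ _]mxE mulrC.
    rewrite mulNr; congr (- _); rewrite mulr_suml; apply: eq_bigr => i _.
    have E al : \sum_c hor Y 0 c * curvmx Gam (hi i) (vi al) x c (vi b) =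
        (\sum_j Y 0 j * hess x i j) * (b == al)%:R.
      rewrite sum_hor mulr_suml; apply: eq_bigr => j _.
      by rewrite Om_hvhv // mulrA.
    rewrite sum_ver (eq_bigr _ (fun al _ => congr1 (fun r => V 0 al * r) (E al))).
    set r := \sum_j Y 0 j * hess x i j; clearbody r.
    rewrite -[LHS]/(X 0 i * _) -mulrA; congr (_ * _).
    rewrite -(sum_delta (fun al => r * V 0 al)); apply: eq_bigr => al _.
    by rewrite mulrCA mulrA.
  by rewrite innerZl.
- move=> V W X Y; rewrite /r4 inner_hor_r.
  suff -> : lsubmx (Rc (Om x) (ver V) (ver W) (hor X)) = 0 by rewrite inner0l.
  apply/rowP => b; rewrite mxE Rc_entry sum_ver big1 ?oppr0 ?mxE // => al _.
  rewrite sum_ver big1 ?mulr0 // => be _; rewrite sum_hor big1 ?mulr0 // => k _.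
  by rewrite Om_vvh // !eq_lrshift !mulr0 subrr mulr0.
- move=> T V X W; rewrite /r4 inner_ver_r.
  have aE (Z : 'rV[R]_n) : (X *m (- mixed x) *m Z^T) 0 0 =
      - \sum_al Z 0 al * \sum_j X 0 j * mixed x j al.
    rewrite mulmxN mulNmx [LHS]mxE mxE; congr (- _); apply: eq_bigr => al _.
    by rewrite !mxE mulrC.
  have -> : rsubmx (Rc (Om x) (ver T) (ver V) (hor X)) =
      (X *m (- mixed x) *m T^T) 0 0 *: V - (X *m (- mixed x) *m V^T) 0 0 *: T.
    apply/rowP => b; rewrite mxE Rc_entry sum_ver [RHS]mxE [in RHS]mxE.
    rewrite [X in _ = _ + X]mxE [X in _ = _ - X]mxE !aE.
    have E al be : \sum_c hor X 0 c * curvmx Gam (vi al) (vi be) x c (vi b) =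
        (\sum_j X 0 j * mixed x j al) * (b == be)%:R -
        (\sum_j X 0 j * mixed x j be) * (b == al)%:R.
      rewrite sum_hor !mulr_suml -sumrB; apply: eq_bigr => j _.
      by rewrite Om_vvh // !(inj_eq (@rshift_inj m n)); ring.
    pose f al := \sum_j X 0 j * mixed x j al; pose s := \sum_be V 0 be * f be.
    have E' al : \sum_q ver V 0 q *
          \sum_c hor X 0 c * curvmx Gam (vi al) q x c (vi b) =
        f al * V 0 b - s * (b == al)%:R.
      rewrite sum_ver (eq_bigr _ (fun be _ => congr1 (fun r => V 0 be * r) (E al be))) -/(f al).
      rewrite -(sum_delta (fun be => f al * V 0 be)) mulr_suml -sumrB.
      apply: eq_bigr => be _; rewrite -/(f be); ring.
    rewrite (eq_bigr _ (fun al _ => congr1 (fun r => T 0 al * r) (E' al))).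
    rewrite -/(f _) -[\sum_(i < n) V 0 i * _]/s; clearbody s; clear E'.
    rewrite !mulNr opprK -[X in _ = _ + X](sum_delta (fun al => s * T 0 al)).
    rewrite mulr_suml -sumrN -[X in _ = X + _]sumrN -big_split; apply: eq_bigr => al _ /=.
    by rewrite -/(f al); move: (f al) => r; ring.
  by rewrite innerDl inner_oppl !innerZl.
Qed.

End TwistedLocal.

(** * Change of charts *)

Section ChartChange.
Variables (R : realType) (N : nat) (W V : set 'rV[R]_N).
Variables (G G' : 'rV[R]_N -> 'M[R]_N) (phi : 'rV[R]_N -> 'rV[R]_N).
Hypothesis W_open : open W.
Hypothesis V_open : open V.
Hypothesis G_smooth : forall i j, smooth_on W (fun x => G x i j).
Hypothesis G_sym : forall x, W x -> (G x)^T = G x.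
Hypothesis G_posdef :
  forall x (v : 'rV[R]_N), W x -> v != 0 -> 0 < (v *m G x *m v^T) 0 0.
Hypothesis G'_smooth : forall i j, smooth_on V (fun x => G' x i j).
Hypothesis G'_sym : forall x, V x -> (G' x)^T = G' x.
Hypothesis G'_posdef :
  forall x (v : 'rV[R]_N), V x -> v != 0 -> 0 < (v *m G' x *m v^T) 0 0.
Hypothesis phi_smooth : forall a, smooth_on W (fun x => phi x 0 a).
Hypothesis phi_V : forall x, W x -> V (phi x).
Local Notation J := (jac phi).
Hypothesis G_pull : forall x, W x -> G x = J x *m G' (phi x) *m (J x)^T.
Implicit Types (x y : 'rV[R]_N) (i j a b : 'I_N).

Lemma phi_continuous x : W x -> {for x, continuous phi}.
Proof.
move=> Wx; apply: (@cvg_mx _ _ (nbhs x) (nbhs_filter x)) => i j; rewrite !ord1.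
by have [c _] := phi_smooth j 0%N; exact: c.
Qed.

Lemma mderiv_comp p q i (B : 'rV[R]_N -> 'M[R]_(p, q)) x : W x -> mx_smooth V B ->
  mderivable i (fun y => B (phi y)) x /\
  mderiv i (fun y => B (phi y)) x = \sum_a J x i a *: mderiv a B (phi x).
Proof.
move=> Wx sB.
have key (c : 'I_p) (d : 'I_q) := @pderiv_comp R N N V (fun y => B y c d) phi x i V_open
  (phi_V Wx) (sB c d) (phi_continuous Wx)
  (fun a => smooth_derivable (phi_smooth a) Wx).
split=> [c d|]; first by have [] := key c d.
apply/matrixP => c d; rewrite mderiv_entry (key c d).2 summxE.
by apply: eq_bigr => a _; rewrite !mxE.
Qed.

Lemma jac_smooth : mx_smooth W (fun x => J x).
Proof.
move=> i a; have -> : (fun x => J x i a) = pderiv i (fun y => phi y 0 a).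
  by apply/funext => x; rewrite mxE.
exact: smooth_on_pderiv.
Qed.

(** Invertibility is read off the pull-back formula: [J x] is a factor of the invertible [G x]. *)
Lemma jac_unit x : W x -> J x \in unitmx.
Proof.
move=> Wx; have := gram_unit G_posdef Wx; rewrite (G_pull Wx) !unitmx_mul.
by case/andP => /andP[].
Qed.

Lemma djac_sym x i j : W x -> row j (mderiv i (fun y => J y) x) = row i (mderiv j (fun y => J y) x).
Proof.
move=> Wx; apply/rowP => a.
have E k l : row l (mderiv k (fun y => J y) x) 0 a = pderiv k (pderiv l (fun y => phi y 0 a)) x.
  rewrite [LHS]mxE mderiv_entry; congr (pderiv k _ x).
  by apply/funext => y; rewrite mxE.
exact: etrans (E i j) (etrans (pderiv_pderivC i j W_open (phi_smooth a) Wx) (esym (E j i))).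
Qed.

Definition pulled i x : 'M[R]_N := \sum_a J x i a *: lcmx G' a (phi x).

Lemma lcmx_target_smooth a : mx_smooth V (lcmx G' a).
Proof. exact: (lcmx_smooth V_open G'_smooth G'_posdef). Qed.

Lemma jac_derivable x i : W x -> mderivable i (fun y => J y) x.
Proof. by move=> Wx; exact: mx_smooth_derivable jac_smooth Wx. Qed.

Lemma jac_entry_derivable x i j a : W x -> derivable (fun y => J y j a) x (delta_mx 0 i).
Proof. by move=> Wx; exact: smooth_derivable (jac_smooth j a) Wx. Qed.

Lemma mderiv_pulled x i j : W x ->
  mderivable i (pulled j) x /\
  mderiv i (pulled j) x =
    \sum_a pderiv i (fun y => J y j a) x *: lcmx G' a (phi x) +
    \sum_a \sum_b (J x i a * J x j b) *: mderiv a (lcmx G' b) (phi x).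
Proof.
move=> Wx; have dt a : mderivable i (fun y => J y j a *: lcmx G' a (phi y)) x.
  apply: mderivableZ; first exact: jac_entry_derivable.
  by have [] := mderiv_comp i Wx (lcmx_target_smooth a).
have [d e] := @mderiv_sum R N N N 'I_N (index_enum 'I_N) i _ x dt.
split; first exact: d.
rewrite /pulled e exchange_big -big_split /=; apply: eq_bigr => a _.
have [d' e'] := mderiv_comp i Wx (lcmx_target_smooth a).
rewrite (mderivZ (@jac_entry_derivable x i j a Wx) d') e'; congr (_ + _).
by rewrite scaler_sumr; apply: eq_bigr => b _; rewrite scalerA mulrC.
Qed.

Lemma pulled_metric x i : W x -> mderiv i (fun y => G' (phi y)) x =
  pulled i x *m G' (phi x) + G' (phi x) *m (pulled i x)^T.
Proof.
move=> Wx; have [_ ->] := mderiv_comp i Wx G'_smooth.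
have -> : (pulled i x)^T = \sum_a J x i a *: (lcmx G' a (phi x))^T.
  rewrite /pulled; apply/matrixP => c d; rewrite mxE !summxE.
  by apply: eq_bigr => a _; rewrite !mxE.
rewrite mulmx_suml mulmx_sumr -big_split; apply: eq_bigr => a _ /=.
rewrite (lcmx_metric V_open G'_sym G'_posdef a (phi_V Wx)).
by rewrite -scalemxAl -scalemxAr -scalerDr.
Qed.

(** The connection of the target chart written in the coordinate frame of the source chart, that is,
    its gauge transform by the Jacobian. Being torsion free and metric for [G], it must be the
    Levi-Civita connection there. *)
Definition gauge i x : 'M[R]_N := (mderiv i (fun y => J y) x + J x *m pulled i x) *m invmx (J x).

Lemma gaugeJ x i : W x -> gauge i x *m J x = mderiv i (fun y => J y) x + J x *m pulled i x.
Proof. by move=> Wx; rewrite /gauge mulmxKV // jac_unit. Qed.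

Lemma gauge_torsion_free : torsion_free W gauge.
Proof.
move=> x i j Wx; rewrite /gauge !row_mul !row_addmx (djac_sym i j Wx).
congr ((_ + _) *m _); rewrite !row_mul !mulmx_sum_row.
have E k l : \sum_c (row k (J x)) 0 c *: row c (pulled l x) =
    \sum_c \sum_a (J x k c * J x l a) *: row c (lcmx G' a (phi x)).
  apply: eq_bigr => c _; rewrite [X in X *: _]mxE.
  have -> : row c (pulled l x) = \sum_a J x l a *: row c (lcmx G' a (phi x)).
    apply/rowP => d; rewrite /pulled mxE !summxE.
    by apply: eq_bigr => a _; rewrite !mxE.
  by rewrite scaler_sumr; apply: eq_bigr => a _; rewrite scalerA.
rewrite !E exchange_big; apply: eq_bigr => c _; apply: eq_bigr => a _ /=.
by rewrite (lcmx_torsion_free V_open G'_sym a c (phi_V Wx)) mulrC.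
Qed.

Lemma gauge_metric : metric_compat W gauge G.
Proof.
move=> x i Wx; rewrite (mderiv_near i W_open Wx G_pull).
have dJx := @jac_derivable x i Wx; have [dG' _] := mderiv_comp i Wx G'_smooth.
rewrite (mderivM (mderivableM dJx dG') (mderivableT dJx)) (mderivM dJx dG') mderivT.
rewrite (pulled_metric i Wx).
have -> : G x *m (gauge i x)^T = (gauge i x *m G x)^T by rewrite [RHS]trmx_mul G_sym.
have -> : gauge i x *m G x =
    (mderiv i (fun y => J y) x + J x *m pulled i x) *m G' (phi x) *m (J x)^T.
  by rewrite (G_pull Wx) !mulmxA gaugeJ.
rewrite trmx_mul trmxK trmx_mul tr_addmx trmx_mul G'_sym; last exact: phi_V.
move: (mderiv _ _ _) (pulled i x) (J x) (G' (phi x)) => D P K H.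
rewrite !(mulmxDl, mulmxDr, mulmxA); move: (@mulmx R N N N) => mm.
by apply/matrixP => c d; rewrite !addmxE; ring.
Qed.

Lemma lcmxJ x i : W x -> lcmx G i x *m J x = mderiv i (fun y => J y) x + J x *m pulled i x.
Proof.
move=> Wx; rewrite -(lcmx_unique G_sym G_posdef gauge_torsion_free gauge_metric i Wx).
exact: gaugeJ.
Qed.

(** Gauge covariance of curvature as pure algebra. The first hypothesis is the derivative of the
    fourth in direction [i], the second that of the third in direction [j]; both contain the same
    second derivative [Kij], which cancels. *)
Lemma gauge_curvature (Gi Gj dij dji K Ki Kj Kij Ti Tj tij tji : 'M[R]_N) :
  dij *m K + Gj *m Ki = Kij + (Ki *m Tj + K *m tij) ->
  dji *m K + Gi *m Kj = Kij + (Kj *m Ti + K *m tji) ->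
  Gi *m K = Ki + K *m Ti -> Gj *m K = Kj + K *m Tj ->
  (dij - dji + Gj *m Gi - Gi *m Gj) *m K =
  K *m (tij - tji + Tj *m Ti - Ti *m Tj).
Proof.
move=> e1 e2 hi hj.
rewrite !(mulmxDl, mulmxDr, mulNmx, mulmxN) -[Gj *m Gi *m K]mulmxA hi -[Gi *m Gj *m K]mulmxA hj.
rewrite !mulmxDr !mulmxA hi hj !mulmxDl.
move: e1 e2; move: (@mulmx R N N N) => mm /matrixP e1 /matrixP e2.
apply/matrixP => c d; move: (e1 c d) (e2 c d); rewrite !(addmxE, oppmxE) => {}e1 {}e2.
have -> : mm dij K c d = Kij c d + (mm Ki Tj c d + mm K tij c d) - mm Gj Ki c d.
  by rewrite -e1; ring.
have -> : mm dji K c d = Kij c d + (mm Kj Ti c d + mm K tji c d) - mm Gi Kj c d.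
  by rewrite -e2; ring.
ring.
Qed.

(** [gauge_curvature] applies to [lcmxJ] and its derivatives. In the derivatives of [pulled] the
    terms with second derivatives of [phi] are symmetric in [i] and [j], so they drop out and the
    curvature transforms as a tensor. *)
Lemma curvmxJ x i j : W x -> curvmx (lcmx G) i j x *m J x =
  J x *m \sum_a \sum_b (J x i a * J x j b) *: curvmx (lcmx G') a b (phi x).
Proof.
move=> Wx.
have dL a k : mderivable a (lcmx G k) x.
  exact: mx_smooth_derivable (lcmx_smooth W_open G_smooth G_posdef k) Wx.
have side k l : mderiv k (lcmx G l) x *m J x + lcmx G l x *m mderiv k (fun y => J y) x =
    mderiv k (mderiv l (fun y => J y)) x +
    (mderiv k (fun y => J y) x *m pulled l x + J x *m mderiv k (pulled l) x).
  have dJx := @jac_derivable x k Wx; have [dP _] := mderiv_pulled k l Wx.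
  rewrite -(mderivM (dL k l) dJx) (mderiv_near k W_open Wx (fun y Wy => lcmxJ l Wy)).
  have dd : mderivable k (mderiv l (fun y => J y)) x.
    by apply: mx_smooth_derivable (mx_smooth_mderiv l jac_smooth) Wx.
  by rewrite (mderivD dd (mderivableM dJx dP)) (mderivM dJx dP).
have e2 := side j i; rewrite (mderivC j i W_open Wx jac_smooth) in e2.
rewrite /curvmx (gauge_curvature (side i j) e2 (lcmxJ i Wx) (lcmxJ j Wx)).
congr (_ *m _); have [_ ->] := mderiv_pulled i j Wx; have [_ ->] := mderiv_pulled j i Wx.
have -> : \sum_a pderiv j (fun y => J y i a) x *: lcmx G' a (phi x) =
    \sum_a pderiv i (fun y => J y j a) x *: lcmx G' a (phi x).
  apply: eq_bigr => a _; congr (_ *: _).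
  have E k l : row l (mderiv k (fun y => J y) x) 0 a = pderiv k (fun y => J y l a) x.
    by rewrite [LHS]mxE mderiv_entry.
  have H := congr1 (fun r : 'rV[R]_N => r 0 a) (djac_sym j i Wx).
  exact: etrans (esym (E j i)) (etrans H (E i j)).
have PP k l : pulled k x *m pulled l x =
    \sum_a \sum_b (J x k a * J x l b) *: (lcmx G' a (phi x) *m lcmx G' b (phi x)).
  rewrite /pulled mulmx_suml; apply: eq_bigr => a _; rewrite mulmx_sumr.
  by apply: eq_bigr => b _; rewrite -scalemxAl -scalemxAr scalerA.
have swap (F : 'I_N -> 'I_N -> 'M[R]_N) : \sum_a \sum_b (J x j a * J x i b) *: F a b =
    \sum_a \sum_b (J x i a * J x j b) *: F b a.
  rewrite exchange_big; apply: eq_bigr => a _; apply: eq_bigr => b _.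
  by rewrite mulrC.
rewrite !PP (swap (fun a b => mderiv a (lcmx G' b) (phi x))).
rewrite (swap (fun a b => lcmx G' a (phi x) *m lcmx G' b (phi x))).
rewrite opprD addrACA subrr add0r -!sumrN -!big_split; apply: eq_bigr => a _ /=.
rewrite -!sumrN -!big_split; apply: eq_bigr => b _ /=.
by rewrite !scalerDr !scalerN.
Qed.

(** [(J x)^T *m wedgemx i j *m J x] is the sum of the [wedgemx a b] weighted by [J x i a * J x j b].
    Hence [G *m wedgemx] obeys the transformation law of the curvature, and the factor [mu] is the
    same in both charts. *)
Lemma cst_curv_pull x (mu : R) : W x ->
  (forall a b, curvmx (lcmx G') a b (phi x) = mu *: (G' (phi x) *m wedgemx R a b)) ->
  forall i j, curvmx (lcmx G) i j x = mu *: (G x *m wedgemx R i j).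
Proof.
move=> Wx cG' i j; have JU := jac_unit Wx.
apply: (can_inj (mulmxK JU)); rewrite curvmxJ // (G_pull Wx) -scalemxAl -!mulmxA.
rewrite scalemxAr; congr (_ *m _).
transitivity (mu *: (G' (phi x) *m \sum_a \sum_b (J x i a * J x j b) *: wedgemx R a b)).
  rewrite mulmx_sumr scaler_sumr; apply: eq_bigr => a _.
  rewrite mulmx_sumr scaler_sumr; apply: eq_bigr => b _.
  by rewrite cG' -scalemxAr !scalerA mulrC.
congr (_ *: (_ *m _)); rewrite /wedgemx mulmxBl mulmxBr.
have dm (k l : 'I_N) : (J x)^T *m (delta_mx k l *m J x) = (row k (J x))^T *m row l (J x).
  rewrite -(mul_delta_mx (0 : 'I_1)) tr_row -!mulmxA -rowE mulmxA; congr (_ *m _).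
  by rewrite colE.
rewrite !dm; apply/matrixP => c d.
rewrite summxE.
have -> : \sum_a (\sum_b (J x i a * J x j b) *: (delta_mx b a - delta_mx a b)) c d =
    \sum_a \sum_b (J x i a * J x j b) * (((c == b) && (d == a))%:R - ((c == a) && (d == b))%:R).
  apply: eq_bigr => a _; rewrite summxE; apply: eq_bigr => b _.
  by rewrite !mxE.
have outer (p q : 'rV[R]_N) : (p^T *m q) c d = p 0 c * q 0 d.
  by rewrite mxE big_ord1 mxE.
rewrite [RHS]addmxE oppmxE !outer.
have S1 (F : 'I_N -> 'I_N -> R) (u v : 'I_N) :
    \sum_a \sum_b F a b * ((u == b) && (v == a))%:R = F v u.
  rewrite (bigD1 v) //= (bigD1 u) //= !eqxx mulr1 !big1 ?addr0 //.
    by move=> a /negbTE ne; rewrite big1 // => b _; rewrite [v == a]eq_sym ne andbF mulr0.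
  by move=> b /negbTE ne; rewrite [u == b]eq_sym ne mulr0.
transitivity (\sum_a \sum_b (J x i a * J x j b) * ((c == b) && (d == a))%:R -
   \sum_a \sum_b (J x i a * J x j b) * ((d == b) && (c == a))%:R).
  rewrite -sumrB; apply: eq_bigr => a _; rewrite -sumrB; apply: eq_bigr => b _.
  by rewrite mulrBr [(d == b) && _]andbC.
rewrite (S1 (fun a b => J x i a * J x j b)) (S1 (fun a b => J x i a * J x j b)).
by rewrite ![row _ _ _ _]mxE; ring.
Qed.

End ChartChange.

(** * From pointwise constant to constant curvature *)

Section Schur.
Variables (R : realType) (N : nat) (M : manifold R N) (g : riemannian_metric M).
Hypothesis N_gt2 : (2 < N)%N.
Implicit Types (p q : M) (c d : atlas M).

Local Notation curv c i j := (curvmx (lcmx (gram g c)) i j).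

Definition cst_curv c (x : 'rV[R]_N) (mu : R) :=
  forall i j, curv c i j x = mu *: (gram g c x *m wedgemx R i j).

Lemma transition_dom_open c d : open (transition_dom (chart_of c) (chart_of d)).
Proof.
rewrite openE => x [tx sx].
have nt := open_nbhs_nbhs (conj (@target_open _ _ _ (chart_of c)) tx).
have ns := open_nbhs_nbhs (conj (@source_open _ _ _ (chart_of d)) sx).
exact: filterI nt (of_coord_continuous tx ns).
Qed.

Lemma cst_curv_chart p c d mu : source (chart_of c) p -> source (chart_of d) p ->
  cst_curv d (to_coord (chart_of d) p) mu -> cst_curv c (to_coord (chart_of c) p) mu.
Proof.
move=> sc sd cd; pose W := transition_dom (chart_of c) (chart_of d).
have WT x : W x -> target (chart_of c) x by case.
have Wx : W (to_coord (chart_of c) p).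
  by split; [exact: to_coord_target|rewrite to_coordK].
apply: (@cst_curv_pull R N W (target (chart_of d)) (gram g c) (gram g d)
  (transition (chart_of c) (chart_of d))) => //.
- exact: transition_dom_open.
- exact: target_open.
- by move=> i j; apply: smooth_on_sub (gram_smooth g c i j) => x /WT.
- by move=> x /WT; exact: gram_sym.
- by move=> x v /WT; exact: gram_posdef.
- exact: gram_smooth.
- exact: gram_sym.
- exact: gram_posdef.
- by move=> a; exact: chart_compat.
- by move=> x [_ sx]; exact: to_coord_target.
- by move=> x Wx'; exact: gram_compat.
- by rewrite /transition to_coordK.
Qed.

Let i0 : 'I_N := Ordinal (ltn_trans (isT : 0 < 2)%N N_gt2).
Let i1 : 'I_N := Ordinal (ltn_trans (isT : 1 < 2)%N N_gt2).

(** One entry recovers the constant: at row [i1] and column [i0], the matrix [G *m wedgemx i0 i1]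
    has the positive entry [G i1 i1]. A constant chosen point by point would carry no smoothness;
    this quotient does. *)
Definition kapf c (x : 'rV[R]_N) : R := curv c i0 i1 x i1 i0 / gram g c x i1 i1.

Lemma gram_diag_neq0 c x i : target (chart_of c) x -> gram g c x i i != 0.
Proof.
move=> tx; rewrite -inner_delta gt_eqF //; apply: gram_posdef => //.
by apply/negP => /eqP/rowP/(_ i); rewrite !mxE !eqxx => /eqP; rewrite oner_eq0.
Qed.

Lemma cst_curv_kapf c x mu : target (chart_of c) x -> cst_curv c x mu -> mu = kapf c x.
Proof.
move=> tx H; have G0 := gram_diag_neq0 i1 tx.
have row_delta (A : 'M[R]_N) (a b k l : 'I_N) : (A *m delta_mx a b) k l = A k a * (l == b)%:R.
  rewrite mxE (bigD1 a) //= big1 ?addr0 ?mxE ?eqxx // => e /negbTE ne.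
  by rewrite mxE ne mulr0.
rewrite /kapf H mxE /wedgemx mulmxBr addmxE oppmxE !row_delta eqxx mulr1.
by rewrite -[i0 == i1]/false mulr0 subr0 mulfK.
Qed.

Lemma kapf_smooth c : smooth_on (target (chart_of c)) (kapf c).
Proof.
have oT := @target_open _ _ _ (chart_of c); have sG := gram_smooth g c.
have sL k : mx_smooth (target (chart_of c)) (lcmx (gram g c) k).
  by apply: lcmx_smooth => // x v; exact: gram_posdef.
apply: smooth_onM => //; last first.
  by apply: smooth_onV => // x; exact: gram_diag_neq0.
have sM := mx_smoothM oT.
have E : (fun x => curv c i0 i1 x i1 i0) = (fun x =>
   mderiv i0 (lcmx (gram g c) i1) x i1 i0 - mderiv i1 (lcmx (gram g c) i0) x i1 i0 +
   (lcmx (gram g c) i1 x *m lcmx (gram g c) i0 x) i1 i0 -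
   (lcmx (gram g c) i0 x *m lcmx (gram g c) i1 x) i1 i0).
  apply/funext => x; rewrite /curvmx.
  move: (mderiv _ _ _) (mderiv _ _ _) (_ *m _) (_ *m _) => p q r s.
  by rewrite !(addmxE, oppmxE).
rewrite E; apply: smooth_onB => //; last exact: sM.
apply: smooth_onD => //; last exact: sM.
by apply: smooth_onB => //; exact: mx_smooth_mderiv.
Qed.

Hypothesis pointwise_cst : forall p c, source (chart_of c) p ->
  exists mu, cst_curv c (to_coord (chart_of c) p) mu.

Lemma cst_curv_all c x : target (chart_of c) x -> cst_curv c x (kapf c x).
Proof.
move=> tx; have [mu] := pointwise_cst (of_coord_source tx).
by rewrite of_coordK // => H; rewrite -(cst_curv_kapf tx H).
Qed.

Lemma kapf_pderiv c x k : target (chart_of c) x -> pderiv k (kapf c) x = 0.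
Proof.
move=> tx; have oT := @target_open _ _ _ (chart_of c).
have pG x' (v : 'rV[R]_N) : target (chart_of c) x' -> v != 0 ->
  0 < (v *m gram g c x' *m v^T) 0 0 by exact: gram_posdef.
have sG := gram_smooth g c; have yG := gram_sym g (c := c).
apply: (schur_local oT (lcmx_smooth oT sG pG) k N_gt2 (lcmx_torsion_free oT yG)
  (lcmx_metric oT yG pG) sG) => //.
- by move=> y ty; exact: (gram_unit (U := target (chart_of c)) pG ty).
- by move=> y i j ty; exact: cst_curv_all.
- by move=> i; exact: smooth_derivable (kapf_smooth c) tx.
Qed.

(** [K] is computed in a chart chosen at each point, but the change of charts makes the value
    independent of the choice. Near a given point one fixed chart can thus be used, and there all
    partial derivatives vanish on a cube. *)
Lemma schur_function : exists K : M -> R,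
  (forall p, \forall q \near p, K q = K p) /\
  (forall p c mu, source (chart_of c) p ->
     cst_curv c (to_coord (chart_of c) p) mu -> mu = K p).
Proof.
pose ch p := sval (cid (chart_cover p)).
have chP p : source (chart_of (ch p)) p by exact: (svalP (cid (chart_cover p))).
pose K p := kapf (ch p) (to_coord (chart_of (ch p)) p).
have KP p c mu : source (chart_of c) p ->
    cst_curv c (to_coord (chart_of c) p) mu -> mu = K p.
  move=> sc cm; have tp := to_coord_target (chP p).
  have := cst_curv_chart sc (chP p) (cst_curv_all tp).
  move=> /(cst_curv_kapf (to_coord_target sc)); rewrite -/(K p) => ->.
  exact: cst_curv_kapf (to_coord_target sc) cm.
exists K; split=> // p; set c := ch p; set x := to_coord (chart_of c) p.
have sp : source (chart_of c) p by exact: chP.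
have tx : target (chart_of c) x by exact: to_coord_target.
have [r r0 rT] := nbhs_box (open_nbhs_nbhs (conj (@target_open _ _ _ (chart_of c)) tx)).
have n1 : nbhs p (source (chart_of c)).
  exact: open_nbhs_nbhs (conj (@source_open _ _ _ (chart_of c)) sp).
have n2 : nbhs p [set q | box x r (to_coord (chart_of c) q)].
  by apply: (to_coord_continuous sp); exact: box_nbhs.
apply: filterS (filterI n1 n2) => q [sq bq].
have -> : K q = kapf c (to_coord (chart_of c) q).
  exact/esym/(KP q c _ sq (cst_curv_all (to_coord_target sq))).
apply: (pderiv0_cst _ bq) => y i /rT ty; split; last exact: kapf_pderiv.
exact: smooth_derivable (kapf_smooth c) ty.
Qed.

End Schur.

(** * Locally constant functions *)

Lemma locally_cst_connected (T : topologicalType) (V : Type) (h : T -> V) :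
  connected [set: T] -> (forall x, \forall y \near x, h y = h x) ->
  forall x y, h x = h y.
Proof.
move=> cT lh x y; pose S := [set z | h z = h x].
have oS : open S.
  by rewrite openE => z Sz; apply: filterS (lh z) => w /= hw; rewrite /S /= hw.
have cS : closed S.
  rewrite -openC openE => z Sz; apply: filterS (lh z) => w /= hw hx.
  by apply: Sz; rewrite /S /= -hw.
have ST : S = setT.
  apply: cT; first by exists x.
  - by exists S => //; rewrite setTI.
  - by exists S => //; rewrite setTI.
by have : S y by rewrite ST.
Qed.

(** One coordinate is moved at a time, so connectedness of each factor is applied to a slice. *)
Lemma locally_cst_prod (S T : topologicalType) (V : Type) (h : S * T -> V) :
  connected [set: S] -> connected [set: T] ->
  (forall x, \forall y \near x, h y = h x) -> forall x y, h x = h y.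
Proof.
move=> cS cT lh [s t] [s' t']; transitivity (h (s', t)).
  apply: (@locally_cst_connected S V (fun a => h (a, t)) cS) => a.
  by have := lh (a, t); apply: (cvg_pair cvg_id (cvg_cst t)).
apply: (@locally_cst_connected T V (fun b => h (s', b)) cT) => b.
by have := lh (s', b); apply: (cvg_pair (cvg_cst s') cvg_id).
Qed.

(** * Independence of two vectors and the Gram determinant *)

Section SectionalDenominator.
Variables (R : realType) (N : nat) (G : 'M[R]_N).
Hypothesis G_sym : G^T = G.
Hypothesis G_posdef : forall v : 'rV[R]_N, v != 0 -> 0 < (v *m G *m v^T) 0 0.
Implicit Types u v : 'rV[R]_N.
Local Notation ip := (inner G).

Lemma row_free_col2 u v : row_free (col_mx u v) <->
  (forall a b : R, a *: u + b *: v = 0 -> a = 0 /\ b = 0).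
Proof.
have E (a b : R) : row_mx a%:M b%:M *m col_mx u v = a *: u + b *: v.
  by rewrite mul_row_col !mul_scalar_mx.
split=> [fr a b e|H].
  have : row_mx a%:M b%:M == 0 :> 'rV[R]_(1 + 1).
    by rewrite -(mulmx_free_eq0 _ fr) E e.
  rewrite -row_mx0 => /eqP/eq_row_mx[/matrixP/(_ 0 0) a0 /matrixP/(_ 0 0) b0].
  by move: a0 b0; rewrite !mxE eqxx.
apply: inj_row_free => w; rewrite -[w]hsubmxK.
rewrite [lsubmx w]mx11_scalar [rsubmx w]mx11_scalar E => /H[-> ->].
have -> : (0 : R)%:M = 0 :> 'M[R]_1 by apply/matrixP => i j; rewrite !mxE mul0rn.
exact: row_mx0.
Qed.

(** The Gram-Schmidt vector [w], cleared of its denominator, is nonzero, and [ip w w] is [ip u u]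
    times the determinant. *)
Lemma gram_det_neq0 u v : row_free (col_mx u v) -> ip u u * ip v v - ip u v ^+ 2 != 0.
Proof.
move=> /row_free_col2 fr.
have u0 : u != 0.
  apply/negP => /eqP u0; have [|/eqP] := fr 1 0; last by rewrite oner_eq0.
  by rewrite u0 scaler0 scale0r addr0.
have uu : 0 < ip u u by exact: inner_gt0.
pose w := - ip u v *: u + ip u u *: v.
have w0 : w != 0.
  by apply/negP => /eqP /fr [_ /eqP]; rewrite gt_eqF.
have ww : ip w w = ip u u * (ip u u * ip v v - ip u v ^+ 2).
  rewrite /w !(innerDl, innerDr, innerZl, innerZr) (innerC G_sym v u); ring.
apply: contraTneq (inner_gt0 G_posdef w0) => e.
by rewrite ww e mulr0 ltxx.
Qed.

Lemma dependent_vectors u v : ~~ row_free (col_mx u v) ->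
  u = 0 \/ exists a, v = a *: u.
Proof.
move=> nf; have [->|u0] := eqVneq u 0; [by left|right].
apply: contrapT => nv; move/negP: nf; apply; apply/row_free_col2 => a b e.
have b0 : b = 0.
  apply/eqP; apply: contraT => bn; case: nv; exists (- (b^-1 * a)).
  apply: (scalerI bn); rewrite scalerA mulrN mulrA divff // mul1r scaleNr.
  by apply/eqP; rewrite -addr_eq0 addrC e.
split=> //; move: e; rewrite b0 scale0r addr0 => /eqP.
by rewrite scaler_eq0 (negbTE u0) orbF => /eqP.
Qed.

End SectionalDenominator.

(** * Curvature conditions at a point of a manifold *)

Section ManifoldCurvature.
Variables (R : realType) (N : nat) (M : manifold R N) (g : riemannian_metric M).
Variables (p : M) (c : atlas M).
Hypothesis source_p : source (chart_of c) p.
Implicit Types u v w : 'rV[R]_N.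

Local Notation x := (to_coord (chart_of c) p).
Local Notation G := (gram g c).
Local Notation Om := (fun i j => curvmx (lcmx G) i j x).

Let oT := @target_open _ _ _ (chart_of c).
Let tx : target (chart_of c) x. Proof. exact: to_coord_target. Qed.
Let sG := gram_smooth g c.
Let yG : forall y, target (chart_of c) y -> (G y)^T = G y.
Proof. exact: gram_sym. Qed.
Let pG : forall y v, target (chart_of c) y -> v != 0 -> 0 < (v *m G y *m v^T) 0 0.
Proof. exact: gram_posdef. Qed.
Let anti := Om_anti_at G x.
Let skew := Om_skew_at oT sG yG pG tx.
Let bianchi := Om_bianchi_at oT yG tx.

Definition Rc_constant (mu : R) := forall u v,
  Rc Om u v u = mu *: (inner (G x) u u *: v - inner (G x) u v *: u).

Lemma Rc_constant_curv mu : Rc_constant mu -> cst_curv g c x mu.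
Proof.
move=> H i j.
exact: (Om_cst (yG tx) i j (Rc_cst (yG tx) anti bianchi H)).
Qed.

Lemma sectionalE u v : sectional G x u v = r4 (G x) Om u v u v /
  (inner (G x) u u * inner (G x) v v - inner (G x) u v ^+ 2).
Proof. by rewrite /sectional (curvature_atE oT sG pG). Qed.

Lemma Rc_constant_sectional mu u v : Rc_constant mu -> row_free (col_mx u v) ->
  sectional G x u v = mu.
Proof.
move=> H fr; rewrite sectionalE /r4 H innerZl innerDl inner_oppl !innerZl -expr2.
by rewrite mulfK // (gram_det_neq0 (yG tx)) // => w; exact: pG.
Qed.

Lemma sectional_Rc_constant mu :
  (forall u v, row_free (col_mx u v) -> sectional G x u v = mu) -> Rc_constant mu.
Proof.
move=> H; apply: (sectional_Rc (yG tx) _ anti skew bianchi) => [v|u v]; first exact: pG.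
have [fr|nf] := boolP (row_free (col_mx u v)).
  have d0 : inner (G x) u u * inner (G x) v v - inner (G x) u v ^+ 2 != 0.
    by apply: gram_det_neq0 => // [|w]; [exact: yG|exact: pG].
  by rewrite -(H u v fr) sectionalE divfK.
(* For dependent vectors the hypothesis is silent; both sides of the goal vanish, the left one by
   skew symmetry. *)
have r0 : r4 (G x) Om u u u u = 0.
  have := r4C12 (G x) anti u u u u => /eqP.
  by rewrite -addr_eq0 -mulr2n mulrn_eq0 /= => /eqP.
have [->|[a ->]] := dependent_vectors nf.
  have := r4Z1 (G x) Om 0 0 v 0 v; rewrite scale0r mul0r => ->.
  by rewrite !inner0l mul0r expr0n subr0 mulr0.
rewrite (r4Z2 (G x) anti) r4Z4 r0 !innerZl !innerZr; ring.
Qed.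

Lemma osserman_atE : osserman_at (G x) Om <->
  (forall u v, inner (G x) u u = 1 -> inner (G x) v v = 1 -> forall a : R,
    \rank (eigenspace (jacobi G x u) a) = \rank (eigenspace (jacobi G x v) a)).
Proof.
have jE u : jacobi G x u = Jac Om u by exact: jacobiE oT sG pG _ _ tx.
by split=> H u v u1 v1 a; have := H u v u1 v1 a; rewrite !jE.
Qed.

Lemma Rc_constant_osserman mu : Rc_constant mu -> osserman_at (G x) Om.
Proof.
move=> H; apply: (cst_osserman (yG tx) _ anti H).
by move=> v; exact: pG.
Qed.

End ManifoldCurvature.

Theorem theorem1p2 (R : realType) (m n : nat)
    (m_gt0 : (0 < m)%N) (n_gt0 : (0 < n)%N) (dim_ge3 : (3 <= m + n)%N)
    (B : manifold R m) (F : manifold R n)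
    (B_connected : connected [set: B]) (F_connected : connected [set: F])
    (gB : riemannian_metric B) (gF : riemannian_metric F)
    (f : product_manifold B F -> R)
    (f_gt0 : forall p, 0 < f p) (f_smooth : smooth_function f) :
  pointwise_osserman (twisted_product gB gF f_gt0 f_smooth) <->
  constant_sectional_curvature (twisted_product gB gF f_gt0 f_smooth).
Proof.
set g := twisted_product gB gF f_gt0 f_smooth; split=> [oss|[kappa sec] p c sp]; last first.
  apply/(osserman_atE g sp).
  apply: (Rc_constant_osserman sp (mu := kappa)).
  by apply: sectional_Rc_constant => // u v; exact: sec.
have cst p c : source (chart_of c) p -> exists mu, Rc_constant g p c mu.
  move=> sp; have tx := to_coord_target sp.
  apply: (@twisted_osserman_cst R m n (target (chart_of c.1)) (target (chart_of c.2))
    (gram gB c.1) (gram gF c.2) (fun x => f (of_coord (chart_of c) x))) => //.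
  - exact: (@target_open _ _ _ (chart_of c)).
  - by move=> x; rewrite gt_eqF.
  - exact: f_smooth.
  - exact: (gram_smooth g c).
  - exact: (@gram_sym _ _ _ g c).
  - exact: (@gram_posdef _ _ _ g c).
  - by apply/(osserman_atE g sp) => u v; exact: oss.
have [K [lK KP]] : exists K : product_manifold B F -> R,
    (forall p, \forall q \near p, K q = K p) /\
    (forall p c mu, source (chart_of c) p ->
       cst_curv g c (to_coord (chart_of c) p) mu -> mu = K p).
  apply: schur_function => // p c sp; have [mu H] := cst p c sp.
  by exists mu; exact: Rc_constant_curv.
have Kc := locally_cst_prod B_connected F_connected lK.
(* The constant is the value of [K] at some point. If the product is empty, any number serves, and 0
   is taken. *)
have [[p0 _]|noB] := pselect (exists p : product_manifold B F, True); last first.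
  by exists 0 => p; case: noB; exists p.
exists (K p0) => p c sp u v fr; have [mu H] := cst p c sp.
rewrite (Rc_constant_sectional sp H fr) (Kc p0 p).
exact: KP sp (Rc_constant_curv sp H).
Qed.
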